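(* Let $\mathcal{P}$ be a finite polysquare translation surface, and let $\mathcal{M}=\mathcal{P}\times[0,1)$ be the associated polycube translation $3$-manifold, the cartesian product of $\mathcal{P}$ and the unit torus $[0,1)$. Let $\mathbf{v}=(v_1,v_2)\in\mathbb{R}^2$ be the step vector of a Kronecker sequence on $\mathcal{P}$, i.e. $v_1,v_2,1$ are linearly independent over $\mathbb{Q}$. Then the following statements are equivalent: (i) Every half-infinite Kronecker sequence with step vector $\mathbf{v}$ on $\mathcal{P}$ is uniformly distributed on $\mathcal{P}$. (ii) For any $w\in\mathbb{R}$ such that $\mathbf{w}=(\mathbf{v},w)=(v_1,v_2,w)\in\mathbb{R}^3$ is the step vector of a Kronecker sequence on $\mathcal{M}$, i.e. such that $v_1,v_2,w,1$ are linearly independent over $\mathbb{Q}$, every half-infinite Kronecker sequence with step vector $\mathbf{w}$ in $\mathcal{M}$ is uniformly distributed in $\mathcal{M}$.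
   Context: A finite polysquare translation surface $\mathcal{P}$ is a connected surface obtained from finitely many, say $s$, unit squares with sides parallel to the axes (the atomic squares) by identifying their edges in pairs by translations (right edges with left edges, top edges with bottom edges). Its singularities are the vertices with total cone angle different from $2\pi$. The manifold $\mathcal{M}=\mathcal{P}\times[0,1)$, where $[0,1)=\mathbb{R}/\mathbb{Z}$ is the unit torus, consists of $s$ atomic cubes (atomic square times $[0,1)$); its singularities are the points $(p,z)$ with $p$ a singularity of $\mathcal{P}$. $\lambda_k$ denotes $k$-dimensional Lebesgue measure, so $\lambda_2(\mathcal{P})=\lambda_3(\mathcal{M})=s$. Geodesics: a geodesic $\mathcal{L}(t)$ on $\mathcal{P}$ or $\mathcal{M}$ with a given direction is the unit speed straight line motion in that direction, continued through the identifications; it is half-infinite if it is defined for all $t\ge0$, i.e. it does not hit a singularity. Kronecker sequences: given a starting point $\mathbf{x}_0$ and a step vector $\mathbf{u}$ (equal to $\mathbf{v}$ on $\mathcal{P}$, or $\mathbf{w}$ in $\mathcal{M}$), let $\mathcal{L}(t)$ be the geodesic with $\mathcal{L}(0)=\mathbf{x}_0$ and direction $\mathbf{u}$. The Kronecker sequence is $\mathbf{x}_0+j\mathbf{u}=\mathcal{L}(jg)$, $j=0,1,2,\ldots$, with time step $g=|\mathbf{u}|$. It is half-infinite if and only if the supporting geodesic is half-infinite (does not hit a singularity). Uniform distribution: a sequence $\mathbf{x}_0,\mathbf{x}_1,\ldots$ on $\mathcal{P}$ (resp. in $\mathcal{M}$) is uniformly distributed if for every convex set $S$ contained in an atomic square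 (resp. atomic cube), $\frac1J|\{0\le j\le J-1:\mathbf{x}_j\in S\}|\to\lambda(S)/s$ as $J\to\infty$, where $\lambda=\lambda_2$ (resp. $\lambda=\lambda_3$). *)

(* Defs.v *)
From HB Require Import structures.
From mathcomp Require Import all_boot all_order all_algebra all_fingroup.
From mathcomp Require Import all_classical all_reals all_analysis.
Set Implicit Arguments.
Unset Strict Implicit.
Unset Printing Implicit Defensive.
Import Order.TTheory GRing.Theory Num.Theory.
Import numFieldNormedType.Exports.
Local Open Scope classical_set_scope.
Local Open Scope ring_scope.

(* The right edge of square i is glued to the left edge of square [right_of i],
   its top edge to the bottom edge of square [up_of i]. *)
Record polysquare (s : nat) := Polysquare {
  right_of : {perm 'I_s};
  up_of : {perm 'I_s};
  polysquare_gt0 : (0 < s)%N;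
  polysquare_connected : forall i j : 'I_s,
    connect (fun a b => [|| right_of a == b, right_of b == a,
                            up_of a == b | up_of b == a])
      i j }.

Definition perm_zpow (T : finType) (p : {perm T}) (n : int) : {perm T} :=
  match n with Posz k => (p ^+ k)%g | Negz k => (p ^- k.+1)%g end.

Definition fracpart {R : realType} (x : R) : R := x - (Num.floor x)%:~R.

(* A point of the surface is (i, (x, y)) with i a square and x, y in [0, 1[;
   thus an edge point is attributed to the square on its right or above it.
   A vertex is represented by the squares of which it is the lower left corner:
   once if its cone angle is 2 pi, and several times if it is a singularity. *)
Definition surface_point (R : realType) (s : nat) : Type := ('I_s * (R * R))%type.

Section Surface.
Context {R : realType} {s : nat} (P : polysquare s).

(* The squares met in one counterclockwise turn around the lower left corner of
   i are i, its left neighbour, the one below, the one to the right, and the one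
   above; the angle is 2 pi for each turn needed to come back to i. *)
Definition corner_turn (i : 'I_s) : 'I_s :=
  up_of P (right_of P ((up_of P)^-1%g ((right_of P)^-1%g i))).

Definition cone_angle (i : 'I_s) : R := 2 * pi * (fingraph.order corner_turn i)%:R.

Definition singular (p : surface_point R s) : Prop :=
  p.2 = (0, 0) /\ cone_angle p.1 <> 2 * pi.

Definition regular_points : set (surface_point R s) :=
  [set p | (`[0, 1[ `*` `[0, 1[) p.2 /\ ~ singular p].

(* The point of the surface with coordinates x relative to the lower left corner
   of square i; x may lie in the closed square i or be slightly outside it. *)
Definition chart (i : 'I_s) (x : R * R) : surface_point R s :=
  (perm_zpow (up_of P) (Num.floor x.2) (perm_zpow (right_of P) (Num.floor x.1) i),
   (fracpart x.1, fracpart x.2)).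

(* At a regular point p this is the flat chart centred at p, for small d: if p is
   a vertex then it has cone angle 2 pi, so that [right_of P] and [up_of P] commute
   around it and the order of the two moves in [chart] is irrelevant. *)
Definition displace (p : surface_point R s) (d : R * R) : surface_point R s :=
  chart p.1 (p.2 + d).

(* The third coordinate is in [0, 1[, standing for R/Z. *)
Definition regular_points3 : set (surface_point R s * R) :=
  regular_points `*` `[0, 1[.

Definition chart3 (i : 'I_s) (x : R * R * R) : surface_point R s * R :=
  (chart i x.1, fracpart x.2).

Definition displace3 (q : surface_point R s * R) (d : R * R * R) : surface_point R s * R :=
  (displace q.1 d.1, fracpart (q.2 + d.2)).

End Surface.

(* The library norm on a product is the maximum norm, hence these. *)
Definition euclid2 {R : realType} (v : R * R) : R :=
  Num.sqrt (v.1 ^+ 2 + v.2 ^+ 2).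
Definition euclid3 {R : realType} (w : R * R * R) : R :=
  Num.sqrt (w.1.1 ^+ 2 + w.1.2 ^+ 2 + w.2 ^+ 2).

(* [L] is only relevant on [0, +oo[: around each of its points it is, in the flat
   chart, the affine motion with velocity u. *)
Definition halfinf_geodesic {R : realType} {V : lmodType R} {X : Type}
    (reg : set X) (displ : X -> V -> X) (u : V) (L : R -> X) : Prop :=
  forall t : R, 0 <= t ->
    reg (L t) /\
    \forall t' \near t, 0 <= t' -> L t' = displ (L t) ((t' - t) *: u).

Section Kronecker.
Context {R : realType} {s : nat} (P : polysquare s).

Definition halfinf_kronecker (v : R * R) (x : nat -> surface_point R s) : Prop :=
  exists L : R -> surface_point R s,
    halfinf_geodesic (regular_points P) (displace P) ((euclid2 v)^-1 *: v) L /\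
    forall j : nat, x j = L (j%:R * euclid2 v).

Definition halfinf_kronecker3 (w : R * R * R) (x : nat -> surface_point R s * R) : Prop :=
  exists L : R -> surface_point R s * R,
    halfinf_geodesic (regular_points3 P) (displace3 P) ((euclid3 w)^-1 *: w) L /\
    forall j : nat, x j = L (j%:R * euclid3 w).

Definition visit_freq {X : Type} (x : nat -> X) (A : set X) (J : nat) : R :=
  #|[pred j : 'I_J | x j \in A]|%:R / J%:R.

(* A non-Borel convex set is still given its Lebesgue measure by these: every
   section is an interval, and the integral of the section lengths, a lower
   integral for nonmeasurable integrands, ignores the null boundary. *)
Definition lambda2 : set (R * R) -> \bar R :=
  (lebesgue_measure \x lebesgue_measure)%E.
Definition lambda3 : set (R * R * R) -> \bar R :=
  (lambda2 \x lebesgue_measure)%E.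

(* [chart P i @` S] is the subset of the surface formed by the points of the
   convex subset S of the closed square i. *)
Definition unif_distributed (x : nat -> surface_point R s) : Prop :=
  forall (i : 'I_s) (S : set (R * R)),
    convex_set S -> S `<=` `[0, 1] `*` `[0, 1] ->
    visit_freq x (chart P i @` S) @ \oo --> fine (lambda2 S) / s%:R.

Definition unif_distributed3 (x : nat -> surface_point R s * R) : Prop :=
  forall (i : 'I_s) (S : set (R * R * R)),
    convex_set S -> S `<=` (`[0, 1] `*` `[0, 1]) `*` `[0, 1[ ->
    visit_freq x (chart3 P i @` S) @ \oo --> fine (lambda3 S) / s%:R.

End Kronecker.

Definition lin_indep_rat {R : realType} {n : nat} (x : n.-tuple R) : Prop :=
  forall a : 'I_n -> rat,
    \sum_(i < n) ratr (a i) * tnth x i = 0 -> forall i, a i = 0.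

(* Main.v *)
Require Import Defs.
From HB Require Import structures.
From mathcomp Require Import all_boot all_order all_algebra all_fingroup.
From mathcomp Require Import all_classical all_reals all_analysis.
From mathcomp.real_closed Require Import complex.
From mathcomp Require Import zify ring lra.
Import Order.TTheory GRing.Theory Num.Theory.
Import numFieldNormedType.Exports.
Local Open Scope ring_scope.
Set Implicit Arguments.
Unset Strict Implicit.
Unset Printing Implicit Defensive.

(** Linear independence makes the third coordinate a rotation that has no
    frequency in common with the translation of the torus by [(v1, v2)]. The
    point of the proof is that the surface, although its flow may have
    eigenvalues that the torus does not have, cannot have this frequency or a
    nonzero multiple of it, because it covers the torus with finitely many sheets.

    From the 3-manifold down to the surface, the span of [v1], [v2] and 1 over the
    rationals is countable, so some [w] lies outside it ([exists_independent]); an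
    orbit on the surface is lifted with this [w], and tested against the cylinder
    over a convex set ([kronecker_lift], [unif_distributed_base]).

    In the other direction, an orbit in the 3-manifold is [(x j, z j)] with [x] an
    orbit on the surface, uniformly distributed by assumption, and [z] a rotation
    by [w]. By Weyl's criterion in the last coordinate it is enough that step
    functions of [x j] do not correlate with [e j = cexp (j * theta)], where
    [theta] is a nonzero integer multiple of [w]. Correlation is measured by a
    mean [m], the limit of Cesaro means along an ultrafilter
    ([avg_cvg_of_means]), so that a single orbit plays the part of an invariant
    measure. In the seminorm [m (|.|^2)], project [e] orthogonally onto the
    closure of the step functions. The shift preserves this closure:
    the flow for [h] units of time carries most of the small cells into cells and
    permutes the sheets above them, as long as it keeps away from the vertices
    ([motion_cellwise_dynamics]). Since the shift multiplies [e] by [cexp theta],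
    it does the same to its projection. So the projection is an eigenfunction on
    the surface, and the [n]-th elementary symmetric function of its values on
    the [s] sheets is an eigenfunction on the torus, with frequency [n * theta].
    All frequencies on the torus are integer combinations of [v1], [v2] and 1, so
    these symmetric functions vanish for [n >= 1], and with them the projection,
    which is a root of a polynomial with these coefficients. Hence [e] is
    orthogonal to the step functions ([cell_indicator_orthogonal]).

    Sequences with a mean do not form a complete space, so the projection is
    replaced by step functions whose distance to [e] is nearly minimal, and
    every equality above holds up to an error that can be made small:
    [near_minimizer_eigen] gives the eigenvalue equation, [elem_sym_eigen] passes
    to symmetric functions, [torus_nonresonant_small] excludes the frequencies
    and [near_minimizer_small] concludes.

    It follows that the orbit visits all small cubes above all cells of the
    sheets equally often. A convex set and its boundary are finally compared to
    cubes of side [1/N]: only [O(N ^ 2)] of them meet the set without being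
    contained in it ([boundary_cells_count]), and both the frequency of the visits
    and the volume lie between those of the inner and of the outer cubes
    ([skew_unif_distributed]). *)

(** * Cesaro means along ultrafilters *)

Section BoundedSequences.
Context {R : realType}.
Implicit Types a b : nat -> R.

Definition bdd a : Prop := exists B : R, forall j, `|a j| <= B.

Lemma bdd_cst (c : R) : bdd (fun=> c).
Proof. by exists `|c|. Qed.

Lemma bddD a b : bdd a -> bdd b -> bdd (fun j => a j + b j).
Proof.
move=> [A hA] [B hB]; exists (A + B) => j.
by rewrite (le_trans (ler_normD _ _))// lerD.
Qed.

Lemma bddM a b : bdd a -> bdd b -> bdd (fun j => a j * b j).
Proof.
move=> [A hA] [B hB]; exists (A * B) => j.
by rewrite normrM ler_pM.
Qed.

Lemma bddN a : bdd a -> bdd (fun j => - a j).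
Proof. by move=> [A hA]; exists A => j; rewrite normrN. Qed.

Lemma bdd_norm a : bdd a -> bdd (fun j => `|a j|).
Proof. by move=> [A hA]; exists A => j; rewrite normr_id. Qed.

Lemma bddS a h : bdd a -> bdd (fun j => a (j + h)%N).
Proof. by move=> [A hA]; exists A => j. Qed.

Lemma bdd_sum (I : Type) (r : seq I) (p : pred I) (F : I -> nat -> R) :
  (forall i, bdd (F i)) -> bdd (fun j => \sum_(i <- r | p i) F i j).
Proof.
move=> bF; elim: r => [|i r [B hB]].
  by exists 0 => j; rewrite big_nil normr0.
have [A hA] := bF i; exists (A + B) => j; rewrite big_cons.
have A0 : 0 <= A by rewrite (le_trans _ (hA 0%N)).
case: ifP => _; first by rewrite (le_trans (ler_normD _ _))// lerD.
by rewrite (le_trans (hB j))// lerDr.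
Qed.

Lemma bdd_bool (p : nat -> bool) : bdd (fun j => (p j)%:R).
Proof. by exists 1 => j; case: (p j); rewrite ?normr1 ?normr0. Qed.

End BoundedSequences.

#[global] Hint Resolve bdd_cst bddD bddM bddN bdd_norm bddS bdd_sum bdd_bool : bdd.
Ltac bd := by auto 12 with bdd.

Section MeanFunctionals.
Local Open Scope classical_set_scope.
Context {R : realType}.
Implicit Types a b : nat -> R.

Definition avg a (J : nat) : R := (\sum_(j < J) a j) / J%:R.

(** The properties shared by all limits of Cesaro means along ultrafilters; the
    correlations of an orbit are computed with them as if they were integrals for
    an invariant measure. *)
Record mean_functional (m : (nat -> R) -> R) : Prop := MeanFunctional {
  meanD : forall a b, bdd a -> bdd b -> m (fun j => a j + b j) = m a + m b;
  meanZ : forall c a, bdd a -> m (fun j => c * a j) = c * m a;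
  mean_le : forall a b, bdd a -> bdd b -> (forall j, a j <= b j) -> m a <= m b;
  mean_cvg : forall a l, bdd a -> avg a @ \oo --> l -> m a = l;
  meanS1 : forall a, bdd a -> m (fun j => a j.+1) = m a }.

Lemma avg_bdd a B : (forall j, `|a j| <= B) -> forall J, `|avg a J| <= B.
Proof.
move=> aB J; rewrite /avg; have B0 : 0 <= B by rewrite (le_trans _ (aB 0%N)).
case: J => [|J]; first by rewrite big_ord0 mul0r normr0.
rewrite normrM normfV [`|J.+1%:R|]ger0_norm// ler_pdivrMr ?ltr0n//.
rewrite (le_trans (ler_norm_sum _ _ _))//.
apply: (@le_trans _ _ (\sum_(i < J.+1) B)); first exact: ler_sum.
by rewrite sumr_const card_ord mulr_natr.
Qed.

Section Ultralimit.
Variables (U : set_system nat) (UU : UltraFilter U) (hU : \oo `<=` U).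

Let ulim a : R := lim (avg a @ U).

Lemma avg_ultra_cvg a : bdd a -> avg a @ U --> ulim a.
Proof.
move=> [B aB].
have : compact `[- B, B]%classic by exact: segment_compact.
rewrite compact_ultra => /(_ (avg a @ U)) [].
- split; first exact: fmap_proper_filter.
  move=> G GF sG; apply/seteqP; split; last exact: sG.
  move=> A GA; have [//|UA] := in_ultra_setVsetC (avg a @^-1` A) UU.
  have : G (~` A) by exact: sG.
  by move=> /(filterI GA); rewrite setICr => /filter_not_empty.
- have hB J : `[- B, B]%classic (avg a J).
    by rewrite /= in_itv /= -ler_norml; exact: avg_bdd.
  have FU : Filter U by exact: filter_filter.
  by apply: (@filterS _ U FU setT) (@filterT _ U FU) => J _; exact: hB.
- by move=> l [_ /= hl]; have -> : ulim a = l by apply: cvg_lim hl; exact: Rhausdorff.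
Qed.

(** Shift invariance holds because the sum of [a j.+1 - a j] telescopes, so that
    its Cesaro means are [O(1/J)]. *)
Lemma ultralimit_mean : mean_functional ulim.
Proof.
have E a l : avg a @ U --> l -> ulim a = l by move=> hl; apply: cvg_lim hl; exact: Rhausdorff.
have mcvg a l : bdd a -> avg a @ \oo --> l -> ulim a = l.
  by move=> ba hl; apply: E; apply: cvg_trans hl => A; exact: hU.
have mD a b : bdd a -> bdd b -> ulim (fun j => a j + b j) = ulim a + ulim b.
  move=> ba bb; apply: E.
  rewrite (_ : avg _ = avg a + avg b); first by apply: cvgD; exact: avg_ultra_cvg.
  by apply/funext => J; rewrite /avg big_split /= mulrDl.
have mZ c a : bdd a -> ulim (fun j => c * a j) = c * ulim a.
  move=> ba; apply: E.
  rewrite (_ : avg _ = fun J => c * avg a J).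
    by apply: cvgMl_tmp; exact: avg_ultra_cvg.
  by apply/funext => J; rewrite /avg -mulr_sumr mulrA.
split => //.
- move=> a b ba bb ab; apply: ler_cvg_to (avg_ultra_cvg ba) (avg_ultra_cvg bb) _.
  by apply: nearW => J; rewrite ler_wpM2r ?invr_ge0// ler_sum.
- move=> a ba; have [B aB] := ba.
  have bS : bdd (fun j => a j.+1) by exists B.
  apply/eqP; rewrite -subr_eq0 -[X in _ + X]mulN1r -mZ// -mD//; last bd.
  apply/eqP/mcvg; first bd.
  apply/cvgr0Pnorm_lt => e e0.
  have [K hK] : exists K, (2 * B) / e < K%:R.
    by exists (Num.truncn ((2 * B) / e)).+1; exact: truncnS_gt.
  exists K.+1 => // J /= KJ; rewrite /avg.
  have J0 : 0 < J%:R :> R by rewrite ltr0n (leq_trans _ KJ).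
  rewrite big_split /= -mulr_sumr mulN1r.
  rewrite (_ : _ - _ = a J - a 0%N).
    rewrite normrM normfV [`|J%:R|]ger0_norm ?(ltW J0)// ltr_pdivrMr//.
    rewrite (@le_lt_trans _ _ (B + B))//.
      by rewrite (le_trans (ler_normB _ _))// lerD.
    rewrite ltr_pdivrMr// in hK.
    have : K%:R <= J%:R :> R by rewrite ler_nat ltnW.
    by nra.
  elim: J {KJ J0} => [|J IH]; first by rewrite !big_ord0 subrr subrr.
  rewrite !big_ord_recr /= opprD addrACA IH; ring.
Qed.

End Ultralimit.

(** If the averages stayed away from [l] infinitely often, an ultrafilter
    containing the set of those times would give a mean of [a] other than [l]. *)
Lemma avg_cvg_of_means a l : bdd a ->
  (forall m, mean_functional m -> m a = l) -> avg a @ \oo --> l.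
Proof.
move=> ba hm; apply/cvgrPdist_lt => e e0; apply: contrapT => nfar.
pose B := [set J | ~ (`|l - avg a J| < e)].
have PF : ProperFilter (within B \oo).
  apply: Build_ProperFilter.
  move=> [K _ hK]; apply: nfar; exists K => // J KJ.
  by apply: contrapT => BJ; exact: (hK J KJ BJ).
have [U [UU FU]] := ultraFilterLemma PF.
have UB : U B by apply: FU; exact: withinT.
have hU : \oo `<=` U by move=> A hA; apply: FU; exact: (@cvg_within _ _ _ B A hA).
have := avg_ultra_cvg UU ba.
rewrite (hm _ (ultralimit_mean UU hU)) => /cvgrPdist_lt /(_ e e0) UA.
have UF : ProperFilter U by exact: ultra_proper.
have [J [/= BJ nBJ]] := @filter_ex _ U UF _ (@filterI _ U filter_filter _ _ UA UB).
exact: nBJ BJ.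
Qed.

Section Consequences.
Variables (m : (nat -> R) -> R) (mm : mean_functional m).

Lemma mean_cst c : m (fun=> c) = c.
Proof.
apply: (mean_cvg mm); first bd.
apply/cvgrPdist_lt => e e0; exists 1%N => // J /= J1.
rewrite /avg sumr_const card_ord -[c *+ J]mulr_natr mulfK ?subrr ?normr0//.
by rewrite pnatr_eq0 -lt0n.
Qed.

Lemma meanN a : bdd a -> m (fun j => - a j) = - m a.
Proof.
by move=> ba; rewrite -mulN1r -(meanZ mm)//; congr m; apply/funext => j; rewrite mulN1r.
Qed.

Lemma meanB a b : bdd a -> bdd b -> m (fun j => a j - b j) = m a - m b.
Proof. by move=> ba bb; rewrite (meanD mm) ?meanN//; bd. Qed.

Lemma mean_ge0 a : bdd a -> (forall j, 0 <= a j) -> 0 <= m a.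
Proof. by move=> ba a0; rewrite -(mean_cst 0); apply: (mean_le mm) => //; bd. Qed.

Lemma mean_le_cst a c : bdd a -> (forall j, a j <= c) -> m a <= c.
Proof. by move=> ba ac; rewrite -[leRHS]mean_cst; apply: (mean_le mm) => //; bd. Qed.

Lemma mean_norm a : bdd a -> `|m a| <= m (fun j => `|a j|).
Proof.
move=> ba; rewrite ler_norml; apply/andP; split.
  rewrite -meanN; last bd; apply: (mean_le mm) => [||j]; [bd|bd|].
  by rewrite lerNl ler_normr lexx orbT.
by apply: (mean_le mm) => [||j]; [bd|bd|exact: ler_norm].
Qed.

Lemma mean_sum (I : Type) (r : seq I) (p : pred I) (F : I -> nat -> R) :
  (forall i, bdd (F i)) ->
  m (fun j => \sum_(i <- r | p i) F i j) = \sum_(i <- r | p i) m (F i).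
Proof.
move=> bF; elim: r => [|i r IH].
  rewrite big_nil -[RHS](mean_cst 0); congr m; apply/funext => j.
  by rewrite big_nil.
rewrite big_cons; case: ifP => pi.
  rewrite -IH -(meanD mm); [|bd|bd]; congr m; apply/funext => j.
  by rewrite big_cons pi.
by rewrite -IH; congr m; apply/funext => j; rewrite big_cons pi.
Qed.

Lemma meanS a h : bdd a -> m (fun j => a (j + h)%N) = m a.
Proof.
move=> ba; elim: h => [|h IH]; first by congr m; apply/funext => j; rewrite addn0.
rewrite -{}IH -[RHS](meanS1 mm); last bd.
by congr m; apply/funext => j; rewrite addSnnS.
Qed.

(** The translates of the set of [j] with [p j] by [0, ..., H - 1] are pairwise
    disjoint and have the same mean. *)
Lemma mean_disjoint_translates (p : nat -> bool) (H : nat) : (0 < H)%N ->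
  (forall j h h', (h < h' < H)%N -> p (j + h)%N -> p (j + h')%N -> False) ->
  m (fun j => (p j)%:R) <= H%:R^-1.
Proof.
move=> H0 dis; rewrite -[leRHS]mul1r ler_pdivlMr ?ltr0n//.
rewrite mulr_natr -[X in _ *+ X]card_ord -sumr_const.
rewrite (eq_bigr (fun h : 'I_H => m (fun j => (p (j + h)%N)%:R))); last first.
  by move=> h _; rewrite [RHS](@meanS (fun j => (p j)%:R)) //; bd.
rewrite -mean_sum; last by move=> h; exact: bdd_bool.
apply: mean_le_cst => [|j]; first by apply: bdd_sum => h; exact: bdd_bool.
have [/existsP[h ph]|/existsPn np] := boolP [exists h : 'I_H, p (j + h)%N].
  rewrite (bigD1 h)//= ph big1 ?addr0// => h' h'h.
  case: (boolP (p _)) => // ph'; exfalso.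
  have [hh|hh] : (h < h')%N \/ (h' < h)%N.
    by have := neq_ltn h' h; rewrite (negPf (_ : _ != _)) // => /esym; case: ltngtP => //; [right|left].
  by apply: (dis j h h' _ ph ph'); rewrite hh ltn_ord.
  by apply: (dis j h' h _ ph' ph); rewrite hh ltn_ord.
by rewrite big1// => h _; rewrite (negPf (np h)).
Qed.

End Consequences.

End MeanFunctionals.

(** * Squared moduli and characters of the circle *)

Local Notation Re := complex.Re.
Local Notation Im := complex.Im.

Section Complex.
Context {R : realType}.
Implicit Types z w : R[i].

(** Valued in [R], so that the ordered field tactics apply to it. *)
Definition sqmod z : R := Re z ^+ 2 + Im z ^+ 2.

Lemma sqmod_ge0 z : 0 <= sqmod z.
Proof. by rewrite addr_ge0 ?sqr_ge0. Qed.

Lemma sqmodM z w : sqmod (z * w) = sqmod z * sqmod w.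
Proof. by case: z => a b; case: w => c d; rewrite /sqmod /=; ring. Qed.

Lemma sqmodN z : sqmod (- z) = sqmod z.
Proof. by case: z => a b; rewrite /sqmod /= !sqrrN. Qed.

Lemma sqmod_parallelogram z w : sqmod (z - w) + sqmod (z + w) = 2 * sqmod z + 2 * sqmod w.
Proof. by case: z => a b; case: w => c d; rewrite /sqmod /=; ring. Qed.

Lemma sqmodD_le z w : sqmod (z + w) <= 2 * sqmod z + 2 * sqmod w.
Proof. by have := sqmod_parallelogram z w; have := sqmod_ge0 (z - w); lra. Qed.

Lemma sqmodB_le z w : sqmod (z - w) <= 2 * sqmod z + 2 * sqmod w.
Proof. by have := sqmod_parallelogram z w; have := sqmod_ge0 (z + w); lra. Qed.

Lemma sqmod_real (x : R) : sqmod x%:C%C = x ^+ 2.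
Proof. by rewrite /sqmod /= expr0n addr0. Qed.

Lemma sqmod0 : sqmod 0 = 0. Proof. by rewrite (sqmod_real 0) expr0n. Qed.
Lemma sqmod1 : sqmod 1 = 1. Proof. by rewrite (sqmod_real 1) expr1n. Qed.

Lemma sqmod_eq0 z : (sqmod z == 0) = (z == 0).
Proof.
apply/idP/eqP => [|->]; last by rewrite sqmod0.
case: z => a b; rewrite /sqmod /= paddr_eq0 ?sqr_ge0// !sqrf_eq0.
by move=> /andP[/eqP-> /eqP->].
Qed.

Lemma sqmod_gt0 z : (0 < sqmod z) = (z != 0).
Proof. by rewrite lt_def sqmod_ge0 sqmod_eq0 andbT. Qed.

Lemma sqmodX z n : sqmod (z ^+ n) = sqmod z ^+ n.
Proof. by elim: n => [|n IH]; rewrite ?sqmod1// !exprS sqmodM IH. Qed.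

Lemma sqmod_prod (I : Type) (r : seq I) (p : pred I) (F : I -> R[i]) :
  sqmod (\prod_(i <- r | p i) F i) = \prod_(i <- r | p i) sqmod (F i).
Proof. by rewrite (big_morph _ sqmodM sqmod1). Qed.

Lemma Re_sum (I : Type) (r : seq I) (p : pred I) (F : I -> R[i]) :
  Re (\sum_(i <- r | p i) F i) = \sum_(i <- r | p i) Re (F i).
Proof. by apply: (big_morph _ _ _) => // [[a b] [c d]]. Qed.

Lemma Im_sum (I : Type) (r : seq I) (p : pred I) (F : I -> R[i]) :
  Im (\sum_(i <- r | p i) F i) = \sum_(i <- r | p i) Im (F i).
Proof. by apply: (big_morph _ _ _) => // [[a b] [c d]]. Qed.

Lemma ReM_real (x : R) z : Re (x%:C%C * z) = x * Re z.
Proof. by case: z => a b /=; ring. Qed.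

(** Cauchy-Schwarz against the constant function 1. *)
Lemma sqmod_sum (I : finType) (F : I -> R[i]) :
  sqmod (\sum_i F i) <= #|I|%:R * \sum_i sqmod (F i).
Proof.
have CS (f : I -> R) : (\sum_i f i) ^+ 2 <= #|I|%:R * \sum_i f i ^+ 2.
  have : 0 <= \sum_i \sum_j (f i - f j) ^+ 2.
    by apply: sumr_ge0 => i _; apply: sumr_ge0 => j _; exact: sqr_ge0.
  rewrite (eq_bigr (fun i => #|I|%:R * f i ^+ 2 + (\sum_j f j ^+ 2) -
     2 * (f i * \sum_j f j))); last first.
    move=> i _; rewrite !mulr_sumr.
    rewrite (_ : #|I|%:R * _ = \sum_(j : I) f i ^+ 2); last first.
      by rewrite sumr_const mulr_natl.
    rewrite -big_split /= -sumrB; apply: eq_bigr => j _; ring.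
  rewrite sumrB big_split /= -mulr_sumr sumr_const -mulr_natl.
  rewrite -mulr_sumr -mulr_suml -expr2; lra.
by rewrite /sqmod Re_sum Im_sum big_split mulrDr lerD.
Qed.

Lemma sqmod_sum_ord (n : nat) (F : 'I_n -> R[i]) :
  sqmod (\sum_i F i) <= n%:R * \sum_i sqmod (F i).
Proof. by have := sqmod_sum F; rewrite card_ord. Qed.

(** Convexity of the squared modulus. *)
Lemma sqmod_avg (n : nat) (F : 'I_n -> R[i]) : (0 < n)%N ->
  sqmod (n%:R^-1%:C%C * \sum_i F i) <= n%:R^-1 * \sum_i sqmod (F i).
Proof.
move=> n0; rewrite sqmodM sqmod_real expr2 -mulrA ler_wpM2l ?invr_ge0//.
by rewrite ler_pdivrMl ?ltr0n// sqmod_sum_ord.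
Qed.

Definition cexp (x : R) : R[i] := (cos (2 * pi * x) +i* sin (2 * pi * x))%C.

Lemma cexpD x y : cexp (x + y) = cexp x * cexp y.
Proof.
rewrite /cexp mulrDr cosD sinD; apply/eqP; rewrite eq_complex /=.
by apply/andP; split; apply/eqP; ring.
Qed.

Lemma cexp0 : cexp 0 = 1.
Proof. by rewrite /cexp mulr0 cos0 sin0. Qed.

Lemma sqmod_cexp x : sqmod (cexp x) = 1.
Proof. exact: cos2Dsin2. Qed.

Lemma cexpN x : cexp (- x) * cexp x = 1.
Proof. by rewrite -cexpD addNr cexp0. Qed.

Lemma cexp_nat x n : cexp (n%:R * x) = cexp x ^+ n.
Proof.
elim: n => [|n IH]; first by rewrite mul0r cexp0.
by rewrite exprS -IH -cexpD; congr cexp; rewrite -natr1; ring.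
Qed.

Lemma cexp1 : cexp 1 = 1.
Proof. by rewrite /cexp mulr1 mulr_natl cos2pi sin2pi. Qed.

Lemma cexp_int (n : int) : cexp n%:~R = 1.
Proof.
have cexp_natr k : cexp k%:R = 1.
  by rewrite -[X in cexp X]mulr1 cexp_nat cexp1 expr1n.
case: n => n; first exact: cexp_natr.
by have := cexpN n.+1%:R; rewrite cexp_natr mulr1 NegzE mulrNz.
Qed.

Lemma cexpDz x (n : int) : cexp (x + n%:~R) = cexp x.
Proof. by rewrite cexpD cexp_int mulr1. Qed.

Lemma sin_pi_eq0 (x : R) : sin (pi * x) = 0 -> exists n : int, x = n%:~R.
Proof.
move=> sx; exists (Num.floor x).
have sfrac : sin (pi * (x - (Num.floor x)%:~R)) = 0.
  rewrite mulrBr sinB sx mul0r sub0r.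
  suff -> : sin (pi * (Num.floor x)%:~R) = 0 :> R by rewrite mulr0 oppr0.
  have natpi n : sin (pi * n%:R) = 0 :> R.
    elim: n => [|n IH]; first by rewrite mulr0 sin0.
    by rewrite -natr1 mulrDr mulr1 sinDpi IH oppr0.
  case: (Num.floor x) => n; first exact: natpi.
  by rewrite NegzE mulrNz mulrN sinN natpi oppr0.
have := floor_itv x; set f := Num.floor x in sfrac *; rewrite intrD => /andP[fx xf].
have [x0|] := ltP 0 (x - f%:~R); last by move: fx; lra.
suff : 0 < sin (pi * (x - f%:~R)) by rewrite sfrac ltxx.
apply: sin_gt0_pi; have := pi_gt0 R.
by nra.
Qed.

Lemma sqmod_cexpB1 x : sqmod (cexp x - 1) = 4 * sin (pi * x) ^+ 2.
Proof.
rewrite /sqmod /cexp /= (_ : 2 * pi * x = pi * x + pi * x); last by ring.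
rewrite cosD sinD; have := cos2Dsin2 (pi * x).
set c := cos _; set s := sin _ => h; nra.
Qed.

Lemma cexp_eq1 x : cexp x = 1 -> exists n : int, x = n%:~R.
Proof.
move=> e1; apply: sin_pi_eq0; have := sqmod_cexpB1 x.
rewrite e1 subrr sqmod0 => /esym/eqP; rewrite mulf_eq0 sqrf_eq0 pnatr_eq0 /=.
by move=> /eqP.
Qed.

(** A geometric sum: its modulus is at most [2 / |1 - cexp beta|]. *)
Lemma geometric_avg_small (beta eps : R) : (forall n : int, beta <> n%:~R) ->
  0 < eps -> exists2 H0, (0 < H0)%N & forall H, (H0 <= H)%N ->
    sqmod (H%:R^-1%:C%C * \sum_(h < H) cexp (h%:R * beta)) <= eps.
Proof.
move=> nb e0; have c0 : 0 < sqmod (cexp beta - 1).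
  by rewrite sqmod_gt0 subr_eq0; apply/eqP => /cexp_eq1[n]; exact: nb.
exists (Num.truncn (4 / (eps * sqmod (cexp beta - 1)))).+1 => // H hH.
have H0 : (0 < H)%N by exact: leq_trans hH.
set S := \sum_(h < H) _.
have hS : (cexp beta - 1) * S = cexp (H%:R * beta) - 1.
  rewrite cexp_nat subrX1; congr (_ * _).
  by apply: eq_bigr => h _; rewrite cexp_nat.
have hn : sqmod (cexp beta - 1) * sqmod S <= 4.
  rewrite -sqmodM hS (le_trans (sqmodB_le _ _))// sqmod_cexp sqmod1; lra.
have Hlarge : 4 < H%:R * (eps * sqmod (cexp beta - 1)).
  rewrite -ltr_pdivrMr ?mulr_gt0// (lt_le_trans (truncnS_gt _))// ler_nat//.
have Hr : 1 <= H%:R :> R by rewrite ler1n.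
rewrite sqmodM sqmod_real exprVn mulrC ler_pdivrMr ?exprn_gt0 ?ltr0n//.
rewrite -(ler_pM2l c0) (le_trans hn)// (le_trans (ltW Hlarge))//.
have p0 := mulr_gt0 e0 c0; set N := sqmod _ in c0 p0 *.
by rewrite [leRHS](_ : _ = H%:R * (eps * N) * H%:R); [rewrite ler_peMr// mulr_ge0// ltW|ring].
Qed.

End Complex.

(** * Cells of the circle and their approximation by trigonometric polynomials *)

Section FractionalPart.
Context {R : realType}.
Implicit Types x y : R.

Lemma fracpart_itv x : 0 <= fracpart x < 1.
Proof.
have := floor_itv x; rewrite intrD /fracpart => /andP[a b].
by apply/andP; split; lra.
Qed.

Lemma fracpartE x : x = (Num.floor x)%:~R + fracpart x.
Proof. by rewrite /fracpart addrC subrK. Qed.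

Lemma fracpart_unique x y (n : int) : 0 <= y < 1 -> x = n%:~R + y -> fracpart x = y.
Proof.
move=> /andP[y0 y1] ->; rewrite /fracpart.
have -> : Num.floor (n%:~R + y) = n; last by rewrite addrC addKr.
by apply: floor_def; rewrite intrD lerDl y0 /= ltrD2l.
Qed.

Lemma fracpart_id x : 0 <= x < 1 -> fracpart x = x.
Proof. by move=> x01; apply: (@fracpart_unique _ _ 0) => //; rewrite add0r. Qed.

Lemma fracpartDz x (n : int) : fracpart (x + n%:~R) = fracpart x.
Proof.
apply: (@fracpart_unique _ _ (n + Num.floor x)); first exact: fracpart_itv.
by rewrite intrD {1}(fracpartE x); ring.
Qed.

Lemma fracpartDl x y : fracpart (fracpart x + y) = fracpart (x + y).
Proof.
rewrite -[LHS](fracpartDz _ (Num.floor x)); congr fracpart.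
by rewrite [in RHS](fracpartE x); ring.
Qed.

Lemma fracpart_eq x y : fracpart x = fracpart y -> exists n : int, x = y + n%:~R.
Proof.
move=> e; exists (Num.floor x - Num.floor y).
rewrite intrD rmorphN /=; have hx := fracpartE x; have hy := fracpartE y.
by rewrite e in hx; lra.
Qed.

Definition cell (N : nat) x : nat := Num.truncn (N%:R * x).

Lemma cellP N x k : 0 <= x -> (cell N x == k) = (k%:R <= N%:R * x < k.+1%:R).
Proof. by move=> x0; rewrite /cell truncn_eq// mulr_ge0. Qed.

Lemma cell_lt N x : (0 < N)%N -> 0 <= x < 1 -> (cell N x < N)%N.
Proof.
move=> N0 /andP[x0 x1]; rewrite /cell truncn_lt_nat ?mulr_ge0//.
by rewrite gtr_pMr ?ltr0n.
Qed.

Lemma cell_refine N Q x : (0 < Q)%N -> 0 <= x -> cell N x = (cell (N * Q) x %/ Q)%N.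
Proof.
move=> Q0 x0; apply/eqP; rewrite cellP//.
have := eqxx (cell (N * Q) x); rewrite cellP// => /andP[].
set k := cell _ _; have Qr : 0 < Q%:R :> R by rewrite ltr0n.
rewrite natrM (_ : N%:R * Q%:R * x = N%:R * x * Q%:R); last by ring.
move=> h1 h2; apply/andP; split.
  by rewrite -(ler_pM2r Qr) (le_trans _ h1)// -natrM ler_nat leq_divM.
by rewrite -(ltr_pM2r Qr) (lt_le_trans h2)// -natrM ler_nat -ltn_divLR.
Qed.

Lemma cell_shift N x k : (k < N)%N ->
  (cell N (fracpart x) == k) = (cell N (fracpart (x - k%:R / N%:R)) == 0%N).
Proof.
move=> kN; have N0 : 0 < N%:R :> R by rewrite ltr0n (leq_ltn_trans _ kN).
have /andP[f0 f1] := fracpart_itv x.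
have kN' : k.+1%:R <= N%:R :> R by rewrite ler_nat.
have k0 : 0 <= k%:R / N%:R :> R by rewrite divr_ge0.
have k1 : k%:R / N%:R <= 1 :> R by rewrite ler_pdivrMr// mul1r ler_nat ltnW.
have Nk : N%:R * (k%:R / N%:R) = k%:R :> R by rewrite mulrCA divff ?gt_eqF// mulr1.
rewrite cellP//; case: (leP k%:R (N%:R * fracpart x)) => h /=.
  have h' : k%:R / N%:R <= fracpart x by rewrite ler_pdivrMr// mulrC.
  rewrite (@fracpart_unique (x - k%:R / N%:R) (fracpart x - k%:R / N%:R) (Num.floor x)).
  - rewrite cellP ?subr_ge0// [N%:R * (_ - k%:R / N%:R)]mulrBr Nk subr_ge0 h /=.
    by rewrite ltrBlDr -natr1 addrC.
  - by apply/andP; split; lra.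
  - by rewrite {1}(fracpartE x); ring.
have h' : fracpart x < k%:R / N%:R by rewrite ltr_pdivlMr// mulrC.
rewrite (@fracpart_unique (x - k%:R / N%:R) (fracpart x - k%:R / N%:R + 1) (Num.floor x - 1)).
- apply/esym/negbTE; rewrite cellP; last by lra.
  apply/negP => /andP[_]; rewrite mulrDr [N%:R * (_ - k%:R / N%:R)]mulrBr Nk mulr1.
  have : 0 <= N%:R * fracpart x by rewrite mulr_ge0.
  by move: kN'; rewrite -natr1; lra.
- by apply/andP; split; lra.
- by rewrite {1}(fracpartE x) intrD rmorphN /=; ring.
Qed.

End FractionalPart.

Section Trig.
Context {R : realType}.

(** Trigonometric polynomials of period 1, as lists of coefficients and
    frequencies. *)
Definition trig (T : R -> R[i]) : Prop := exists l : seq (R[i] * int),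
  forall x, T x = \sum_(p <- l) p.1 * cexp (p.2%:~R * x).

Lemma trig_cst c : trig (fun=> c).
Proof. by exists [:: (c, 0)] => x; rewrite big_seq1 /= mul0r cexp0 mulr1. Qed.

Lemma trig_cexp : trig cexp.
Proof. by exists [:: (1, 1)] => x; rewrite big_seq1 /= mul1r mul1r. Qed.

Lemma trig_cexpN : trig (fun x => cexp (- x)).
Proof. by exists [:: (1, -1)] => x; rewrite big_seq1 /= mul1r mulN1r. Qed.

Lemma trig_ext T S : (forall x, S x = T x) -> trig T -> trig S.
Proof. by move=> /funext ->. Qed.

Lemma trigD T S : trig T -> trig S -> trig (fun x => T x + S x).
Proof. by move=> [l hl] [k hk]; exists (l ++ k) => x; rewrite big_cat /= hl hk. Qed.

Lemma trigM T S : trig T -> trig S -> trig (fun x => T x * S x).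
Proof.
move=> [l hl] [k hk]; exists [seq (p.1 * q.1, p.2 + q.2) | p <- l, q <- k] => x.
rewrite big_allpairs_dep hl hk mulr_suml; apply: eq_bigr => p _.
rewrite mulr_sumr; apply: eq_bigr => q _ /=.
by rewrite intrD mulrDl cexpD; ring.
Qed.

Lemma trigX T n : trig T -> trig (fun x => T x ^+ n).
Proof.
move=> hT; elim: n => [|n IH]; first exact: trig_cst.
by apply: (@trig_ext (fun x => T x * T x ^+ n)) => [x|]; [rewrite exprS|exact: trigM].
Qed.

(** [ramp N] exceeds 1/2 exactly on the interior of [0, 1/N] modulo 1, and
    [threshold N n] sharpens it towards the indicator of that interval. *)
Definition ramp (N : nat) (x : R) : R :=
  2^-1 + 2^-1 * (sin (pi * x) * sin (pi * (N%:R^-1 - x))).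

Definition threshold (N n : nat) (x : R) : R := 1 - (1 - ramp N x ^+ n) ^+ (2 ^ n).

Lemma trig_threshold N n : trig (fun x => (threshold N n x)%:C%C).
Proof.
have hr : trig (fun x => (ramp N x)%:C%C).
  pose a : R := N%:R^-1.
  pose k : R[i] := (2^-1 - cos (pi * a) / 4)%:C%C.
  apply: (@trig_ext (fun x => k + ((8^-1)%:C%C * cexp (- (a / 2))) * cexp x
      + ((8^-1)%:C%C * cexp (a / 2)) * cexp (- x))); last first.
    apply: trigD; last by apply: trigM; [exact: trig_cst|exact: trig_cexpN].
    by apply: trigD; [exact: trig_cst|apply: trigM; [exact: trig_cst|exact: trig_cexp]].
  move=> x; rewrite -!mulrA -!cexpD.
  have e1 : 2 * pi * (- (a / 2) + x) = pi * x - pi * (a - x) by field.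
  have e2 : 2 * pi * (a / 2 + - x) = - (pi * x - pi * (a - x)) by field.
  have e3 : pi * a = pi * x + pi * (a - x) by ring.
  rewrite /cexp e1 e2 /k e3 cosN sinN cosD cosB /ramp -/a.
  apply/eqP; rewrite eq_complex /=; apply/andP; split; apply/eqP; by field.
apply: (@trig_ext (fun x => (1 : R[i]) + (-1) * (1 + (-1) * (ramp N x)%:C%C ^+ n) ^+ (2 ^ n))).
  by move=> x; rewrite /threshold rmorphB rmorphXn rmorphB rmorphXn rmorph1 !mulN1r.
apply: trigD; first exact: trig_cst.
apply: trigM; first exact: trig_cst.
apply: trigX; apply: trigD; first exact: trig_cst.
by apply: trigM; [exact: trig_cst|exact: trigX].
Qed.

Lemma ramp_itv N x : 0 <= ramp N x <= 1.
Proof.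
rewrite /ramp; set s := sin _; set t := sin _.
have [s1 s2] : (-1 <= s /\ s <= 1) by rewrite sin_geN1 sin_le1.
have [t1 t2] : (-1 <= t /\ t <= 1) by rewrite sin_geN1 sin_le1.
have st : `|s * t| <= 1 by rewrite normrM mulr_ile1// ler_norml ?s1 ?t1.
by move: st; rewrite ler_norml => /andP[a b]; apply/andP; split; lra.
Qed.

Lemma threshold_itv N n x : 0 <= threshold N n x <= 1.
Proof.
have /andP[r0 r1] := ramp_itv N x.
have h0 : 0 <= 1 - ramp N x ^+ n by rewrite subr_ge0 exprn_ile1.
have h1 : 1 - ramp N x ^+ n <= 1 by rewrite gerBl exprn_ge0.
by rewrite /threshold subr_ge0 exprn_ile1//= gerBl exprn_ge0.
Qed.

Lemma bernoulli (x : R) n : 0 <= x -> 1 + n%:R * x <= (1 + x) ^+ n.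
Proof.
move=> x0; elim: n => [|n IH]; first by rewrite mul0r addr0.
rewrite exprS -natr1; have n0 : 0 <= n%:R :> R by [].
have : (1 + x) * (1 + n%:R * x) <= (1 + x) * (1 + x) ^+ n.
  by rewrite ler_wpM2l// addr_ge0.
have : 0 <= n%:R * x * x by rewrite !mulr_ge0.
by lra.
Qed.

Lemma bernoulliB (x : R) n : 0 <= x <= 1 -> 1 - n%:R * x <= (1 - x) ^+ n.
Proof.
move=> /andP[x0 x1]; elim: n => [|n IH]; first by rewrite mul0r subr0.
rewrite exprS -natr1; have n0 : 0 <= n%:R :> R by [].
have : (1 - x) * (1 - n%:R * x) <= (1 - x) * (1 - x) ^+ n.
  by rewrite ler_wpM2l// subr_ge0.
have : 0 <= n%:R * x * x by rewrite !mulr_ge0//.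
by lra.
Qed.

Lemma sin_pi_ge0 (z : R) : 0 <= z <= 1 -> 0 <= sin (pi * z).
Proof.
move=> /andP[z0 z1]; have p0 := pi_gt0 R.
have [->|zn0] := eqVneq z 0; first by rewrite mulr0 sin0.
have [->|zn1] := eqVneq z 1; first by rewrite mulr1 sinpi.
have zp : 0 < z by rewrite lt_def zn0.
have zl : z < 1 by rewrite lt_def eq_sym zn1.
by apply/ltW/sin_gt0_pi; rewrite mulr_gt0//= gtr_pMr.
Qed.

(** With [K = 2 ^ n], [(1 - t ^ n) ^ K] is at least [1 - (2 t) ^ n] and at most
    [1 / (1 + K t ^ n) <= (2 t) ^ - n], hence the jump at [t = 1/2]. *)
Lemma threshold_approx N n (d x : R) : (0 < N)%N -> 0 < d ->
  d <= `|sin (pi * x)| -> d <= `|sin (pi * (N%:R^-1 - x))| ->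
  `|(cell N (fracpart x) == 0%N)%:R - threshold N n x| <= (1 + n%:R * d ^+ 2)^-1.
Proof.
move=> N0 d0 h1 h2.
have Nr : 0 < N%:R :> R by rewrite ltr0n.
have N1 : N%:R^-1 <= 1 :> R by rewrite invf_le1// ler1n.
have [r0 r1] := andP (ramp_itv N x).
have K0 : 0 < 1 + n%:R * d ^+ 2.
  by rewrite ltr_pwDl// mulr_ge0// sqr_ge0.
have /andP[f0 f1] := fracpart_itv x; set y := fracpart x in f0 f1 *.
have rampf : sin (pi * x) * sin (pi * (N%:R^-1 - x)) =
             sin (pi * y) * sin (pi * (N%:R^-1 - y)).
  have e (a b : R) : sin a * sin b = (cos (a - b) - cos (a + b)) / 2.
    by rewrite cosB cosD; field.
  rewrite !e; congr ((_ - cos _) / 2); last by ring.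
  have e2 (z : R) : cos (pi * z - pi * (N%:R^-1 - z)) = Re (cexp (z - N%:R^-1 / 2)).
    by rewrite /cexp /=; congr cos; field; rewrite gt_eqF.
  rewrite !e2 -(cexpDz (y - _) (Num.floor x)); congr (Re (cexp _)).
  by rewrite [in LHS](fracpartE x) -/y; ring.
have hs : d ^+ 2 <= `|sin (pi * y) * sin (pi * (N%:R^-1 - y))|.
  by rewrite -rampf normrM expr2 ler_pM// ltW.
have sy : 0 <= sin (pi * y) by apply: sin_pi_ge0; rewrite f0 ltW.
rewrite /threshold; set t := ramp N x in r0 r1 *.
have tE : t = 2^-1 + 2^-1 * (sin (pi * y) * sin (pi * (N%:R^-1 - y))).
  by rewrite /t /ramp rampf.
have tn : 0 <= t ^+ n <= 1 by rewrite exprn_ge0// exprn_ile1.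
have /andP[tn0 tn1] := tn.
have K1 : 0 <= 1 - t ^+ n by rewrite subr_ge0.
rewrite cellP//= mulr_ge0//=.
have [yN|Ny] := ltP (N%:R * y) 1.
  have st : 0 <= sin (pi * (N%:R^-1 - y)).
    have yN' : y < N%:R^-1 by rewrite -[ltRHS]mul1r ltr_pdivlMr// mulrC.
    by apply: sin_pi_ge0; apply/andP; split; lra.
  rewrite ger0_norm in hs; last exact: mulr_ge0.
  have t2 : 1 + d ^+ 2 <= 2 * t by rewrite tE; lra.
  have -> : 1 - (1 - (1 - t ^+ n) ^+ (2 ^ n)) = (1 - t ^+ n) ^+ (2 ^ n) by ring.
  rewrite ger0_norm ?exprn_ge0// -[leRHS]mul1r ler_pdivlMr//.
  have A : 1 + n%:R * d ^+ 2 <= (1 + t ^+ n) ^+ (2 ^ n).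
    rewrite (le_trans (bernoulli n (sqr_ge0 d)))//.
    rewrite (@le_trans _ _ ((2 * t) ^+ n))//.
      by rewrite lerXn2r// nnegrE ?addr_ge0 ?sqr_ge0// mulr_ge0.
    rewrite (le_trans _ (bernoulli (2 ^ n) tn0))//.
    by rewrite exprMn natrX lerDr.
  apply: (@le_trans _ _ ((1 - t ^+ n) ^+ (2 ^ n) * (1 + t ^+ n) ^+ (2 ^ n))).
    by rewrite ler_wpM2l// exprn_ge0.
  rewrite -exprMn exprn_ile1//; last by have := mulr_ge0 tn0 tn0; lra.
  by rewrite mulr_ge0// addr_ge0.
have st : sin (pi * (N%:R^-1 - y)) <= 0.
  rewrite -oppr_ge0 -sinN -mulrN opprB.
  have yN' : N%:R^-1 <= y by rewrite -[leLHS]mul1r ler_pdivrMr// mulrC.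
  have N2 : 0 < N%:R^-1 :> R by rewrite invr_gt0.
  by apply: sin_pi_ge0; apply/andP; split; lra.
rewrite ler0_norm in hs; last by rewrite mulr_ge0_le0.
have t2 : 2 * t <= 1 - d ^+ 2 by rewrite tE; lra.
rewrite sub0r normrN ger0_norm; last by rewrite subr_ge0 exprn_ile1// gerBl.
have := bernoulliB (2 ^ n) tn; rewrite natrX -exprMn => B.
apply: (@le_trans _ _ ((2 * t) ^+ n)); first by lra.
rewrite -[leRHS]mul1r ler_pdivlMr//.
apply: (@le_trans _ _ ((1 - d ^+ 2) ^+ n * (1 + d ^+ 2) ^+ n)).
  apply: ler_pM; rewrite ?exprn_ge0 ?(ltW K0) ?mulr_ge0//.
    by rewrite lerXn2r// nnegrE ?mulr_ge0//; move: t2; lra.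
  exact: bernoulli (sqr_ge0 d).
have d1 : 0 <= 1 - d ^+ 2 by lra.
rewrite -exprMn exprn_ile1//; first by rewrite mulr_ge0// addr_ge0// sqr_ge0.
have := mulr_ge0 (sqr_ge0 d) (sqr_ge0 d); lra.
Qed.

End Trig.

(** * Irrational rotations in mean *)

Section Rotation.
Context {R : realType}.

Definition irrational_step (a : R) : Prop :=
  forall g : nat, (0 < g)%N -> forall n : int, g%:R * a <> n%:~R.

Definition rotation_orbit (z0 a : R) (j : nat) : R := fracpart (z0 + j%:R * a).

(** Two times [j] at which the rotation is close to an integer are at distance
    at least [H], since otherwise their difference [g < H] would bring [g * a] too
    close to an integer. *)
Lemma rotation_near_point (a : R) (H : nat) : irrational_step a -> (0 < H)%N ->
  exists2 d : R, 0 < d & forall (z0 : R) (m : (nat -> R) -> R), mean_functional m ->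
    m (fun j => (`|sin (pi * (z0 + j%:R * a))| < d)%R%:R) <= H%:R^-1.
Proof.
move=> ia H0.
have [d d0 hd] : exists2 d : R, 0 < d &
    forall g, (0 < g < H)%N -> 2 * d <= `|sin (pi * (g%:R * a))|.
  elim: H {H0} => [|H [d d0 hd]]; first by exists 1 => // g; rewrite ltn0 andbF.
  have [->|H0] := posnP H.
    by exists 1 => // g; rewrite ltnS leqn0 lt0n; case: eqP.
  have s0 : 0 < `|sin (pi * (H%:R * a))|.
    by rewrite normr_gt0; apply/eqP => /sin_pi_eq0[n]; exact: ia.
  exists (Num.min d (`|sin (pi * (H%:R * a))| / 2)).
    by rewrite lt_min d0 divr_gt0.
  move=> g /andP[g0]; rewrite ltnS leq_eqVlt => /orP[/eqP->|gH].
    have : Num.min d (`|sin (pi * (H%:R * a))| / 2) <= `|sin (pi * (H%:R * a))| / 2.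
      by rewrite ge_min lexx orbT.
    lra.
  apply: le_trans (hd g _); last by rewrite g0.
  by rewrite ler_pM2l// ge_min lexx.
exists d => // z0 m mm; apply: mean_disjoint_translates => //.
move=> j h h' /andP[hh' h'H].
set A := pi * (z0 + (j + h)%:R * a); set B := pi * (z0 + (j + h')%:R * a).
move=> sA sB.
have := hd (h' - h)%N; rewrite subn_gt0 hh' (leq_ltn_trans (leq_subr _ _) h'H).
have -> : pi * ((h' - h)%:R * a) = B - A.
  by rewrite /A /B !natrD natrB ?(ltnW hh')//; ring.
move=> /(_ isT); rewrite sinB leNgt => /negP; apply.
apply: le_lt_trans (ler_normB _ _) _; rewrite !normrM.
have hc (x y : R) : `|x| * `|cos y| <= `|x| by rewrite ler_piMr// ler_norml cos_geN1 cos_le1.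
have := hc (sin B) A; have := hc (sin A) B.
by rewrite [`|cos B| * _]mulrC; lra.
Qed.

(** The error of the threshold polynomial is small away from the two endpoints of
    the interval, and the rotation is rarely near them. The order [n] does not
    depend on [k]: all intervals use translates of the same polynomial. *)
Lemma rotation_interval_approx (a : R) (N : nat) (eps : R) :
  irrational_step a -> (0 < N)%N -> 0 < eps ->
  exists n, forall (z0 : R) (m : (nat -> R) -> R) (k : nat), mean_functional m -> (k < N)%N ->
    m (fun j => `|(cell N (rotation_orbit z0 a j) == k)%:R
                  - threshold N n (z0 + j%:R * a - k%:R / N%:R)|) <= eps.
Proof.
move=> ia N0 e0.
have [H H0 hH] : exists2 H, (0 < H)%N & H%:R^-1 <= eps / 4.
  exists (Num.truncn (eps / 4)^-1).+1 => //.
  rewrite -[leRHS]invrK lef_pV2 ?posrE ?ltr0n ?invr_gt0 ?divr_gt0//.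
  exact/ltW/truncnS_gt.
have [d d0 hd] := rotation_near_point ia H0.
have [n hn] : exists n, (1 + n%:R * d ^+ 2)^-1 <= eps / 4.
  exists (Num.truncn ((eps / 4)^-1 / d ^+ 2)).+1.
  rewrite -[leRHS]invrK lef_pV2 ?posrE ?invr_gt0 ?divr_gt0//; last first.
    by rewrite ltr_pwDl// mulr_ge0// sqr_ge0.
  have := truncnS_gt ((eps / 4)^-1 / d ^+ 2).
  by rewrite ltr_pdivrMr ?exprn_gt0//; lra.
exists n => z0 m k mm kN.
pose E1 j := (`|sin (pi * (z0 - k%:R / N%:R + j%:R * a))| < d)%R%:R : R.
pose E2 j := (`|sin (pi * (z0 - k.+1%:R / N%:R + j%:R * a))| < d)%R%:R : R.
have bT : bdd (fun j => threshold N n (z0 + j%:R * a - k%:R / N%:R)).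
  by exists 1 => j; have /andP[t0 t1] := threshold_itv N n (z0 + j%:R * a - k%:R / N%:R);
     rewrite ger0_norm.
have b1 : bdd E1 by exact: bdd_bool.
have b2 : bdd E2 by exact: bdd_bool.
rewrite /rotation_orbit.
apply: (@le_trans _ _ (m (fun j => eps / 4 + (E1 j + E2 j)))).
  apply: (mean_le mm) => [||j]; [bd|bd|].
  rewrite cell_shift//; set x := z0 + j%:R * a - k%:R / N%:R.
  have x1 : z0 - k%:R / N%:R + j%:R * a = x by rewrite /x; ring.
  have x2 : z0 - k.+1%:R / N%:R + j%:R * a = - (N%:R^-1 - x).
    by rewrite /x -natr1; ring.
  have le1 : `|(cell N (fracpart x) == 0%N)%:R - threshold N n x| <= 1.
    have /andP[t0 t1] := threshold_itv N n x.
    by case: eqP => _; rewrite /= ?mulr1n ?mulr0n ler_norml; apply/andP; split; lra.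
  rewrite /E1 /E2 x1 x2 mulrN sinN normrN; have e40 : 0 <= eps / 4 by lra.
  case: (ltP (`|sin (pi * x)|) d) => h1 /=; first by case: (_ < d) => /=; lra.
  case: (ltP (`|sin (pi * (N%:R^-1 - x))|) d) => h2 /=; first by lra.
  by have := threshold_approx n N0 d0 h1 h2; lra.
rewrite (meanD mm); [|bd|bd]; rewrite (meanD mm)// (mean_cst mm).
have := hd (z0 - k%:R / N%:R) m mm; have := hd (z0 - k.+1%:R / N%:R) m mm.
by rewrite -/E1 -/E2; lra.
Qed.

Lemma bdd_sqmod (a : nat -> R[i]) (B : R) : (forall j, sqmod (a j) <= B) ->
  bdd (fun j => sqmod (a j)).
Proof. by move=> aB; exists B => j; rewrite ger0_norm ?sqmod_ge0. Qed.

Lemma Re_bound (z : R[i]) : `|Re z| <= 1 + sqmod z.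
Proof.
case: z => x y; rewrite /sqmod /= ler_norml.
have := sqr_ge0 y; have := sqr_ge0 (x - 1); have := sqr_ge0 (x + 1).
by move=> ? ? ?; apply/andP; split; nra.
Qed.

Lemma bdd_Re (a : nat -> R[i]) (B : R) : (forall j, sqmod (a j) <= B) ->
  bdd (fun j => Re (a j)).
Proof. by move=> aB; exists (1 + B) => j; rewrite (le_trans (Re_bound _))// lerD2l. Qed.

Section Decorrelation.
Variables (m : (nat -> R) -> R) (mm : mean_functional m).
Variables (phi : nat -> R) (phi01 : forall j, 0 <= phi j <= 1).
Variables (a : R) (ia : irrational_step a).
Hypothesis phi_orth : forall (k : int) (c : R[i]), k != 0 ->
  m (fun j => phi j * Re (c * cexp (k%:~R * (j%:R * a)))) = 0.

Let bphi : bdd phi.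
Proof. by exists 1 => j; have /andP[p0 p1] := phi01 j; rewrite ger0_norm. Qed.

(** Only the constant terms of [T] contribute, and they do not depend on [y]. *)
Lemma trig_decorrelation T : trig T -> exists c0 : R,
  forall y, m (fun j => phi j * Re (T (y + j%:R * a))) = c0 * m phi.
Proof.
move=> [l hl]; exists (\sum_(p <- l | p.2 == 0) Re p.1) => y.
have bt p : bdd (fun j => phi j * Re (p.1 * cexp (p.2%:~R * y) * cexp (p.2%:~R * (j%:R * a)))).
  apply: bddM => //; apply: (@bdd_Re _ (sqmod p.1)) => j.
  by rewrite !sqmodM !sqmod_cexp !mulr1.
transitivity (m (fun j => \sum_(p <- l)
    phi j * Re (p.1 * cexp (p.2%:~R * y) * cexp (p.2%:~R * (j%:R * a))))).
  congr m; apply/funext => j; rewrite hl Re_sum mulr_sumr.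
  by apply: eq_bigr => p _; rewrite mulrDr cexpD mulrA.
rewrite mean_sum// [in RHS]big_mkcond mulr_suml; apply: eq_bigr => p _.
case: eqP => [p0|/eqP p0]; last by rewrite phi_orth// mul0r.
rewrite -(meanZ mm)//; congr m; apply/funext => j.
by rewrite p0 !mul0r cexp0 !mulr1 mulrC.
Qed.

(** The weight only sees the constant terms of the threshold polynomials, which are
    translates of each other, so that each of the [N] intervals gets the same
    share. *)
Lemma rotation_independent (z0 : R) (N k : nat) : (k < N)%N ->
  m (fun j => phi j * (cell N (rotation_orbit z0 a j) == k)%:R) = m phi / N%:R.
Proof.
move=> kN; have N0 : (0 < N)%N by exact: leq_ltn_trans kN.
have Nr : 0 < N%:R :> R by rewrite ltr0n.
pose I k j := phi j * (cell N (rotation_orbit z0 a j) == k)%:R.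
have bI k' : bdd (I k') by apply: bddM => //; exact: bdd_bool.
have sumI : \sum_(k' < N) m (I k') = m phi.
  rewrite -mean_sum//; congr m; apply/funext => j; rewrite -mulr_sumr.
  have cN : (cell N (rotation_orbit z0 a j) < N)%N by rewrite cell_lt// fracpart_itv.
  rewrite (bigD1 (Ordinal cN))//= eqxx big1 ?addr0 ?mulr1// => k' k'n.
  by rewrite eq_sym -(inj_eq val_inj) in k'n; rewrite (negPf k'n).
(* All the [m (I k')] are within [e] of one number, the mean of the same
   trigonometric polynomial, and they add up to [m phi]. *)
suff hk (e : R) : 0 < e -> `|m (I k) - m phi / N%:R| <= 2 * e.
  apply/eqP; rewrite -subr_eq0 -normr_le0; apply/ler_addgt0Pl => e e0.
  by have := hk (e / 2); rewrite addr0 (_ : 2 * (e / 2) = e); [apply; rewrite divr_gt0|field].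
move=> e0; have [n hn] := rotation_interval_approx ia N0 e0.
have [c0 hc] := trig_decorrelation (trig_threshold N n).
have close k' : (k' < N)%N -> `|m (I k') - c0 * m phi| <= e.
  move=> k'N; rewrite -(hc (z0 - k'%:R / N%:R)) /=.
  apply: le_trans (hn z0 m k' mm k'N).
  have bT : bdd (fun j => threshold N n (z0 + j%:R * a - k'%:R / N%:R)).
    by exists 1 => j; have /andP[t0 t1] := threshold_itv N n (z0 + j%:R * a - k'%:R / N%:R);
       rewrite ger0_norm.
  have E : (fun j => phi j * threshold N n (z0 - k'%:R / N%:R + j%:R * a)) =
           fun j => phi j * threshold N n (z0 + j%:R * a - k'%:R / N%:R).
    by apply/funext => j; rewrite addrAC.
  rewrite E -(meanB mm)//; last bd.
  apply: le_trans (mean_norm mm _) _; first bd.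
  apply: (mean_le mm) => [||j]; [bd|by apply: bdd_norm; apply: bddD => //; [exact: bdd_bool|bd]|].
  rewrite -mulrBr normrM; have /andP[p0 p1] := phi01 j.
  by rewrite [`|phi j|]ger0_norm// ler_piMl.
have h2 : `|m phi / N%:R - c0 * m phi| <= e.
  rewrite -(ler_pM2l Nr) -[X in X * `|_|](gtr0_norm Nr) -normrM.
  have -> : N%:R * (m phi / N%:R - c0 * m phi) = \sum_(k' < N) (m (I k') - c0 * m phi).
    rewrite sumrB sumI sumr_const card_ord -[(c0 * _) *+ _]mulr_natl.
    by field; rewrite gt_eqF.
  apply: le_trans (ler_norm_sum _ _ _) _.
  apply: (@le_trans _ _ (\sum_(k' < N) e)); first by apply: ler_sum => k' _; exact: close.
  by rewrite sumr_const card_ord mulr_natl.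
have h1 := close k kN.
have -> : m (I k) - m phi / N%:R = (m (I k) - c0 * m phi) - (m phi / N%:R - c0 * m phi) by ring.
by rewrite (le_trans (ler_normB _ _))// mulr_natl mulr2n lerD.
Qed.

End Decorrelation.

(** Each product of two exponentials turns into a geometric sum, whose ratio is not
    1 because [beta] is not a frequency of the translation. *)
Lemma trig_twisted_avg (T1 T2 : R -> R[i]) (v1 v2 beta eps : R) :
  trig T1 -> trig T2 ->
  (forall r1 r2 n : int, r1%:~R * v1 + r2%:~R * v2 - beta <> n%:~R) -> 0 < eps ->
  exists2 H, (0 < H)%N & forall x1 x2,
    sqmod (H%:R^-1%:C%C * \sum_(h < H)
         cexp (- (h%:R * beta)) * (T1 (x1 + h%:R * v1) * T2 (x2 + h%:R * v2))) <= eps.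
Proof.
move=> [l1 h1] [l2 h2] nres eps0.
pose W (t : R[i] * (int * int)) x1 x2 := t.1 * cexp (t.2.1%:~R * x1 + t.2.2%:~R * x2).
pose l := [seq (p.1 * q.1, (p.2, q.2)) | p <- l1, q <- l2].
have TE x1 x2 : T1 x1 * T2 x2 = \sum_(t <- l) W t x1 x2.
  rewrite big_allpairs_dep h1 h2 mulr_suml; apply: eq_bigr => p _.
  rewrite mulr_sumr; apply: eq_bigr => q _.
  by rewrite /W /= cexpD; ring.
suff [H0 H00 hH] : exists2 H0, (0 < H0)%N & forall H, (H0 <= H)%N -> forall x1 x2,
    sqmod (H%:R^-1%:C%C * \sum_(h < H)
         cexp (- (h%:R * beta)) * \sum_(t <- l) W t (x1 + h%:R * v1) (x2 + h%:R * v2)) <= eps.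
  exists H0 => // x1 x2; have := hH _ (leqnn _) x1 x2.
  by congr (sqmod (_ * _) <= _); apply: eq_bigr => h _; rewrite TE.
elim: l eps eps0 {TE} => [|t l IH] eps eps0.
  exists 1%N => // H _ x1 x2; rewrite big1 ?mulr0 ?sqmod0 ?ltW// => h _.
  by rewrite big_nil mulr0.
have e4 : 0 < eps / 4 by rewrite divr_gt0.
have [HA HA0 hA] := IH _ e4.
have e5 : 0 < eps / 4 / (1 + sqmod t.1) by rewrite divr_gt0// ltr_pwDl// sqmod_ge0.
have [HB HB0 hB] := geometric_avg_small (nres t.2.1 t.2.2) e5.
exists (maxn HA HB) => [|H]; first by rewrite leq_max HA0.
rewrite geq_max => /andP[HHA HHB] x1 x2.
have -> : \sum_(h < H) cexp (- (h%:R * beta)) *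
     \sum_(t <- t :: l) W t (x1 + h%:R * v1) (x2 + h%:R * v2) =
   W t x1 x2 * \sum_(h < H) cexp (h%:R * (t.2.1%:~R * v1 + t.2.2%:~R * v2 - beta)) +
   \sum_(h < H) cexp (- (h%:R * beta)) *
     \sum_(t <- l) W t (x1 + h%:R * v1) (x2 + h%:R * v2).
  rewrite mulr_sumr -big_split; apply: eq_bigr => h _ /=.
  rewrite big_cons mulrDr; congr (_ + _).
  rewrite /W -mulrA -cexpD mulrCA -cexpD; congr (_ * cexp _); ring.
rewrite mulrDr; apply: le_trans (sqmodD_le _ _) _.
have := hA H HHA x1 x2; set X := sqmod _ => hX.
suff : sqmod ((H%:R^-1)%:C%C * (W t x1 x2 *
    \sum_(h < H) cexp (h%:R * (t.2.1%:~R * v1 + t.2.2%:~R * v2 - beta)))) <= eps / 4.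
  by lra.
rewrite mulrCA sqmodM /W sqmodM sqmod_cexp mulr1.
have := hB H HHB; rewrite ler_pdivlMr ?ltr_pwDl ?sqmod_ge0//.
set Y := sqmod (_ * _); have : 0 <= Y by exact: sqmod_ge0.
have := sqmod_ge0 t.1; nra.
Qed.

End Rotation.

(** * Elementary symmetric functions of the values on the sheets *)

Section ElementarySymmetric.
Context {R : realType} {s : nat}.
Implicit Types (z w : 'I_s -> R[i]) (n : nat).

Definition elem_sym n z : R[i] := \sum_(J : {set 'I_s} | #|J| == n) \prod_(i in J) z i.

Lemma elem_sym_perm n z (p : {perm 'I_s}) : elem_sym n (fun i => z (p i)) = elem_sym n z.
Proof.
have pI := @perm_inj _ p.
rewrite /elem_sym [RHS](reindex_inj (imset_inj pI)) /=.
apply: eq_big => [J|J _]; first by rewrite card_imset.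
by rewrite big_imset//= => ? ? _ _; exact: pI.
Qed.

Lemma elem_symZ n (u : R[i]) z : elem_sym n (fun i => u * z i) = u ^+ n * elem_sym n z.
Proof.
rewrite /elem_sym mulr_sumr; apply: eq_bigr => J /eqP Jn.
by rewrite big_split /= prodr_const Jn.
Qed.

Lemma sqmod_prod_le1 (r : seq 'I_s) (p : pred 'I_s) z : (forall i, sqmod (z i) <= 1) ->
  sqmod (\prod_(i <- r | p i) z i) <= 1.
Proof.
move=> z1; rewrite sqmod_prod.
suff /andP[] : 0 <= \prod_(i <- r | p i) sqmod (z i) <= 1 by [].
apply: (big_ind (fun x : R => 0 <= x <= 1)) => [|x y|i _].
- by rewrite ler01 lexx.
- by move=> /andP[x0 x1] /andP[y0 y1]; rewrite mulr_ge0//= mulr_ile1.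
- by rewrite sqmod_ge0 z1.
Qed.

Let nS : R := #|{set 'I_s}|%:R.

Lemma sqmod_elem_sym_le n z : (forall i, sqmod (z i) <= 1) -> sqmod (elem_sym n z) <= nS ^+ 2.
Proof.
move=> z1; rewrite /elem_sym big_mkcond; apply: le_trans (sqmod_sum _) _.
rewrite expr2 ler_wpM2l//; apply: (@le_trans _ _ (\sum_(J : {set 'I_s}) 1)).
  apply: ler_sum => J _; case: ifP => _; first exact: sqmod_prod_le1.
  by rewrite sqmod0.
by rewrite sumr_const.
Qed.

(** Replace the factors one at a time; a factor 2 is lost at each step because
    the squared modulus is not subadditive. *)
Lemma sqmod_prodB_le (r : seq 'I_s) (p : pred 'I_s) z w :
  (forall i, sqmod (z i) <= 1) -> (forall i, sqmod (w i) <= 1) ->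
  sqmod (\prod_(i <- r | p i) z i - \prod_(i <- r | p i) w i)
  <= 2 ^+ size r * \sum_(i <- r) sqmod (z i - w i).
Proof.
move=> z1 w1; elim: r => [|i r IH] /=.
  by rewrite !big_nil subrr sqmod0 mulr0.
rewrite !big_cons exprS; set S := \sum_(j <- r) _ in IH *.
have S0 : 0 <= S by apply: sumr_ge0 => j _; exact: sqmod_ge0.
have A1 : 1 <= 2 ^+ size r :> R by rewrite exprn_ege1// ler1n.
set A := 2 ^+ size r in A1 IH *; have D0 := sqmod_ge0 (z i - w i).
case: ifP => pi; last first.
  apply: le_trans IH _; have h1 : 0 <= A * sqmod (z i - w i) by rewrite mulr_ge0//; lra.
  have h2 : 0 <= A * S by rewrite mulr_ge0//; lra.
  lra.
set Z := \prod_(j <- r | p j) z j in IH *; set W := \prod_(j <- r | p j) w j in IH *.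
have -> : z i * Z - w i * W = (z i - w i) * Z + w i * (Z - W) by ring.
apply: le_trans (sqmodD_le _ _) _; rewrite !sqmodM.
have Z1 : sqmod Z <= 1 by exact: sqmod_prod_le1.
have h1 : sqmod (z i - w i) * sqmod Z <= sqmod (z i - w i) by rewrite ler_piMr.
have h2 : sqmod (w i) * sqmod (Z - W) <= sqmod (Z - W) by rewrite ler_piMl// sqmod_ge0.
have h3 : sqmod (z i - w i) <= A * sqmod (z i - w i) by rewrite ler_peMl.
have h4 : sqmod (z i - w i) * sqmod Z + sqmod (w i) * sqmod (Z - W) <=
   A * sqmod (z i - w i) + A * S by lra.
lra.
Qed.

(** A Lipschitz constant for [elem_sym] on the unit polydisc, in the squared
    Euclidean norm. *)
Definition elem_sym_lip : R := nS ^+ 2 * 2 ^+ s.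

Lemma elem_sym_lip_ge0 : 0 <= elem_sym_lip.
Proof. by rewrite mulr_ge0// exprn_ge0. Qed.

Lemma sqmod_elem_symB_le n z w :
  (forall i, sqmod (z i) <= 1) -> (forall i, sqmod (w i) <= 1) ->
  sqmod (elem_sym n z - elem_sym n w) <= elem_sym_lip * \sum_i sqmod (z i - w i).
Proof.
move=> z1 w1; rewrite /elem_sym -sumrB big_mkcond; apply: le_trans (sqmod_sum _) _.
rewrite /elem_sym_lip expr2 -!mulrA ler_wpM2l//.
set X := 2 ^+ s * _; apply: (@le_trans _ _ (\sum_(J : {set 'I_s}) X)); last first.
  by rewrite sumr_const mulr_natl.
apply: ler_sum => J _.
have sz : size (index_enum 'I_s) = s by rewrite -[RHS]card_ord cardT enumT.
have X0 : 0 <= X by rewrite mulr_ge0// ?exprn_ge0// sumr_ge0// => i _; exact: sqmod_ge0.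
case: ifP => _; last by rewrite sqmod0.
by have := sqmod_prodB_le (index_enum 'I_s) (mem J) z1 w1; rewrite sz.
Qed.

(** Vieta's formula. *)
Lemma prodD_elem_sym (x : R[i]) z :
  \prod_i (x + z i) = \sum_(n < s.+1) elem_sym n z * x ^+ (s - n).
Proof.
rewrite (eq_bigr (fun i => z i + x)) => [|i _]; last by rewrite addrC.
rewrite bigA_distr /= (partition_big (fun J : {set 'I_s} => inord #|J| : 'I_s.+1) xpredT)//=.
apply: eq_bigr => n _; rewrite /elem_sym mulr_suml.
apply: eq_big => [J|J /eqP Jn].
  rewrite -val_eqE /= inordK// ltnS -[leqRHS]card_ord; exact: max_card.
rewrite -(_ : #|J| = n); last first.
  by rewrite -Jn inordK// ltnS -[leqRHS]card_ord; exact: max_card.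
rewrite (bigID (mem J)) /=; congr (_ * _).
  by apply: eq_bigr => i ->.
rewrite (eq_bigr (fun=> x)) => [|i /negPf ->]//.
rewrite prodr_const; congr (x ^+ _).
have <- : #|~: J| = (s - #|J|)%N by have := cardsC J; rewrite card_ord; lia.
by apply: eq_card => i; rewrite !inE.
Qed.

(** Each [z i0] is a root of [\prod_i (X - z i)], whose lower coefficients are
    the elementary symmetric functions; so it is small when they are. *)
Lemma sqmod_le_elem_sym z i0 : (forall i, sqmod (z i) <= 1) ->
  sqmod (z i0) ^+ s <= s%:R * \sum_(n < s) sqmod (elem_sym n.+1 z).
Proof.
move=> z1.
have e0 w : elem_sym 0 w = 1.
  rewrite /elem_sym (big_pred1 (finset.set0 : {set _})) => [|J]; last by rewrite /= cards_eq0.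
  by rewrite big_set0.
have : \prod_i (z i0 + (-1) * z i) = 0.
  by rewrite (bigD1 i0)//= mulN1r subrr mul0r.
rewrite prodD_elem_sym big_ord_recl /= e0 mul1r subn0 => /eqP; rewrite addr_eq0 => /eqP h.
rewrite -sqmodX h sqmodN; apply: le_trans (sqmod_sum_ord _) _.
rewrite ler_wpM2l//; apply: ler_sum => n _; rewrite /bump /= add1n elem_symZ !sqmodM !sqmodX.
rewrite sqmodN sqmod1 expr1n mul1r ler_piMr ?sqmod_ge0//.
by rewrite exprn_ile1// sqmod_ge0.
Qed.

End ElementarySymmetric.

(** * Eigenvalues of a skew product with finite fibres *)

Lemma bdd_sqmodB {R : realType} (f g : nat -> R[i]) (A B : R) :
  (forall j, sqmod (f j) <= A) -> (forall j, sqmod (g j) <= B) ->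
  bdd (fun j => sqmod (f j - g j)).
Proof.
move=> fA gB; apply: (@bdd_sqmod _ _ (2 * A + 2 * B)) => j.
by apply: le_trans (sqmodB_le _ _) _; have := fA j; have := gB j; lra.
Qed.

Section SkewProduct.
Context {R : realType} {s : nat}.
Variables (m : (nat -> R) -> R) (mm : mean_functional m).
Variables (sheet : nat -> 'I_s) (a1 a2 v1 v2 : R).

Local Notation y1 := (rotation_orbit a1 v1).
Local Notation y2 := (rotation_orbit a2 v2).

(** The value of a step function along the orbit: [c] is constant on the cells of
    side [1/N] of each sheet. *)
Definition step {X : Type} (c : 'I_s -> nat -> nat -> X) (N j : nat) : X :=
  c (sheet j) (cell N (y1 j)) (cell N (y2 j)).

Definition equidistributed_on_cells : Prop :=
  forall (N : nat) (i : 'I_s) (k1 k2 : nat), (k1 < N)%N -> (k2 < N)%N ->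
    m (step (fun i' k1' k2' => [&& i' == i, k1' == k1 & k2' == k2]%:R) N)
      = (s%:R * N%:R ^+ 2)^-1.

(** The geometry of the surface enters the argument through this property only:
    most cells of a fine grid travel as wholes, bijectively on the sheets. *)
Definition cellwise_dynamics : Prop :=
  forall (N h : nat) (d : R), (0 < N)%N -> 0 < d ->
  exists Q (bad : nat -> nat -> bool) (p : nat -> nat -> {perm 'I_s}) (t : nat -> nat -> nat * nat),
    [/\ (0 < Q)%N,
     \sum_(k : 'I_(N * Q) * 'I_(N * Q)) (bad k.1 k.2)%:R <= d * (N * Q)%:R ^+ 2 &
     forall j, let k1 := cell (N * Q) (y1 j) in let k2 := cell (N * Q) (y2 j) in
       ~~ bad k1 k2 ->
       [/\ sheet (j + h) = p k1 k2 (sheet j),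
           cell N (y1 (j + h)) = (t k1 k2).1 & cell N (y2 (j + h)) = (t k1 k2).2]].

Hypothesis (ud : equidistributed_on_cells) (dyn : cellwise_dynamics).

Let s0 : (0 < s)%N. Proof. exact: leq_ltn_trans (ltn_ord (sheet 0)). Qed.
Let sr : 0 < s%:R :> R. Proof. by rewrite ltr0n. Qed.

Let y1_ge0 j : 0 <= y1 j. Proof. by have /andP[] := fracpart_itv (a1 + j%:R * v1). Qed.
Let y2_ge0 j : 0 <= y2 j. Proof. by have /andP[] := fracpart_itv (a2 + j%:R * v2). Qed.

Let cell1_lt N j : (0 < N)%N -> (cell N (y1 j) < N)%N.
Proof. by move=> N0; rewrite cell_lt// fracpart_itv. Qed.
Let cell2_lt N j : (0 < N)%N -> (cell N (y2 j) < N)%N.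
Proof. by move=> N0; rewrite cell_lt// fracpart_itv. Qed.

Lemma step_sum (G : 'I_s -> nat -> nat -> R) N : (0 < N)%N ->
  step G N = fun j => \sum_(q : 'I_s * ('I_N * 'I_N)) G q.1 q.2.1 q.2.2 *
    step (fun i' k1' k2' => [&& i' == q.1, k1' == q.2.1 & k2' == q.2.2]%:R) N j.
Proof.
move=> N0; apply/funext => j; rewrite /step.
rewrite (bigD1 (sheet j, (Ordinal (cell1_lt j N0), Ordinal (cell2_lt j N0))))//=.
rewrite !eqxx mulr1 big1 ?addr0// => -[i [k1 k2]] /= ne.
case: and3P => [[/eqP e1 /eqP e2 /eqP e3]|_]; last by rewrite mulr0.
by case/negP: ne; rewrite xpair_eqE xpair_eqE -!val_eqE /= e1 e2 e3 !eqxx.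
Qed.

Lemma bdd_step (G : 'I_s -> nat -> nat -> R) N : (0 < N)%N -> bdd (step G N).
Proof.
move=> N0; rewrite step_sum//; apply: bdd_sum => q; apply: bddM; first bd.
exact: bdd_bool.
Qed.

Lemma mean_step (G : 'I_s -> nat -> nat -> R) N : (0 < N)%N ->
  m (step G N) = (s%:R * N%:R ^+ 2)^-1 * \sum_(q : 'I_s * ('I_N * 'I_N)) G q.1 q.2.1 q.2.2.
Proof.
move=> N0; rewrite step_sum// mean_sum// => [|q]; last first.
  by apply: bddM; [bd|exact: bdd_bool].
rewrite mulr_sumr; apply: eq_bigr => q _.
rewrite mulrC -(ud q.1 (ltn_ord q.2.1) (ltn_ord q.2.2)).
by apply: (meanZ mm); exact: bdd_bool.
Qed.

Let sum_sheet_cell N (F : 'I_s -> 'I_N * 'I_N -> R) :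
  \sum_(q : 'I_s * ('I_N * 'I_N)) F q.1 q.2 = \sum_i \sum_k F i k.
Proof. by rewrite pair_bigA. Qed.

(** Equidistribution transfers information from the sheet of the orbit to all
    the sheets above the same point of the torus. *)
Lemma mean_sum_sheets (G : 'I_s -> nat -> nat -> R) N : (0 < N)%N ->
  m (step (fun=> fun k1 k2 => \sum_i G i k1 k2) N) = s%:R * m (step G N).
Proof.
move=> N0; rewrite !mean_step// [RHS]mulrCA /=; congr (_ * _).
have /= -> := sum_sheet_cell (fun _ (k : 'I_N * 'I_N) => \sum_i G i k.1 k.2).
have /= -> := sum_sheet_cell (fun i (k : 'I_N * 'I_N) => G i k.1 k.2).
by rewrite sumr_const card_ord -[_ *+ s]mulr_natl exchange_big.
Qed.

Lemma mean_bad (bad : nat -> nat -> bool) (N : nat) (d : R) : (0 < N)%N ->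
  \sum_(k : 'I_N * 'I_N) (bad k.1 k.2)%:R <= d * N%:R ^+ 2 ->
  m (step (fun=> fun k1 k2 => (bad k1 k2)%:R) N) <= d.
Proof.
move=> N0 hb; rewrite mean_step//=.
have /= -> := sum_sheet_cell (fun _ (k : 'I_N * 'I_N) => (bad k.1 k.2)%:R : R).
rewrite sumr_const card_ord -[(\sum_k _) *+ s]mulr_natl.
have N2 : 0 < N%:R ^+ 2 :> R by rewrite exprn_gt0// ltr0n.
by rewrite ler_pdivrMl ?(mulr_gt0 sr N2)// -mulrA ler_wpM2l// [_ * d]mulrC.
Qed.

Hypothesis (iv1 : irrational_step v1) (iv2 : irrational_step v2).

(** Averaging the twisted translates changes [E] little, but makes small the
    trigonometric polynomial that approximates it, since none of its frequencies
    agrees with [beta]. *)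
Lemma torus_nonresonant_small (beta kappa M : R) (F : nat -> nat -> R[i]) N :
  (0 < N)%N -> (forall k1 k2, sqmod (F k1 k2) <= M) ->
  (forall r1 r2 n : int, r1%:~R * v1 + r2%:~R * v2 - beta <> n%:~R) ->
  let E j := step (fun=> F) N j in
  (forall h, m (fun j => sqmod (E j - cexp (- (h%:R * beta)) * E (j + h)%N)) <= kappa) ->
  m (fun j => sqmod (E j)) <= 2 * kappa.
Proof.
move=> N0 FM nres E hE; have M0 : 0 <= M by rewrite (le_trans _ (FM 0%N 0%N))// sqmod_ge0.
have EM j : sqmod (E j) <= M by exact: FM.
apply/ler_addgt0Pl => d6 d60.
(* A factor [N ^ 2] for each of two sums over the cells: one from the
   Cauchy-Schwarz inequality, one from the number of terms. *)
pose A : R := M * N%:R ^+ 4; have A0 : 0 <= A by rewrite mulr_ge0// exprn_ge0.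
have A1 : 0 < 1 + 12 * A by lra.
pose eps := d6 / (1 + 12 * A); have e0 : 0 < eps by rewrite divr_gt0.
have [n1 hn1] := rotation_interval_approx iv1 N0 e0.
have [n2 hn2] := rotation_interval_approx iv2 N0 e0.
pose T1 x := threshold N n1 x : R; pose T2 x := threshold N n2 x : R.
have [H H0 hH] := trig_twisted_avg (trig_threshold N n1) (trig_threshold N n2) nres e0.
pose x1 (k : 'I_N * 'I_N) j := a1 + j%:R * v1 - (k.1)%:R / N%:R.
pose x2 (k : 'I_N * 'I_N) j := a2 + j%:R * v2 - (k.2)%:R / N%:R.
pose q j : R[i] := \sum_(k : 'I_N * 'I_N) F k.1 k.2 * (T1 (x1 k j) * T2 (x2 k j))%:C%C.
pose I1 (k : 'I_N * 'I_N) j : R := (cell N (y1 j) == k.1)%:R.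
pose I2 (k : 'I_N * 'I_N) j : R := (cell N (y2 j) == k.2)%:R.
have EI j : E j = \sum_(k : 'I_N * 'I_N) F k.1 k.2 * (I1 k j * I2 k j)%:C%C.
  rewrite (bigD1 (Ordinal (cell1_lt j N0), Ordinal (cell2_lt j N0)))//=.
  rewrite /I1 /I2 /= !eqxx mulr1 rmorph1 mulr1 big1 ?addr0// => -[k1 k2] /= ne.
  have [e1|_] := eqVneq (cell N (y1 j)) k1; last by rewrite mul0r rmorph0 mulr0.
  have [e2|_] := eqVneq (cell N (y2 j)) k2; last by rewrite mulr0 rmorph0 mulr0.
  by case/negP: ne; rewrite xpair_eqE -!val_eqE /= e1 e2 !eqxx.
pose D1 k j := `|I1 k j - T1 (x1 k j)|; pose D2 k j := `|I2 k j - T2 (x2 k j)|.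
have bT (n : nat) (f : nat -> R) : bdd (fun j => threshold N n (f j)).
  by exists 1 => j; have /andP[? ?] := threshold_itv N n (f j); rewrite ger0_norm.
have bD1 k : bdd (D1 k) by apply: bdd_norm; apply: bddD; [exact: bdd_bool|apply: bddN; exact: bT].
have bD2 k : bdd (D2 k) by apply: bdd_norm; apply: bddD; [exact: bdd_bool|apply: bddN; exact: bT].
have card2 : #|{: 'I_N * 'I_N}|%:R = N%:R ^+ 2 :> R.
  by rewrite card_prod card_ord natrM expr2.
have sumcard (x : R) : \sum_(k : 'I_N * 'I_N) x = N%:R ^+ 2 * x.
  by rewrite sumr_const -card2 mulr_natl.
have qB j : sqmod (q j) <= N%:R ^+ 2 * (N%:R ^+ 2 * M).
  apply: le_trans (sqmod_sum _) _; rewrite card2 ler_wpM2l ?exprn_ge0//.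
  rewrite -sumcard; apply: ler_sum => k _; rewrite sqmodM sqmod_real.
  have /andP[? ?] := threshold_itv N n1 (x1 k j).
  have /andP[? ?] := threshold_itv N n2 (x2 k j).
  apply: le_trans (FM k.1 k.2); rewrite ler_piMr ?sqmod_ge0//.
  by rewrite exprn_ile1 ?mulr_ge0// mulr_ile1.
have bEq : bdd (fun j => sqmod (E j - q j)) by exact: bdd_sqmodB EM qB.
have mEq : m (fun j => sqmod (E j - q j)) <= 2 * A * eps.
  apply: (@le_trans _ _ (m (fun j => N%:R ^+ 2 * \sum_(k : 'I_N * 'I_N) (M * (D1 k j + D2 k j))))).
    apply: (mean_le mm) => [//||j].
      by apply: bddM; [bd|apply: bdd_sum => k; bd].
    rewrite EI /q -sumrB; apply: le_trans (sqmod_sum _) _.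
    rewrite card2 ler_wpM2l ?exprn_ge0//; apply: ler_sum => k _.
    rewrite -mulrBr sqmodM -rmorphB sqmod_real ler_pM ?sqmod_ge0 ?sqr_ge0//.
    rewrite /D1 /D2; have /andP[] := threshold_itv N n1 (x1 k j).
    have /andP[] := threshold_itv N n2 (x2 k j).
    rewrite -/(T1 _) -/(T2 _); set p1 := T1 _; set p2 := T2 _ => b2 b2' b1 b1'.
    have hp : 0 <= p1 * p2 <= 1 by rewrite mulr_ge0//= mulr_ile1.
    move/andP: hp => [hp0 hp1].
    have p12 : p1 * p2 <= p1 by rewrite ler_piMr.
    have p21 : p1 * p2 <= p2 by rewrite ler_piMl.
    have hz : 0 <= (1 - p1) * (1 - p2) by rewrite mulr_ge0// subr_ge0.
    rewrite /I1 /I2; clear -b1 b1' b2 b2' p12 p21 hz hp0 hp1.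
    case: (_ == _); case: (_ == _); rewrite /= ?mulr1 ?mulr0 ?mul0r ?sub0r;
      rewrite ?normrN ?[`|p1|]ger0_norm// ?[`|p2|]ger0_norm// ?[`|1 - _|]ger0_norm ?subr_ge0//; nra.
  rewrite (meanZ mm); last by apply: bdd_sum => k; bd.
  rewrite (mean_sum mm) => [|k]; last by apply: bddM; [bd|exact: bddD].
  apply: (@le_trans _ _ (N%:R ^+ 2 * \sum_(k : 'I_N * 'I_N) (M * (2 * eps)))).
    rewrite ler_wpM2l ?exprn_ge0//; apply: ler_sum => k _.
    rewrite (meanZ mm); last bd.
    rewrite ler_wpM2l// (meanD mm)//.
    by have := hn1 a1 m k.1 mm (ltn_ord _); have := hn2 a2 m k.2 mm (ltn_ord _); rewrite /D1 /D2 /I1 /I2; lra.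
  by rewrite sumcard /A le_eqVlt; apply/orP; left; apply/eqP; ring.
pose w h := cexp (- (h%:R * beta)).
(* The twisted average [av] nearly fixes [E], and nearly kills [q]. *)
pose av (f : nat -> R[i]) j := H%:R^-1%:C%C * \sum_(h < H) w h * f (j + h)%N.
have avE j : sqmod (E j - av E j) <= H%:R^-1 * \sum_(h < H) sqmod (E j - w h * E (j + h)%N).
  have -> : E j - av E j = H%:R^-1%:C%C * \sum_(h < H) (E j - w h * E (j + h)%N).
    rewrite sumrB mulrBr; congr (_ - _).
    rewrite sumr_const card_ord -[E j *+ H]mulr_natl mulrA.
    by rewrite -(rmorph_nat (real_complex R)) -rmorphM /= mulVf ?mul1r// pnatr_eq0 -lt0n.
  exact: sqmod_avg.
have avEq j : sqmod (av E j - av q j) <= H%:R^-1 * \sum_(h < H) sqmod (E (j + h)%N - q (j + h)%N).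
  rewrite /av -mulrBr -sumrB; apply: le_trans (sqmod_avg _ H0) _.
  rewrite ler_wpM2l ?invr_ge0//; apply: ler_sum => h _.
  by rewrite -mulrBr sqmodM sqmod_cexp mul1r.
have avq j : sqmod (av q j) <= A * eps.
  have -> : av q j = \sum_(k : 'I_N * 'I_N) F k.1 k.2 * (H%:R^-1%:C%C * \sum_(h < H)
     w h * ((T1 (x1 k j + h%:R * v1))%:C%C * (T2 (x2 k j + h%:R * v2))%:C%C)).
    rewrite /av /q; under eq_bigr do rewrite mulr_sumr.
    rewrite exchange_big mulr_sumr; apply: eq_bigr => k _ /=.
    rewrite mulrCA; congr (_ * _); rewrite mulr_sumr; apply: eq_bigr => h _.
    rewrite mulrCA; congr (_ * (_ * _)); rewrite -rmorphM; congr (T1 _ * T2 _)%:C%C.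
      by rewrite /x1 natrD; ring.
    by rewrite /x2 natrD; ring.
  apply: le_trans (sqmod_sum _) _.
  have -> : A * eps = N%:R ^+ 2 * (N%:R ^+ 2 * (M * eps)) by rewrite /A; ring.
  rewrite card2 ler_wpM2l ?exprn_ge0// -sumcard; apply: ler_sum => k _.
  by rewrite sqmodM ler_pM ?sqmod_ge0//; exact: hH.
have wEM h j : sqmod (w h * E j) <= M by rewrite sqmodM sqmod_cexp mul1r.
have bEw (h : 'I_H) : bdd (fun j => sqmod (E j - w h * E (j + h)%N)) by exact: bdd_sqmodB EM _.
have bEqS (h : 'I_H) : bdd (fun j => sqmod (E (j + h)%N - q (j + h)%N)).
  by move: bEq => [b hb]; exists b => j.
pose U1 j := H%:R^-1 * \sum_(h < H) sqmod (E j - w h * E (j + h)%N).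
pose U2 j := H%:R^-1 * \sum_(h < H) sqmod (E (j + h)%N - q (j + h)%N).
have bU1 : bdd U1 by apply: bddM; [bd|exact: bdd_sum].
have bU2 : bdd U2 by apply: bddM; [bd|exact: bdd_sum].
have Hr : 0 < H%:R :> R by rewrite ltr0n.
have mU1 : m U1 <= kappa.
  rewrite (meanZ mm); last exact: bdd_sum.
  rewrite mean_sum// ler_pdivrMl//.
  apply: (@le_trans _ _ (\sum_(h < H) kappa)); first by apply: ler_sum => h _; exact: hE.
  by rewrite sumr_const card_ord mulr_natl.
have mU2 : m U2 <= 2 * A * eps.
  rewrite (meanZ mm); last exact: bdd_sum.
  rewrite mean_sum// ler_pdivrMl//.
  apply: (@le_trans _ _ (\sum_(h < H) (2 * A * eps))).
    by apply: ler_sum => h _; rewrite (meanS mm h bEq).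
  by rewrite sumr_const card_ord -[_ *+ H]mulr_natl.
apply: (@le_trans _ _ (m (fun j => 2 * U1 j + (4 * U2 j + 4 * (A * eps))))).
  apply: (mean_le mm) => [||j]; [exact: bdd_sqmod EM|bd|].
  have h1 := sqmodD_le (E j - av E j) (av E j); rewrite subrK in h1.
  have h2 := sqmodD_le (av E j - av q j) (av q j); rewrite subrK in h2.
  by have := avE j; have := avEq j; have := avq j; rewrite -/(U1 j) -/(U2 j); lra.
rewrite (meanD mm); [|bd|bd]; rewrite (meanD mm); [|bd|bd].
rewrite (mean_cst mm) (meanZ mm 2 bU1) (meanZ mm 4 bU2).
have : (1 + 12 * A) * eps = d6 by rewrite mulrC divfK// gt_eqF.
lra.
Qed.

Section Eigenvalue.
Variable theta : R.
Let e j : R[i] := cexp (j%:R * theta).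

Let unit_step (c : 'I_s -> nat -> nat -> R[i]) := forall i k1 k2, sqmod (c i k1 k2) <= 1.

Let dist c N := m (fun j => sqmod (e j - step c N j)).

Let ne j : sqmod (e j) <= 1. Proof. by rewrite sqmod_cexp. Qed.

Let dist_ge0 c N : unit_step c -> 0 <= dist c N.
Proof.
move=> c1; apply: (mean_ge0 mm) => [|j]; last exact: sqmod_ge0.
by apply: (bdd_sqmodB ne) => j; exact: c1.
Qed.

(** Two near-minimizers of the distance to the sequence [e] are close to each
    other by the parallelogram identity; a twisted translate of a near-minimizer
    is one again, because the twisted translation fixes [e]. *)
Lemma near_minimizer_eigen (eta eps : R) c N : (0 < N)%N -> unit_step c ->
  (forall c' N', (0 < N')%N -> unit_step c' -> eta <= dist c' N') ->
  dist c N <= eta + eps -> forall h,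
  m (fun j => sqmod (step c N j - cexp (- (h%:R * theta)) * step c N (j + h))) <= 4 * eps.
Proof.
move=> N0 c1 etamin cmin h; apply/ler_addgt0Pl => d6 d60.
set d := d6 / 6; have d0 : 0 < d by rewrite divr_gt0.
have [Q [bad [p [t [Q0 hbad hdyn]]]]] := dyn h N0 d0.
have NQ0 : (0 < N * Q)%N by rewrite muln_gt0 N0.
pose u := cexp (- (h%:R * theta)).
(* The step function [c'] represents the twisted translate [b] of [c] outside the
   bad cells; [c2] below is the midpoint of [c] and [c']. *)
pose c' i k1 k2 := if bad k1 k2 then 0 else u * c (p k1 k2 i) (t k1 k2).1 (t k1 k2).2.
have c'1 : unit_step c'.
  by move=> i k1 k2; rewrite /c'; case: ifP; rewrite ?sqmod0// sqmodM sqmod_cexp mul1r.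
pose B j : R := step (fun=> fun k1 k2 => (bad k1 k2)%:R) (N * Q) j.
have bB : bdd B by exact: (@bdd_step (fun _ k1 k2 => (bad k1 k2)%:R) _ NQ0).
have mB : m B <= d by exact: mean_bad NQ0 hbad.
pose a j := step c N j; pose b j := u * step c N (j + h); pose b' j := step c' (N * Q) j.
have a1' j : sqmod (a j) <= 1 by exact: c1.
have b1' j : sqmod (b j) <= 1 by rewrite sqmodM sqmod_cexp mul1r; exact: c1.
have b'1 j : sqmod (b' j) <= 1 by exact: c'1.
have b_ea : bdd (fun j => sqmod (e j - a j)) by exact: bdd_sqmodB ne a1'.
have b_ebb : bdd (fun j => sqmod (e j - b j)) by exact: bdd_sqmodB ne b1'.
have b_eb : bdd (fun j => sqmod (e j - b' j)) by exact: bdd_sqmodB ne b'1.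
have bb' j : b' j = b j \/ B j = 1 /\ b' j = 0.
  rewrite /b' /B /step /c'; have := hdyn j; rewrite /= -/(y1 j) -/(y2 j).
  case: (bad _ _) => [_|/(_ isT)[e1 e2 e3]]; [by right|left].
  by rewrite /b /step e1 e2 e3.
have B0 j : 0 <= B j by rewrite /B /step.
have distb : m (fun j => sqmod (e j - b j)) = dist c N.
  rewrite /dist -[RHS](meanS mm h)//.
  congr m; apply/funext => j; rewrite -[RHS]mul1r -(sqmod_cexp (- (h%:R * theta))) -sqmodM -/u.
  by rewrite mulrBr /e -cexpD; congr (sqmod (cexp _ - _)); rewrite natrD; ring.
have distb' : dist c' (N * Q) <= eta + eps + d.
  apply: (@le_trans _ _ (m (fun j => sqmod (e j - b j) + B j))); last first.
    by rewrite (meanD mm)// distb lerD.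
  apply: (mean_le mm) => [||j]; [exact: b_eb|bd|].
  rewrite -/(b' j); have := bb' j => -[->|[-> ->]]; first by rewrite lerDl.
  by rewrite subr0 sqmod_cexp lerDr sqmod_ge0.
pose half : R[i] := (2^-1)%:C%C.
pose c2 i k1 k2 := half * (c i (k1 %/ Q)%N (k2 %/ Q)%N + c' i k1 k2).
have step2 j : step c2 (N * Q) j = half * (a j + b' j).
  by rewrite /step /c2 /a /b' /step -!cell_refine.
have sqmodh : sqmod half = 4^-1 by rewrite sqmod_real exprVn; congr _^-1; ring.
have c21 : unit_step c2.
  move=> i k1 k2; rewrite /c2 sqmodM sqmodh ler_pdivrMl// mulr1.
  apply: le_trans (sqmodD_le _ _) _.
  by have := c1 i (k1 %/ Q)%N (k2 %/ Q)%N; have := c'1 i k1 k2; lra.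
have := etamin _ _ NQ0 c21; rewrite /dist => hmid.
have par j : sqmod (a j - b' j) = 2 * sqmod (e j - a j) + 2 * sqmod (e j - b' j)
   + (- 4) * sqmod (e j - step c2 (N * Q) j).
  have := sqmod_parallelogram (e j - a j) (e j - b' j); rewrite step2.
  have -> : e j - a j - (e j - b' j) = - (a j - b' j) by ring.
  have -> : e j - a j + (e j - b' j) = 2%:C%C * (e j - half * (a j + b' j)).
    have h2 : 2%:C%C * half = 1 by rewrite -rmorphM /= divff// pnatr_eq0.
    have e2 : 2%:C%C = 2%:R :> R[i] by exact: (rmorph_nat (real_complex R) 2).
    by rewrite mulrBr mulrA h2 mul1r e2; ring.
  by rewrite sqmodN sqmodM sqmod_real => <-; ring.
have b_e2 : bdd (fun j => sqmod (e j - step c2 (N * Q) j)).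
  by apply: (bdd_sqmodB ne) => j; exact: c21.
have b_ab : bdd (fun j => sqmod (a j - b' j)) by exact: bdd_sqmodB a1' b'1.
have hab' : m (fun j => sqmod (a j - b' j)) <= 4 * eps + 2 * d.
  under eq_fun do rewrite par.
  rewrite (meanD mm); [|bd|bd]; rewrite (meanD mm); [|bd|bd].
  rewrite !(meanZ mm)//; move: cmin distb' hmid; rewrite /dist -/a -/b'.
  lra.
apply: (@le_trans _ _ (m (fun j => sqmod (a j - b' j) + 4 * B j))); last first.
  rewrite (meanD mm)//; last bd.
  by rewrite (meanZ mm)//; move: hab' mB; rewrite /d; lra.
apply: (mean_le mm) => [||j]; [exact: bdd_sqmodB a1' b1'|bd|].
rewrite -/(a j) -/u -/(b j); have := bb' j => -[->|[-> ->]].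
  by rewrite lerDl mulr_ge0.
apply: le_trans (sqmodB_le _ _) _; have := a1' j; have := b1' j.
by have := sqmod_ge0 (a j - 0); lra.
Qed.

(** The dynamics permutes the sheets, and [elem_sym n] is symmetric and homogeneous
    of degree [n]: this is where [n * theta] comes from. *)
Lemma elem_sym_eigen (kappa : R) c N n : (0 < N)%N -> unit_step c ->
  (forall h, m (fun j => sqmod (step c N j -
     cexp (- (h%:R * theta)) * step c N (j + h))) <= kappa) ->
  let E j := step (fun=> fun k1 k2 => elem_sym n (fun i => c i k1 k2)) N j in
  forall h, m (fun j => sqmod (E j - cexp (- (h%:R * (n%:R * theta))) * E (j + h)%N))
    <= @elem_sym_lip R s * (s%:R * kappa).
Proof.
move=> N0 c1 hc E h; set L := @elem_sym_lip R s.
have L0 : 0 <= L := elem_sym_lip_ge0.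
pose M : R := #|{set 'I_s}|%:R ^+ 2; have M0 : 0 <= M by rewrite exprn_ge0.
apply/ler_addgt0Pl => d6 d60; pose d := d6 / (1 + 4 * M).
have M1 : 0 < 1 + 4 * M by lra.
have d0 : 0 < d by rewrite divr_gt0.
have [Q [bad [p [t [Q0 hbad hdyn]]]]] := dyn h N0 d0.
have NQ0 : (0 < N * Q)%N by rewrite muln_gt0 N0.
pose u := cexp (- (h%:R * theta)).
pose B j : R := step (fun=> fun k1 k2 => (bad k1 k2)%:R) (N * Q) j.
have bB : bdd B by exact: (@bdd_step (fun _ k1 k2 => (bad k1 k2)%:R) _ NQ0).
have mB : m B <= d by exact: mean_bad NQ0 hbad.
have B0 j : 0 <= B j by rewrite /B /step.
pose G i k1 k2 : R := if bad k1 k2 then 0 else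
  sqmod (c i (k1 %/ Q)%N (k2 %/ Q)%N - u * c (p k1 k2 i) (t k1 k2).1 (t k1 k2).2).
have G0 i k1 k2 : 0 <= G i k1 k2 by rewrite /G; case: ifP => // _; exact: sqmod_ge0.
have uc1 i k1 k2 : sqmod (u * c i k1 k2) <= 1 by rewrite sqmodM sqmod_cexp mul1r.
have mG : m (step G (N * Q)) <= kappa.
  apply: le_trans (hc h); apply: (mean_le mm) => [||j]; first exact: bdd_step.
    by apply: (@bdd_sqmodB R _ _ 1 1) => j; [exact: c1|exact: uc1].
  rewrite {1}/step /G; have := hdyn j; rewrite /= -/(y1 j) -/(y2 j).
  case: (bad _ _) => [_|/(_ isT)[e1 e2 e3]]; first exact: sqmod_ge0.
  by rewrite /step -!cell_refine// e1 e2 e3.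
have EM j : sqmod (E j) <= M by rewrite /E /step sqmod_elem_sym_le.
have uE j : sqmod (cexp (- (h%:R * (n%:R * theta))) * E j) <= M by rewrite sqmodM sqmod_cexp mul1r.
have := mean_sum_sheets G NQ0; set S := step _ _ => mS.
have bS : bdd S by exact: bdd_step.
apply: (@le_trans _ _ (m (fun j => L * S j + 4 * M * B j))); last first.
  rewrite (meanD mm); [|bd|bd]; rewrite !(meanZ mm)// mS.
  have h1 : L * (s%:R * m (step G (N * Q))) <= L * (s%:R * kappa).
    by rewrite ler_wpM2l// ler_wpM2l.
  have h2 : 4 * M * m B <= 4 * M * d by rewrite ler_wpM2l//; lra.
  have h3 : (1 + 4 * M) * d = d6 by rewrite mulrC divfK// gt_eqF.
  by move: h1 h2 h3 d0; lra.
apply: (mean_le mm) => [||j]; [exact: bdd_sqmodB EM (fun j => uE (j + h)%N)|bd|].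
have S0 : 0 <= S j by rewrite /S /step sumr_ge0.
have := hdyn j; rewrite /S /B /step /= -/(y1 j) -/(y2 j) /G.
case: (bad _ _) => [_|/(_ isT)[e1 e2 e3]].
  rewrite big1// mulr0 add0r mulr1.
  by apply: le_trans (sqmodB_le _ _) _; have := EM j; have := uE (j + h)%N; lra.
rewrite mulr0 addr0 /E /step e2 e3.
set k1 := cell (N * Q) _; set k2 := cell (N * Q) _.
have -> : cexp (- (h%:R * (n%:R * theta))) = u ^+ n.
  by rewrite /u -cexp_nat; congr cexp; ring.
rewrite -(elem_sym_perm n (fun i => c i (t k1 k2).1 (t k1 k2).2) (p k1 k2)) -elem_symZ.
rewrite (cell_refine N Q0 (y1_ge0 j)) (cell_refine N Q0 (y2_ge0 j)) -/k1 -/k2.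
apply: sqmod_elem_symB_le => i; [exact: c1|exact: uc1].
Qed.

Hypothesis nonresonant : forall (n : nat) (r1 r2 k : int), (0 < n)%N ->
  r1%:~R * v1 + r2%:~R * v2 - n%:R * theta <> k%:~R.

(** Weighted inequality that bounds a mean by the mean of [n]-th powers. *)
Lemma pow_trunc (x k : R) (n : nat) : 0 < k -> 0 <= x -> (0 < n)%N ->
  x <= k + k ^- n.-1 * x ^+ n.
Proof.
move=> k0 x0 n0; have [xk|kx] := leP x k.
  by rewrite (le_trans xk)// lerDl mulr_ge0 ?exprn_ge0// invr_ge0 exprn_ge0// ltW.
apply: (@le_trans _ _ (k ^- n.-1 * x ^+ n)); last by rewrite lerDr ltW.
rewrite ler_pdivlMl ?exprn_gt0// -[X in x ^+ X](prednK n0) exprSr ler_wpM2r//.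
by rewrite lerXn2r ?nnegrE ?(ltW k0) ?(ltW kx).
Qed.

(** The elementary symmetric functions of a near-minimizer, of positive degree,
    nearly satisfy an eigenvalue equation on the torus at a frequency which is not
    available there; so they are small, and the near-minimizer with them. *)
Lemma near_minimizer_small (eta kappa : R) : 0 < kappa ->
  (forall c' N', (0 < N')%N -> unit_step c' -> eta <= dist c' N') ->
  (forall eps, 0 < eps -> exists c N, [/\ (0 < N)%N, unit_step c & dist c N <= eta + eps]) ->
  exists c N, [/\ (0 < N)%N, unit_step c, dist c N <= eta + kappa &
    m (fun j => sqmod (step c N j)) <= kappa].
Proof.
move=> kap0 etamin etainf; set L := @elem_sym_lip R s.
have L0 : 0 <= L := elem_sym_lip_ge0.
pose k := kappa / 2; have k0 : 0 < k by rewrite divr_gt0.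
(* The product of the losses in the bounds below: [4] in the eigenvalue equation
   of the sheets, [s * L] on passing to symmetric functions, [2] on the torus,
   [s * s] on passing back to the sheets, and the power of [k] from [pow_trunc]. *)
pose C : R := k ^- s.-1 * (s%:R * (s%:R * (2 * (L * (s%:R * 4))))).
have C0 : 0 <= C.
  by rewrite mulr_ge0 ?invr_ge0 ?exprn_ge0 ?(ltW k0)// !mulr_ge0.
have C1 : 0 < 1 + C by lra.
pose eps := k / (1 + C); have eps0 : 0 < eps by rewrite divr_gt0.
have epsE : (1 + C) * eps = k by rewrite mulrC divfK// gt_eqF.
have Ce : C * eps <= k by lra.
have epsk : eps <= k by have := mulr_ge0 C0 (ltW eps0); lra.
have [c [N [N0 c1 cD]]] := etainf _ eps0.
exists c, N; split => //; first by rewrite /k in epsk; lra.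
have heig := near_minimizer_eigen N0 c1 etamin cD.
pose E n j : R[i] := step (fun=> fun k1 k2 => elem_sym n.+1 (fun i => c i k1 k2)) N j.
pose M : R := #|{set 'I_s}|%:R ^+ 2.
have EM n j : sqmod (E n j) <= M by rewrite /E /step sqmod_elem_sym_le.
have mE n : m (fun j => sqmod (E n j)) <= 2 * (L * (s%:R * (4 * eps))).
  apply: (torus_nonresonant_small (beta := n.+1%:R * theta)
    (F := fun k1 k2 => elem_sym n.+1 (fun i => c i k1 k2)) N0 (M := M)).
  - by move=> k1 k2; exact: sqmod_elem_sym_le.
  - by move=> r1 r2 k'; exact: nonresonant.
  - exact: (@elem_sym_eigen (4 * eps) c N n.+1 N0 c1 heig).
have bE n : bdd (fun j => sqmod (E n j)) by exact: bdd_sqmod (EM n).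
pose V j := \sum_(n < s) sqmod (E n j).
have bV : bdd V by apply: bdd_sum => n; exact: bE.
have mV : m V <= s%:R * (2 * (L * (s%:R * (4 * eps)))).
  rewrite (mean_sum mm)//.
  apply: (@le_trans _ _ (\sum_(n < s) (2 * (L * (s%:R * (4 * eps)))))).
    by apply: ler_sum => n _; exact: mE.
  by rewrite sumr_const card_ord -[_ *+ s]mulr_natl.
have step1 j : sqmod (step c N j) <= 1 by exact: c1.
apply: (@le_trans _ _ (m (fun j => k + (k ^- s.-1 * s%:R) * V j))).
  apply: (mean_le mm) => [||j]; [exact: bdd_sqmod step1|bd|].
  apply: le_trans (pow_trunc k0 (sqmod_ge0 _) s0) _.
  rewrite lerD2l -mulrA ler_wpM2l ?invr_ge0 ?exprn_ge0 ?(ltW k0)//.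
  exact: (sqmod_le_elem_sym (z := fun i => c i (cell N (y1 j)) (cell N (y2 j))) (sheet j)).
rewrite (meanD mm); [|bd|bd]; rewrite (mean_cst mm) (meanZ mm _ bV).
have : k ^- s.-1 * s%:R * m V <= C * eps.
  apply: (@le_trans _ _ (k ^- s.-1 * s%:R * (s%:R * (2 * (L * (s%:R * (4 * eps))))))).
    by rewrite ler_wpM2l// mulr_ge0// invr_ge0 exprn_ge0// ltW.
  by rewrite le_eqVlt /C; apply/orP; left; apply/eqP; ring.
by rewrite /k in Ce *; lra.
Qed.

(** By [near_minimizer_small] the infimum of the distances is nearly attained by a
    step function that is nearly 0 in mean square, and 0 is at distance 1. *)
Lemma dist_ge1 c N : (0 < N)%N -> unit_step c -> 1 <= dist c N.
Proof.
move=> N0 c1.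
pose S : set R := [set x | exists c' N', [/\ (0 < N')%N, unit_step c' & x = dist c' N']]%classic.
have Slb : lbound S 0 by move=> _ [c' [N' [N'0 c'1 ->]]]; exact: dist_ge0.
have hS : has_inf S by split; [exists (dist c N), c, N|exists 0].
have etamin c' N' : (0 < N')%N -> unit_step c' -> inf S <= dist c' N'.
  by move=> N'0 c'1; apply: ge_inf; [exists 0|exists c', N'].
apply: le_trans (etamin c N N0 c1); apply/ler_addgt0Pl => d d0.
have etainf eps : 0 < eps -> exists c' N', [/\ (0 < N')%N, unit_step c' & dist c' N' <= inf S + eps].
  move=> eps0; have [_ [c' [N' [N'0 c'1 ->]]] lt] := inf_adherent eps0 hS.
  by exists c', N'; split => //; exact: ltW.
pose t := Num.min 1 (d / 3).
have t0 : 0 < t by rewrite lt_min ltr01 divr_gt0.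
have t1 : t <= 1 by rewrite ge_min lexx.
have td : t <= d / 3 by rewrite ge_min lexx orbT.
have t20 : 0 < t ^+ 2 by rewrite exprn_gt0.
have [c' [N' [N'0 c'1 hD hs]]] := near_minimizer_small t20 etamin etainf.
have n1 j : sqmod (step c' N' j) <= 1 by exact: c'1.
have bn : bdd (fun j => sqmod (step c' N' j)) by exact: bdd_sqmod n1.
have : 1 - t - t^-1 * t ^+ 2 <= dist c' N'.
  apply: (@le_trans _ _ (m (fun j => (1 - t) + (- t^-1) * sqmod (step c' N' j)))).
    rewrite (meanD mm); [|bd|bd]; rewrite (mean_cst mm) (meanZ mm _ bn).
    by rewrite mulNr lerD2l lerN2 ler_wpM2l// invr_ge0 ltW.
  apply: (mean_le mm) => [||j]; [bd|exact: bdd_sqmodB ne n1|].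
  have := sqmod_ge0 (t%:C%C * e j - step c' N' j); have : sqmod (e j) = 1 by exact: sqmod_cexp.
  case: (e j) => p q; case: (step c' N' j) => x y; rewrite /sqmod /= => hpq hsq.
  rewrite -(ler_pM2l t0) mulrDr mulrA mulrN divff ?gt_eqF// mulN1r.
  have -> : t * ((p - x) ^+ 2 + (q - y) ^+ 2) =
     t * (p ^+ 2 + q ^+ 2) + t * (x ^+ 2 + y ^+ 2) - 2 * t * (p * x + q * y) by ring.
  have : 0 <= t ^+ 2 * (p ^+ 2 + q ^+ 2) - 2 * t * (p * x + q * y) + (x ^+ 2 + y ^+ 2).
    by apply: le_trans hsq _; rewrite le_eqVlt; apply/orP; left; apply/eqP; ring.
  rewrite hpq; have : 0 <= t * (x ^+ 2 + y ^+ 2) by rewrite mulr_ge0 ?(ltW t0)// addr_ge0 ?sqr_ge0.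
  lra.
rewrite expr2 mulrA mulVf ?gt_eqF// mul1r.
have : t ^+ 2 <= t by rewrite expr2 ler_piMr// ltW.
by lra.
Qed.

(** If the correlation were positive, a small multiple of the conjugate of the
    step function would come closer to [e] than 0 does. *)
Lemma mean_Re_step_le0 c N : (0 < N)%N -> unit_step c ->
  m (fun j => Re (step c N j * e j)) <= 0.
Proof.
move=> N0 c1; apply/ler_addgt0Pl => d d0; rewrite addr0.
pose t := Num.min 1 d.
have t0 : 0 < t by rewrite lt_min ltr01.
have t1 : t <= 1 by rewrite ge_min lexx.
have td : t <= d by rewrite ge_min lexx orbT.
pose c' i k1 k2 : R[i] := t%:C%C * ((c i k1 k2)^*)%C.
have sqmodc (z : R[i]) : sqmod (z^*)%C = sqmod z by case: z => x y; rewrite /sqmod /= sqrrN.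
have tt : t ^+ 2 <= 1 by rewrite exprn_ile1// ltW.
have c'1 : unit_step c'.
  move=> i k1 k2; rewrite sqmodM sqmod_real sqmodc.
  by rewrite mulr_ile1 ?sqr_ge0 ?sqmod_ge0.
have := dist_ge1 N0 c'1.
have s1 j : sqmod (step c N j) <= 1 by exact: c1.
have se1 j : sqmod (step c N j * e j) <= 1 by rewrite sqmodM sqmod_cexp mulr1.
have bs : bdd (fun j => sqmod (step c N j)) by exact: bdd_sqmod s1.
have bR : bdd (fun j => Re (step c N j * e j)) by exact: bdd_Re se1.
have -> : dist c' N = 1 + ((- (2 * t)) * m (fun j => Re (step c N j * e j))
                       + t ^+ 2 * m (fun j => sqmod (step c N j))).
  rewrite -(meanZ mm _ bs) -(meanZ mm _ bR) -(meanD mm); [|bd|bd].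
  rewrite -[X in _ = X + _](mean_cst mm) -(meanD mm); [|bd|bd].
  congr m; apply/funext => j; rewrite {1}/step /c' -/(step c N j).
  have : sqmod (e j) = 1 by exact: sqmod_cexp.
  case: (step c N j) => x y; case: (e j) => p q; rewrite /sqmod /= => pq. lra.
have : t ^+ 2 * m (fun j => sqmod (step c N j)) <= t ^+ 2 * 1.
  by rewrite ler_wpM2l ?sqr_ge0//; exact: (mean_le_cst mm).
set A := m (fun j => Re _); set B := t ^+ 2 * _ => h1 h2.
have h3 : t * (2 * A) <= t * t by rewrite -expr2; lra.
by rewrite ler_pM2l// in h3; lra.
Qed.

Lemma mean_Re_step0 c N : (0 < N)%N -> unit_step c ->
  m (fun j => Re (step c N j * e j)) = 0.
Proof.
move=> N0 c1; apply/eqP; rewrite eq_le mean_Re_step_le0//=.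
have se1 j : sqmod (step c N j * e j) <= 1 by rewrite sqmodM sqmod_cexp mulr1; exact: c1.
have c1' : unit_step (fun i k1 k2 => - c i k1 k2) by move=> i k1 k2; rewrite sqmodN.
have := mean_Re_step_le0 N0 c1'.
rewrite (_ : (fun j => _) = fun j => - Re (step c N j * e j)).
  by rewrite (meanN mm) ?oppr_le0//; exact: bdd_Re se1.
by apply/funext => j; rewrite /step mulNr; case: (_ * _).
Qed.

(** Dividing by [1 + sqmod c] puts [c] times the indicator into the unit ball. *)
Lemma cell_indicator_orthogonal (N : nat) (i : 'I_s) (k1 k2 : nat) (c : R[i]) : (0 < N)%N ->
  m (fun j => step (fun i' k1' k2' => [&& i' == i, k1' == k1 & k2' == k2]%:R) N j
              * Re (c * cexp (j%:R * theta))) = 0.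
Proof.
move=> N0; pose r : R := 1 + sqmod c; have r1 : 1 <= r by rewrite lerDl sqmod_ge0.
pose w i' k1' k2' : R[i] := if [&& i' == i, k1' == k1 & k2' == k2] then (r^-1)%:C%C * c else 0.
have w1 : unit_step w.
  move=> i' k1' k2'; rewrite /w; case: ifP => _; last by rewrite sqmod0.
  rewrite sqmodM sqmod_real exprVn ler_pdivrMl ?mulr1 ?exprn_gt0 ?(lt_le_trans ltr01)//.
  apply: (@le_trans _ _ r); first by rewrite /r lerDr.
  by rewrite expr2 ler_peMr// (le_trans ler01).
have := mean_Re_step0 N0 w1; have r0 : r != 0 by rewrite gt_eqF// (lt_le_trans ltr01).
have se1 j : sqmod (step w N j * e j) <= 1 by rewrite sqmodM sqmod_cexp mulr1; exact: w1.
move=> /(congr1 (fun x => r * x)); rewrite mulr0 -(meanZ mm); last exact: bdd_Re se1.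
move=> <-; congr m; apply/funext => j; rewrite /step /w.
case: ifP => _; last by rewrite !mul0r mulr0.
by rewrite mul1r -mulrA ReM_real mulrA divff// mul1r.
Qed.

End Eigenvalue.

End SkewProduct.

(** * Nearby stretches of a geodesic *)

Section Propagation.
Context {R : realType}.

(** Connectedness of the interval: consider the supremum of the times up to which
    [A] keeps its initial value. *)
Lemma local_propagation (A : R -> Prop) (T : R) : 0 <= T ->
  (forall t, 0 <= t <= T -> exists2 d, 0 < d &
     forall t', 0 <= t' <= T -> `|t' - t| < d -> (A t' <-> A t)) ->
  A 0 <-> A T.
Proof.
move=> T0 loc.
pose S : set R := [set t | 0 <= t <= T /\ forall r, 0 <= r <= t -> (A r <-> A 0)]%classic.
have S0 : S 0.
  split; first by rewrite lexx.
  by move=> r r0; have -> : r = 0 by apply/eqP; rewrite eq_le andbC.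
have hS : has_sup S by split; [exists 0|exists T => t [/andP[]]].
pose c := sup S; have c0 : 0 <= c by apply: ub_le_sup => //; exact: hS.2.
have cT : c <= T by apply: ge_sup => [|t [/andP[]]//]; exact: hS.1.
have [d d0 hd] := loc c ltac:(by rewrite c0 cT).
have [a Sa ca] := sup_adherent d0 hS.
have ac : a <= c by apply: ub_le_sup => //; exact: hS.2.
have [/andP[a0 aT] ha] := Sa; rewrite -/c in ca.
have Aa : A a <-> A 0 by apply: ha; rewrite a0 lexx.
have Ac : A a <-> A c.
  by apply: hd; [rewrite a0|rewrite ler0_norm ?subr_le0//; lra].
have loc_c t' : 0 <= t' <= T -> `|t' - c| < d -> (A t' <-> A 0).
  by move=> h1 h2; rewrite (hd t' h1 h2) -Ac.
have S' : S (Num.min T (c + d / 2)).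
  have m0 : 0 <= Num.min T (c + d / 2) by rewrite le_min T0 /= addr_ge0// divr_ge0// ltW.
  split; first by rewrite m0 ge_min lexx.
  move=> r /andP[r0]; rewrite le_min => /andP[rT rc].
  have [ra|ar] := leP r a; first by apply: ha; rewrite r0.
  apply: loc_c; first by rewrite r0.
  by rewrite ltr_norml; apply/andP; split; lra.
have := ub_le_sup hS.2 S'; rewrite -/c ge_min => /orP[Tc|]; last by lra.
have -> : T = c by apply/eqP; rewrite eq_le Tc.
by rewrite -Ac Aa.
Qed.

End Propagation.

Section Geodesics.
Context {R : realType}.

Lemma halfinf_geodesicP (V : lmodType R) (X : Type) (reg : set X) (displ : X -> V -> X)
    (u : V) (L : R -> X) :
  halfinf_geodesic reg displ u L <-> (forall t, 0 <= t -> reg (L t) /\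
    exists2 d, 0 < d & forall t', 0 <= t' -> `|t' - t| < d -> L t' = displ (L t) ((t' - t) *: u)).
Proof.
split=> h t t0; have [h1 h2] := h t t0; split => //.
  have /nbhs_ballP[d d0 hd] := h2; exists d => // t' t'0 tt'.
  by apply: hd => //; rewrite -ball_normE /= distrC.
have [d d0 hd] := h2; apply/nbhs_ballP; exists d => // t'.
by rewrite -ball_normE /= => tt' t'0; apply: hd => //; rewrite distrC.
Qed.

Lemma geodesic_rescale (V : lmodType R) (X : Type) (reg : set X) (displ : X -> V -> X)
    (u : V) (L : R -> X) (a : R) : 0 < a ->
  halfinf_geodesic reg displ u L ->
  halfinf_geodesic reg displ (a *: u) (fun t => L (a * t)).
Proof.
move=> a0 /halfinf_geodesicP h; apply/halfinf_geodesicP => t t0.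
have [h1 [d d0 hd]] := h (a * t) (mulr_ge0 (ltW a0) t0); split => //.
exists (d / a); first by rewrite divr_gt0.
move=> t' t'0 tt'; rewrite hd ?mulr_ge0 ?(ltW a0)//.
  by rewrite -mulrBr scalerA [a * (t' - t)]mulrC.
by rewrite -mulrBr normrM gtr0_norm// mulrC -ltr_pdivlMr.
Qed.

(** Reparametrization by [t = j] at the [j]-th point of the sequence. *)
Lemma kronecker_motion (V : lmodType R) (X : Type) (reg : set X) (displ : X -> V -> X)
    (v : V) (g : R) (x : nat -> X) : 0 < g ->
  (exists L : R -> X, halfinf_geodesic reg displ (g^-1 *: v) L /\ forall j : nat, x j = L (j%:R * g))
  <-> (exists L : R -> X, halfinf_geodesic reg displ v L /\ forall j : nat, x j = L j%:R).
Proof.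
move=> g0; split => -[L [hL hx]].
  exists (fun t => L (g * t)); split; last by move=> j; rewrite hx mulrC.
  by have := geodesic_rescale g0 hL; rewrite scalerA divff ?gt_eqF// scale1r.
exists (fun t => L (g^-1 * t)); split.
  by apply: geodesic_rescale => //; rewrite invr_gt0.
by move=> j; rewrite hx mulrC mulfK// gt_eqF.
Qed.

End Geodesics.

Section Displacement.
Context {R : realType} {s : nat} (P : polysquare s).

Lemma perm_zpowD (p : {perm 'I_s}) (m n : int) :
  perm_zpow p (m + n) = (perm_zpow p m * perm_zpow p n)%g.
Proof.
have S1 k : perm_zpow p (k + 1) = (perm_zpow p k * p)%g.
  case: k => k; first by rewrite /= addn1 expgSr.
  case: k => [|k]; first by rewrite /= expg1 mulVg.
  have -> : Negz k.+1 + 1 = Negz k by rewrite !NegzE; lia.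
  by rewrite /= [in RHS]expgS invMg -mulgA mulVg mulg1.
have B1 k : perm_zpow p (k - 1) = (perm_zpow p k * p^-1)%g.
  by rewrite -{2}(subrK 1 k) S1 -mulgA mulgV mulg1.
elim: n => [|n IH|n IH]; first by rewrite addr0 mulg1.
  by rewrite -addn1 PoszD addrA !S1 IH mulgA.
by rewrite -addn1 PoszD opprD addrA !B1 IH mulgA.
Qed.

Lemma floorD_frac (x e : R) : Num.floor (x + e) = Num.floor x + Num.floor (fracpart x + e).
Proof.
have h := fracpartE x; have hf := floor_itv (fracpart x + e); apply: floor_def.
by move: hf; rewrite -addrA !intrD => /andP[h1 h2]; apply/andP; split; lra.
Qed.

Lemma floor_eq0 (x : R) : 0 <= x < 1 -> Num.floor x = 0.
Proof. by move=> x01; apply: floor_def; rewrite add0r. Qed.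

(** Two moves compose as a translation when the vertical coordinate stays in the
    open unit interval: only powers of one of the two permutations are involved. *)
Lemma displaceD_h (p : surface_point R s) (d e : R * R) :
  0 <= p.2.2 + d.2 < 1 -> 0 <= p.2.2 + d.2 + e.2 < 1 ->
  displace P (displace P p d) e = displace P p (d + e).
Proof.
case: p d e => [i [a b]] [d1 d2] [e1 e2] /= h1 h2.
rewrite /displace /chart /= (fracpart_id h1) (floor_eq0 h1) (floor_eq0 h2).
rewrite !addrA (floor_eq0 h2) /= !perm1 fracpartDl; congr ((_, _)).
by rewrite (floorD_frac (a + d1)) perm_zpowD permM.
Qed.

Lemma displaceD_v (p : surface_point R s) (d e : R * R) :
  0 <= p.2.1 + d.1 < 1 -> 0 <= p.2.1 + d.1 + e.1 < 1 ->
  displace P (displace P p d) e = displace P p (d + e).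
Proof.
case: p d e => [i [a b]] [d1 d2] [e1 e2] /= h1 h2.
rewrite /displace /chart /= (fracpart_id h1) (floor_eq0 h1) (floor_eq0 h2).
rewrite !addrA (floor_eq0 h2) /= !perm1 fracpartDl; congr ((_, _)).
by rewrite (floorD_frac (b + d2)) perm_zpowD permM.
Qed.

Lemma displace_inj (p q : surface_point R s) (e : R * R) : p.2 = q.2 ->
  displace P p e = displace P q e -> p = q.
Proof.
case: p q => [i y] [j z] /= <-; rewrite /displace /chart /= => -[].
by move=> /perm_inj /perm_inj ->.
Qed.

(** The commutator of small displacements is trivial away from the vertices. *)
Lemma displaceC (p : surface_point R s) (d e : R * R) (r : R) :
  `|d.1| < r -> `|d.2| < r -> `|e.1| < r -> `|e.2| < r ->
  2 * r < p.2.1 < 1 - 2 * r \/ 2 * r < p.2.2 < 1 - 2 * r ->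
  displace P (displace P p d) e = displace P (displace P p e) d.
Proof.
move=> /ltr_normlP[? ?] /ltr_normlP[? ?] /ltr_normlP[? ?] /ltr_normlP[? ?] [] /andP[? ?].
  by rewrite !displaceD_v; [by congr displace; rewrite addrC|..]; apply/andP; split; lra.
by rewrite !displaceD_h; [by congr displace; rewrite addrC|..]; apply/andP; split; lra.
Qed.

Variables (v1 v2 : R) (L : R -> surface_point R s).
Hypothesis hL : halfinf_geodesic (regular_points P) (displace P) (v1, v2) L.

Lemma motion_local t : 0 <= t -> exists2 d, 0 < d &
  forall t', 0 <= t' -> `|t' - t| < d -> L t' = displace P (L t) ((t' - t) *: (v1, v2)).
Proof. by move=> t0; have /halfinf_geodesicP/(_ t t0)[] := hL. Qed.

Lemma motion_itv t : 0 <= t -> 0 <= (L t).2.1 < 1 /\ 0 <= (L t).2.2 < 1.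
Proof.
move=> t0; have [[h _] _] := hL t0; move: h => /= [].
by rewrite !in_itv /=.
Qed.

Lemma frac_propagation (f : R -> R) (v : R) :
  (forall t, 0 <= t -> 0 <= f t < 1) ->
  (forall t, 0 <= t -> exists2 d, 0 < d &
    forall t', 0 <= t' -> `|t' - t| < d -> f t' = fracpart (f t + (t' - t) * v)) ->
  forall t, 0 <= t -> f t = fracpart (f 0 + t * v).
Proof.
move=> f01 loc T T0.
pose A t := f t = fracpart (f 0 + t * v).
have A0 : A 0 by rewrite /A mul0r addr0 fracpart_id// f01.
rewrite -/(A T) -(@local_propagation _ A T)// => t /andP[t0 tT].
have [d d0 hd] := loc t t0; exists d => // t' /andP[t'0 t'T] tt'.
rewrite /A (hd t' t'0 tt'); split => [e|->].
  have [n hn] := fracpart_eq e.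
  rewrite -[LHS](fracpart_id (f01 t t0)) -(fracpartDz (f 0 + t * v) n); congr fracpart.
  by move: hn; lra.
by rewrite fracpartDl; congr fracpart; ring.
Qed.

Lemma motion_coord t : 0 <= t ->
  (L t).2.1 = fracpart ((L 0).2.1 + t * v1) /\ (L t).2.2 = fracpart ((L 0).2.2 + t * v2).
Proof.
move=> t0; split.
  apply: (frac_propagation (f := fun t => (L t).2.1)) => // r r0.
    by have [] := motion_itv r0.
  have [d d0 hd] := motion_local r0; exists d => // t' t'0 h.
  by rewrite (hd t' t'0 h).
apply: (frac_propagation (f := fun t => (L t).2.2)) => // r r0.
  by have [] := motion_itv r0.
have [d d0 hd] := motion_local r0; exists d => // t' t'0 h.
by rewrite (hd t' t'0 h).
Qed.

(** Whether the second stretch is the first one displaced by [d] does not change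
    with time while the first keeps away from the vertices, because there small
    displacements commute; at both ends it amounts to a comparison of squares. *)
Lemma parallel_stretches (r T j j' : R) (d : R * R) :
  0 <= T -> 0 <= j -> 0 <= j' -> `|d.1| < r -> `|d.2| < r ->
  (L j').2 = (L j).2 + d ->
  (forall t, 0 <= t <= T -> 2 * r < (L (j + t)).2.1 < 1 - 2 * r
                         \/ 2 * r < (L (j + t)).2.2 < 1 - 2 * r) ->
  0 <= (L (j + T)).2.1 + d.1 < 1 -> 0 <= (L (j + T)).2.2 + d.2 < 1 ->
  (L j').1 = (L j).1 <-> (L (j' + T)).1 = (L (j + T)).1.
Proof.
move=> T0 j0 j'0 d1r d2r hd far end1 end2.
have r0 : 0 < r by exact: le_lt_trans (normr_ge0 _) d1r.
pose A t := L (j' + t) = displace P (L (j + t)) d.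
have coord t : 0 <= t -> (L (j' + t)).2 = (displace P (L (j + t)) d).2.
  move=> t0; have [c1 c2] := motion_coord (addr_ge0 j'0 t0).
  have [c3 c4] := motion_coord (addr_ge0 j0 t0).
  have [c5 c6] := motion_coord j0; have [c7 c8] := motion_coord j'0.
  have [e1 e2] : (L j').2.1 = (L j).2.1 + d.1 /\ (L j').2.2 = (L j).2.2 + d.2 by rewrite hd.
  have E (a b x y z : R) : fracpart (a + x * z) = fracpart (a + y * z) + b ->
      fracpart (a + (x + t) * z) = fracpart (fracpart (a + (y + t) * z) + b).
    move=> e; rewrite fracpartDl.
    transitivity (fracpart (fracpart (a + x * z) + t * z)).
      by rewrite fracpartDl; congr fracpart; ring.
    by rewrite e -addrA fracpartDl; congr fracpart; ring.
  rewrite [LHS]surjective_pairing /displace /chart /= c1 c2 c3 c4.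
  by congr (_, _); apply: E; rewrite -?c5 -?c6 -?c7 -?c8.
have chart_small t : 0 <= t -> 0 <= (L (j + t)).2.1 + d.1 < 1 ->
    0 <= (L (j + t)).2.2 + d.2 < 1 -> (A t <-> (L (j' + t)).1 = (L (j + t)).1).
  move=> t0 h1 h2; have := coord t t0; rewrite /A /displace /chart.
  rewrite (floor_eq0 h1) (floor_eq0 h2) !perm1; case: (L (j' + t)) => i y /= ->.
  by split=> [[]|->].
have A0 : A 0 <-> (L j').1 = (L j).1.
  have := chart_small 0 (lexx _); rewrite !addr0; apply.
    by have [] := motion_itv j'0; rewrite hd.
  by have [] := motion_itv j'0; rewrite hd.
rewrite -A0 -(chart_small T T0 end1 end2).
apply: local_propagation => // t /andP[t0 tT].
have [da da0 hda] := motion_local (addr_ge0 j0 t0).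
have [db db0 hdb] := motion_local (addr_ge0 j'0 t0).
(* With times less than [r / V] apart, both coordinates move by less than [r]. *)
pose V := 1 + `|v1| + `|v2|.
have V0 : 0 < V by rewrite /V -addrA ltr_pwDl// addr_ge0.
exists (Num.min (r / V) (Num.min da db)).
  by rewrite !lt_min da0 db0 divr_gt0.
move=> t' /andP[t'0 t'T]; rewrite !lt_min => /and3P[tr ta tb].
have Ej : j + t' - (j + t) = t' - t by ring.
have Ej' : j' + t' - (j' + t) = t' - t by ring.
rewrite /A (hda (j + t')) ?addr_ge0 ?Ej//.
rewrite (hdb (j' + t')) ?addr_ge0 ?Ej'//.
have [v1V v2V] : `|v1| <= V /\ `|v2| <= V.
  rewrite /V; split; last by rewrite lerDr addr_ge0.
  by rewrite -addrA addrCA lerDl addr_ge0.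
rewrite ltr_pdivlMr// in tr.
have sm v : `|v| <= V -> `|(t' - t) * v| < r.
  by move=> vV; rewrite normrM (le_lt_trans _ tr)// ler_wpM2l.
rewrite -(displaceC (r := r) (d := d)) //=; [|exact: sm|exact: sm|by apply: far; rewrite t0].
by split=> [|->//]; apply: displace_inj; exact: coord.
Qed.

End Displacement.

(** * Cells of the torus whose future avoids the vertices *)

Section BadCells.
Context {R : realType}.
Variables (v1 v2 : R) (N h : nat).

(** The distances [2/N'] to the vertices and [1/N'] to the coarse grid leave room
    for any other point of the same cell, which is displaced by less than [1/N'] in
    each coordinate. *)
Definition near_vertex (N' : nat) (y1 y2 : R) : Prop :=
  exists t : R, [/\ 0 <= t <= h%:R,
    exists n : int, `|y1 + t * v1 - n%:~R| <= 2 / N'%:R &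
    exists n : int, `|y2 + t * v2 - n%:~R| <= 2 / N'%:R].

Definition near_grid (N' : nat) (v y : R) : Prop :=
  exists n : int, `|y + h%:R * v - n%:~R / N%:R| <= N'%:R^-1.

Definition bad_cell (N' k1 k2 : nat) : bool := `[< exists y1 y2 : R,
  [/\ k1%:R <= N'%:R * y1 < k1.+1%:R, k2%:R <= N'%:R * y2 < k2.+1%:R &
   [\/ near_vertex N' y1 y2, near_grid N' v1 y1 | near_grid N' v2 y2]] >].

(** The residues modulo [Q] of the integers at distance at most 5 from
    [- Num.floor x], as [o] ranges over the first 11 integers. *)
Definition shifted_residue (Q : nat) (x : R) (o : nat) : nat :=
  `|((o%:Z - 5 - Num.floor x) %% Q%:Z)%Z|%N.

Lemma shifted_residueP (Q k : nat) (x : R) (n : int) : (k < Q)%N ->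
  `|k%:R + x - n%:~R * Q%:R| <= 4 -> exists2 o, (o < 11)%N & k = shifted_residue Q x o.
Proof.
move=> kQ; rewrite ler_norml => /andP[h1 h2].
have /andP[f1 f2] := floor_itv x; rewrite intrD in f2.
set f := Num.floor x in f1 f2 *.
pose o := k%:Z + f - n * Q%:Z.
have oE : o%:~R = k%:R + f%:~R - n%:~R * Q%:R :> R.
  by rewrite /o intrD intrD rmorphN /= intrM.
have o1 : -5 <= o by rewrite -(ler_int R) oE; lra.
have o2 : o <= 5 by rewrite -(ler_int R) oE; lra.
exists `|(o + 5)%R|%N; first by lia.
rewrite /shifted_residue -/f.
have -> : `|(o + 5)%R|%N%:Z - 5 - f = k%:Z - n * Q%:Z by rewrite /o in o1 o2 *; lia.
by rewrite -mulNr addrC modzMDl modz_small ?ltz_nat.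
Qed.

(** With [N' = N * Q], the cells that approach a vertex lie near the curves traced
    backwards from it; sampling these at times [tau / (K * N')], less than a cell
    apart, shows that there are [O(h * K * N')] of them. Those that land near the
    coarse grid lie in [O(N)] strips of [O(N')] cells each. Both numbers are small
    compared to [N' ^ 2] for large [Q]. *)
Lemma count_bad_cells (d : R) : (0 < N)%N -> 0 < d -> exists2 Q, (0 < Q)%N &
  \sum_(k : 'I_(N * Q) * 'I_(N * Q)) (bad_cell (N * Q) k.1 k.2)%:R <= d * (N * Q)%:R ^+ 2.
Proof.
move=> N0 d0.
pose K := (Num.truncn (`|v1| + `|v2|)).+1.
have [K1 K2] : `|v1| <= K%:R /\ `|v2| <= K%:R.
  have := truncnS_gt (`|v1| + `|v2|); have := normr_ge0 v1; have := normr_ge0 v2.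
  by rewrite -/K; split; lra.
(* The factors 121 = 11 * 11 and 22 = 2 * 11 count the shifted residues. *)
pose C := (121 * (h * K + 1) + 22 * N)%N.
pose Q := (Num.truncn (C%:R / d)).+1; exists Q => //.
have NQ0 : (0 < N * Q)%N by rewrite muln_gt0 N0.
set N' := (N * Q)%N in NQ0 *.
have N'r : 0 < N'%:R :> R by rewrite ltr0n.
have Kr : 0 < K%:R :> R by rewrite ltr0n.
have Nr : 0 < N%:R :> R by rewrite ltr0n.
have N'E : N'%:R = N%:R * Q%:R :> R by rewrite natrM.
(* The list [l1] contains the cells near the backward curves of the vertices; [l2]
   and [l3] contain the two families of strips. *)
pose l1 := [seq (shifted_residue N' (p.1%:R * v1 / K%:R) p.2.1,
                 shifted_residue N' (p.1%:R * v2 / K%:R) p.2.2)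
  | p <- [seq (t, o) | t <- iota 0 (h * K * N' + 1),
          o <- [seq (o1, o2) | o1 <- iota 0 11, o2 <- iota 0 11]]].
pose grid v := [seq (Q * p.1 + shifted_residue Q (N'%:R * (h%:R * v)) p.2)%N
  | p <- [seq (g, o) | g <- iota 0 N, o <- iota 0 11]].
pose l2 := [seq (k1, k2) | k1 <- grid v1, k2 <- iota 0 N'].
pose l3 := [seq (k1, k2) | k1 <- iota 0 N', k2 <- grid v2].
have vertex_l1 (k1 k2 : nat) (y1 y2 : R) : (k1 < N')%N -> (k2 < N')%N ->
    k1%:R <= N'%:R * y1 < k1.+1%:R -> k2%:R <= N'%:R * y2 < k2.+1%:R ->
    near_vertex N' y1 y2 -> (k1, k2) \in l1.
  move=> k1N k2N /andP[a1 b1] /andP[a2 b2] [t [/andP[t0 th] [n1 hn1] [n2 hn2]]].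
  pose tau := Num.truncn (t * (K * N')%:R).
  have KN0 : 0 < (K * N')%:R :> R by rewrite natrM mulr_gt0.
  have /andP[tau1 tau2] : tau%:R <= t * (K * N')%:R < tau.+1%:R.
    by apply: truncn_itv; rewrite mulr_ge0// ltW.
  have E k y v n : k%:R <= N'%:R * y -> N'%:R * y < k.+1%:R -> `|v| <= K%:R ->
      `|y + t * v - n%:~R| <= 2 / N'%:R ->
      `|k%:R + tau%:R * v / K%:R - n%:~R * N'%:R| <= 4.
    move=> a b vK hn.
    have h1 : `|N'%:R * (y + t * v - n%:~R)| <= 2.
      by rewrite normrM gtr0_norm// mulrC -ler_pdivlMr.
    have h2 : `|(t * (K * N')%:R - tau%:R) * (v / K%:R)| <= 1.
      rewrite normrM mulr_ile1// ?ler_norml.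
        by rewrite -natr1 in tau2; clear -tau1 tau2 v1 v2 N h; apply/andP; split; lra.
      by rewrite -ler_norml normrM normfV [`|K%:R|]gtr0_norm// ler_pdivrMr// mul1r.
    have h3 : `|k%:R - N'%:R * y| <= 1.
      by rewrite -natr1 in b; clear -a b v1 v2 N h; rewrite ler_norml; apply/andP; split; lra.
    have -> : k%:R + tau%:R * v / K%:R - n%:~R * N'%:R =
       (N'%:R * (y + t * v - n%:~R)) + (k%:R - N'%:R * y)
       - (t * (K * N')%:R - tau%:R) * (v / K%:R).
      by rewrite natrM; field; rewrite gt_eqF.
    apply: le_trans (ler_normB _ _) _.
    have h4 := ler_normD (N'%:R * (y + t * v - n%:~R)) (k%:R - N'%:R * y).
    by clear -h1 h2 h3 h4 v1 v2 N h; lra.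
  have [p1 p1l e1] := shifted_residueP k1N (E _ _ _ _ a1 b1 K1 hn1).
  have [p2 p2l e2] := shifted_residueP k2N (E _ _ _ _ a2 b2 K2 hn2).
  apply/mapP; exists (tau, (p1, p2)); last by rewrite /= -e1 -e2.
  apply: (allpairs_f pair); last by apply: (allpairs_f pair); rewrite mem_iota.
  rewrite mem_iota add0n leq0n addn1 ltnS -(ler_nat R) (le_trans tau1)//.
  by rewrite -mulnA [X in _ <= X]natrM ler_wpM2r// ltW.
have grid_mem (k : nat) (v y : R) : (k < N')%N ->
    k%:R <= N'%:R * y < k.+1%:R -> near_grid N' v y -> k \in grid v.
  move=> kN /andP[a b] [n hn].
  have kQ : (k %% Q < Q)%N by rewrite ltn_mod.
  have kr : k%:R = (k %/ Q)%:R * Q%:R + (k %% Q)%:R :> R.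
    by rewrite -natrM -natrD -divn_eq.
  have h1 : `|N'%:R * (y + h%:R * v - n%:~R / N%:R)| <= 1.
    by rewrite normrM gtr0_norm// -ler_pdivlMl// mulr1.
  have h3 : `|k%:R - N'%:R * y| <= 1.
    by rewrite -natr1 in b; clear -a b v1 v2 N h; rewrite ler_norml; apply/andP; split; lra.
  have hk : `|(k %% Q)%:R + N'%:R * (h%:R * v) - (n - (k %/ Q)%:Z)%:~R * Q%:R| <= 4.
    have -> : (k %% Q)%:R + N'%:R * (h%:R * v) - (n - (k %/ Q)%:Z)%:~R * Q%:R =
       N'%:R * (y + h%:R * v - n%:~R / N%:R) + (k%:R - N'%:R * y).
      by rewrite intrD rmorphN /= kr N'E; field; rewrite gt_eqF.
    by apply: le_trans (ler_normD _ _) _; lra.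
  have [p p11 e] := shifted_residueP kQ hk.
  apply/mapP; exists ((k %/ Q)%N, p); last by rewrite /= -e mulnC -divn_eq.
  apply: (allpairs_f pair); rewrite mem_iota// add0n leq0n.
  by rewrite ltn_divLR// mulnC.
pose s1 := [seq (val k.1, val k.2) | k <- enum [pred k : 'I_N' * 'I_N' | bad_cell N' k.1 k.2]].
have us1 : uniq s1.
  rewrite map_inj_in_uniq ?enum_uniq// => -[a b] [a' b'] _ _ /= [] /val_inj -> /val_inj -> //.
have sub : {subset s1 <= l1 ++ l2 ++ l3}.
  move=> x /mapP[[k1 k2] kin ->]; rewrite mem_enum in kin.
  have /asboolP[y1 [y2 [c1 c2 hb]]] : bad_cell N' k1 k2 by exact: kin.
  rewrite !mem_cat; case: hb => hb; apply/orP.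
  - by left; exact: (vertex_l1 _ _ y1 y2 (ltn_ord k1) (ltn_ord k2) c1 c2 hb).
  - right; apply/orP; left; apply: (allpairs_f pair); last by rewrite mem_iota /=.
    exact: (grid_mem _ _ y1 (ltn_ord k1) c1 hb).
  - right; apply/orP; right; apply: (allpairs_f pair); first by rewrite mem_iota /=.
    exact: (grid_mem _ _ y2 (ltn_ord k2) c2 hb).
have := uniq_leq_size us1 sub.
rewrite !size_cat /l1 /l2 /l3 /grid !(size_map, size_allpairs, size_iota).
rewrite -cardE => hcard.
have -> : \sum_(k : 'I_N' * 'I_N') (bad_cell N' k.1 k.2)%:R =
    #|[pred k : 'I_N' * 'I_N' | bad_cell N' k.1 k.2]|%:R :> R.
  rewrite -sum1_card natr_sum big_mkcond [RHS]big_mkcond /=.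
  by apply: eq_bigr => k _; rewrite inE; case: (bad_cell _ _ _).
have hC : (#|[pred k : 'I_N' * 'I_N' | bad_cell N' k.1 k.2]| <= C * N')%N.
  by apply: (leq_trans hcard); rewrite /C; nia.
apply: (@le_trans _ _ (C * N')%:R); first by rewrite ler_nat.
rewrite natrM expr2 mulrA ler_wpM2r ?ler0n//.
have := truncnS_gt (C%:R / d); rewrite -/Q ltr_pdivrMr// => hQ.
apply: (le_trans (ltW hQ)).
rewrite N'E (_ : d * (N%:R * Q%:R) = N%:R * (Q%:R * d)); last by ring.
by rewrite ler_peMl ?ler1n// mulr_ge0// ltW.
Qed.

End BadCells.

Section Dynamics.
Context {R : realType} {s : nat} (P : polysquare s).
Variables (v1 v2 : R) (L : R -> surface_point R s).
Hypothesis hL : halfinf_geodesic (regular_points P) (displace P) (v1, v2) L.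

Let a1 := (L 0).2.1.
Let a2 := (L 0).2.2.
Let sheet (j : nat) := (L j%:R).1.
Local Notation y1 := (rotation_orbit a1 v1).
Local Notation y2 := (rotation_orbit a2 v2).

Let y1E j : (L j%:R).2.1 = y1 j.
Proof. by have [] := motion_coord hL (ler0n R j). Qed.
Let y2E j : (L j%:R).2.2 = y2 j.
Proof. by have [] := motion_coord hL (ler0n R j). Qed.

(** In a good cell the stretches of length [h] from two orbit points run parallel
    to each other, too close together for a vertex or the coarse grid to separate
    them. *)
Lemma same_cell_parallel (N Q h j j' : nat) : (0 < N)%N -> (0 < Q)%N ->
  cell (N * Q) (y1 j) = cell (N * Q) (y1 j') ->
  cell (N * Q) (y2 j) = cell (N * Q) (y2 j') ->
  ~~ bad_cell v1 v2 N h (N * Q) (cell (N * Q) (y1 j)) (cell (N * Q) (y2 j)) ->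
  [/\ sheet j' = sheet j <-> sheet (j' + h) = sheet (j + h),
      cell N (y1 (j' + h)) = cell N (y1 (j + h)) &
      cell N (y2 (j' + h)) = cell N (y2 (j + h))].
Proof.
move=> N0 Q0 c1 c2 good; set N' := (N * Q)%N in c1 c2 good.
have N'0 : 0 < N'%:R :> R by rewrite ltr0n muln_gt0 N0.
have Nr : 0 < N%:R :> R by rewrite ltr0n.
pose r : R := N'%:R^-1; have r0 : 0 < r by rewrite invr_gt0.
have f01 x : 0 <= fracpart (x : R) := proj1 (andP (fracpart_itv x)).
have cl (y : R) : 0 <= y -> (cell N' y)%:R <= N'%:R * y < (cell N' y).+1%:R.
  by move=> y0; rewrite -cellP.
have close (y y' : R) : 0 <= y -> 0 <= y' -> cell N' y = cell N' y' -> `|y' - y| < r.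
  move=> h0 h0' e; have := cl _ h0; have := cl _ h0'; rewrite e -natr1.
  move=> /andP[A1 B1] /andP[A2 B2].
  rewrite -(ltr_pM2l N'0) -[X in X * `|_|](gtr0_norm N'0) -normrM divff ?gt_eqF//.
  by rewrite mulrBr ltr_norml; apply/andP; split; lra.
pose d : R * R := (y1 j' - y1 j, y2 j' - y2 j).
have d1 : `|d.1| < r by exact: close (f01 _) (f01 _) c1.
have d2 : `|d.2| < r by exact: close (f01 _) (f01 _) c2.
have nb := elimN (asboolP _) good; rewrite -/N' in nb.
have nvert : ~ near_vertex v1 v2 h N' (y1 j) (y2 j).
  by move=> hv; apply: nb; exists (y1 j), (y2 j); split; [exact: cl (f01 _)|exact: cl (f01 _)|exact: Or31].
have ngr1 : ~ near_grid N h N' v1 (y1 j).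
  by move=> hv; apply: nb; exists (y1 j), (y2 j); split; [exact: cl (f01 _)|exact: cl (f01 _)|exact: Or32].
have ngr2 : ~ near_grid N h N' v2 (y2 j).
  by move=> hv; apply: nb; exists (y1 j), (y2 j); split; [exact: cl (f01 _)|exact: cl (f01 _)|exact: Or33].
have fracS (a v : R) (n : nat) t : fracpart (a + (n%:R + t) * v) = fracpart (fracpart (a + n%:R * v) + t * v).
  by rewrite fracpartDl; congr fracpart; ring.
(* A landing point that keeps [r] away from the coarse grid stays in its coarse
   cell after a displacement by less than [r]. *)
have landing (v a : R) : let y n := fracpart (a + n%:R * v) in
    ~ near_grid N h N' v (y j) -> `|y j' - y j| < r ->
    0 <= y (j + h)%N + (y j' - y j) < 1 /\ cell N (y (j' + h)%N) = cell N (y (j + h)%N).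
  move=> y ng dy; set e := y j' - y j in dy *.
  pose f := y (j + h)%N; have fE : f = fracpart (y j + h%:R * v) by rewrite /f /y natrD fracS.
  have far (n : int) : r < `|f - n%:~R / N%:R|.
    rewrite ltNge; apply/negP => hn; apply: ng.
    have := fracpartE (y j + h%:R * v); rewrite -fE; set F := Num.floor _ => yF.
    exists (n + F * N%:Z); rewrite yF; apply: le_trans hn.
    rewrite le_eqVlt; apply/orP; left; apply/eqP; congr `|_|.
    by rewrite intrD intrM; field; rewrite gt_eqF.
  have /andP[f0 f1] : 0 <= f < 1 by exact: fracpart_itv.
  have /ltr_normlP[e1 e2] := dy.
  pose k := cell N f; have /andP[kf fk] : k%:R <= N%:R * f < k.+1%:R.
    by rewrite -cellP.
  have kr1 : k%:R / N%:R + r < f.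
    have := far k%:Z; rewrite ger0_norm ?subr_ge0 ?ler_pdivrMr 1?mulrC//; lra.
  have kr2 : f < k.+1%:R / N%:R - r.
    have := far k.+1%:Z; rewrite ler0_norm ?subr_le0 ?ler_pdivlMr 1?mulrC ?ltW//; lra.
  have kN : (k < N)%N by apply: cell_lt => //; rewrite f0.
  have k0 : 0 <= k%:R / N%:R :> R by rewrite divr_ge0.
  have k1 : k.+1%:R / N%:R <= 1 :> R by rewrite ler_pdivrMr// mul1r ler_nat.
  have fe : 0 <= f + e < 1 by clear -kr1 kr2 e1 e2 k0 k1 hL y1E y2E; apply/andP; split; lra.
  split => //; rewrite -/f.
  have -> : y (j' + h)%N = f + e.
    have -> : y (j' + h)%N = fracpart (y j' + h%:R * v) by rewrite /y natrD fracS.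
    by rewrite -(fracpart_id fe) fE fracpartDl; congr fracpart; rewrite /e; ring.
  apply/eqP; rewrite cellP; last by case/andP: fe.
  rewrite -/k -[N%:R * _]mulrC -ler_pdivrMr// -ltr_pdivlMr//.
  by clear -kr1 kr2 e1 e2 hL y1E y2E; apply/andP; split; lra.
have [end1 cell1] := landing v1 a1 ngr1 d1.
have [end2 cell2] := landing v2 a2 ngr2 d2.
split; [|exact: cell1|exact: cell2].
rewrite /sheet !natrD; apply: (parallel_stretches hL (r := r) (d := d)) => //.
- by rewrite [LHS]surjective_pairing [(L j%:R).2]surjective_pairing !y1E !y2E /d; congr (_, _); rewrite /= addrC subrK.
- move=> t /andP[t0 th].
  have [-> ->] := motion_coord hL (addr_ge0 (ler0n R j) t0).
  rewrite -/a1 -/a2 !fracS -/(y1 j) -/(y2 j).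
  have dich (z : R) : 2 * r < fracpart z < 1 - 2 * r \/ exists n : int, `|z - n%:~R| <= 2 / N'%:R.
    have /andP[z0 z1] := fracpart_itv z; have zE := fracpartE z.
    have [h1|h1] := ltP (2 * r) (fracpart z); last first.
      right; exists (Num.floor z); rewrite ger0_norm; last by lra.
      by rewrite -/r; lra.
    have [h2|h2] := ltP (fracpart z) (1 - 2 * r); first by left; apply/andP; split.
    right; exists (Num.floor z + 1); rewrite intrD ler0_norm; last by lra.
    by rewrite -/r; lra.
  have [?|h1] := dich (y1 j + t * v1); first by left.
  have [?|h2] := dich (y2 j + t * v2); first by right.
  by exfalso; apply: nvert; exists t; rewrite t0 th; split.
- by rewrite -natrD y1E.
- by rewrite -natrD y2E.
Qed.

(** The dynamics above a good cell are read off from one orbit point in each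
    sheet. *)
Lemma motion_cellwise_dynamics (m : (nat -> R) -> R) :
  mean_functional m -> equidistributed_on_cells m sheet a1 a2 v1 v2 ->
  cellwise_dynamics sheet a1 a2 v1 v2.
Proof.
move=> mm ud N h d N0 d0.
have [Q Q0 hQ] := count_bad_cells v1 v2 h N0 d0.
pose N' := (N * Q)%N; have N'0 : (0 < N')%N by rewrite muln_gt0 N0.
(* every sheet above every cell is visited, having positive frequency *)
have visit i k1 k2 : (k1 < N')%N -> (k2 < N')%N ->
    exists j, [&& sheet j == i, cell N' (y1 j) == k1 & cell N' (y2 j) == k2].
  move=> k1N k2N; apply: contrapT => nov.
  have := ud N' i k1 k2 k1N k2N.
  rewrite (_ : step _ _ _ _ _ _ _ = fun=> 0).
    rewrite (mean_cst mm) => /esym/eqP; rewrite invr_eq0 mulf_eq0 expf_eq0 /= !pnatr_eq0.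
    rewrite !gtn_eqF//; exact: leq_ltn_trans (ltn_ord (sheet 0)).
  apply/funext => j; rewrite /step; case hv: [&& _, _ & _] => //.
  by exfalso; apply: nov; exists j.
pose pick i k1 k2 : nat := xget 0%N [set j | [&& sheet j == i, cell N' (y1 j) == k1 & cell N' (y2 j) == k2]]%classic.
have pickP i k1 k2 : (k1 < N')%N -> (k2 < N')%N ->
    [/\ sheet (pick i k1 k2) = i, cell N' (y1 (pick i k1 k2)) = k1 & cell N' (y2 (pick i k1 k2)) = k2].
  move=> k1N k2N; have [j hj] := visit i k1 k2 k1N k2N.
  have /= := xgetPex 0%N (ex_intro _ j hj : exists j, [set j | [&& sheet j == i, cell N' (y1 j) == k1 & cell N' (y2 j) == k2]]%classic j).
  by rewrite -/(pick i k1 k2) => /and3P[/eqP ? /eqP ? /eqP ?].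
pose bad k1 k2 := bad_cell v1 v2 N h N' k1 k2.
have c1N j : (cell N' (y1 j) < N')%N by rewrite cell_lt// fracpart_itv.
have c2N j : (cell N' (y2 j) < N')%N by rewrite cell_lt// fracpart_itv.
pose f k1 k2 i := sheet (pick i k1 k2 + h).
have fP j : let k1 := cell N' (y1 j) in let k2 := cell N' (y2 j) in ~~ bad k1 k2 ->
    injective (f k1 k2) /\ sheet (j + h) = f k1 k2 (sheet j).
  move=> k1 k2 good; have k1N := c1N j; have k2N := c2N j; split.
    move=> i i'; rewrite /f.
    have [e1 e2 e3] := pickP i k1 k2 k1N k2N; have [e1' e2' e3'] := pickP i' k1 k2 k1N k2N.
    have good' : ~~ bad_cell v1 v2 N h N' (cell N' (y1 (pick i k1 k2))) (cell N' (y2 (pick i k1 k2))).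
      by rewrite e2 e3.
    have [iff _ _] := same_cell_parallel N0 Q0 (etrans e2 (esym e2')) (etrans e3 (esym e3')) good'.
    by move=> e; rewrite -e1 -e1'; apply/esym/iff.
  have [e1 e2 e3] := pickP (sheet j) k1 k2 k1N k2N.
  have [iff _ _] := same_cell_parallel N0 Q0 (esym e2) (esym e3) good.
  by apply/esym/iff.
pose p k1 k2 : {perm 'I_s} := if pselect (injective (f k1 k2)) is left inj then perm inj else 1%g.
pose t k1 k2 := let j := pick (sheet 0) k1 k2 in (cell N (y1 (j + h)), cell N (y2 (j + h))).
exists Q, bad, p, t; split => // j k1 k2 good.
have [finj fE] := fP j good.
have [e1 e2 e3] := pickP (sheet 0) k1 k2 (c1N j) (c2N j).
have [_ t1 t2] := same_cell_parallel N0 Q0 (esym e2) (esym e3) good.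
split; [|exact: esym t1|exact: esym t2].
by rewrite /p; case: pselect => // inj; rewrite permE.
Qed.

End Dynamics.

(** * Convex sets and cubic cells *)

Section ConvexCells.
Context {R : realType}.

Definition in_cell (N k : nat) (x : R) : bool := k%:R <= N%:R * x < k.+1%:R.

Lemma convex_comb (V : lmodType R) (S : set V) (x y : V) (t : R) :
  convex_set S -> S x -> S y -> 0 <= t <= 1 -> S (t *: x + (1 - t) *: y).
Proof.
move=> cS Sx Sy t01; pose l : {i01 R} := Itv01 (proj1 (andP t01)) (proj2 (andP t01)).
by have := cS x y l; rewrite !inE => /(_ Sx Sy).
Qed.

(** The two sides of [p] on the line; a triple of booleans gives an orthant. *)
Definition beyond (e : bool) (p q : R) : bool := if e then p < q else q < p.

Lemma beyond_conv e p x y t : beyond e p x -> beyond e p y -> 0 <= t <= 1 ->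
  beyond e p (t * x + (1 - t) * y).
Proof.
move=> px py /andP[t0 t1]; have [h|h] := leP t 2^-1; move: px py; rewrite /beyond;
  by case: e => px py; nra.
Qed.

Lemma convex_hit (p x y : R) : beyond true p x -> beyond false p y ->
  exists2 t, 0 <= t <= 1 & t * x + (1 - t) * y = p.
Proof.
move=> /= px py; have xy : 0 < x - y by lra.
exists ((p - y) / (x - y)); last by field; rewrite gt_eqF.
by rewrite divr_ge0 ?ler_pdivrMr ?mul1r//; lra.
Qed.

(** If every open orthant at [p] contained a point of a convex set, then so would
    [p] itself: move to [p] one coordinate at a time. *)
Lemma convex_misses_orthant (S : set (R * R * R)) (p : R * R * R) :
  convex_set S -> ~ S p -> exists e : bool * bool * bool, forall q, S q ->
    ~~ [&& beyond e.1.1 p.1.1 q.1.1, beyond e.1.2 p.1.2 q.1.2 & beyond e.2 p.2 q.2].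
Proof.
move=> cS; apply: contra_notP => noe.
have H3 e1 e2 e3 : exists q, [/\ S q, beyond e1 p.1.1 q.1.1, beyond e2 p.1.2 q.1.2 & beyond e3 p.2 q.2].
  apply: contrapT => nq; apply: noe; exists (e1, e2, e3) => q Sq.
  by apply/negP => /and3P[b1 b2 b3]; apply: nq; exists q.
have H2 e1 e2 : exists q, [/\ S q, beyond e1 p.1.1 q.1.1, beyond e2 p.1.2 q.1.2 & q.2 = p.2].
  have [q [Sq q1 q2 q3]] := H3 e1 e2 true; have [r [Sr r1 r2 r3]] := H3 e1 e2 false.
  have [t t01 tE] := convex_hit q3 r3.
  exists (t *: q + (1 - t) *: r); split; first exact: convex_comb.
  - exact: beyond_conv.
  - exact: beyond_conv.
  - exact: tE.
have H1 e1 : exists q, [/\ S q, beyond e1 p.1.1 q.1.1, q.1.2 = p.1.2 & q.2 = p.2].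
  have [q [Sq q1 q2 q3]] := H2 e1 true; have [r [Sr r1 r2 r3]] := H2 e1 false.
  have [t t01 tE] := convex_hit q2 r2.
  exists (t *: q + (1 - t) *: r); split; first exact: convex_comb.
  - exact: beyond_conv.
  - exact: tE.
  - by rewrite /= q3 r3 -mulrDl addrC subrK mul1r.
have [q [Sq q1 q2 q3]] := H1 true; have [r [Sr r1 r2 r3]] := H1 false.
have [t t01 tE] := convex_hit q1 r1.
suff -> : p = t *: q + (1 - t) *: r by exact: convex_comb.
rewrite [p]surjective_pairing [p.1]surjective_pairing; congr (_, _, _).
- by rewrite /= -tE.
- by rewrite /= q2 r2 -mulrDl addrC subrK mul1r.
- by rewrite /= q3 r3 -mulrDl addrC subrK mul1r.
Qed.

Definition in_cell3 (N : nat) (k : nat * nat * nat) (q : R * R * R) : bool :=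
  [&& in_cell N k.1.1 q.1.1, in_cell N k.1.2 q.1.2 & in_cell N k.2 q.2].

Lemma cell_beyond N (k k' : nat) (x y : R) e : (0 < N)%N ->
  in_cell N k x -> in_cell N k' y -> (if e then (k < k')%N else (k' < k)%N) -> beyond e x y.
Proof.
move=> N0 /andP[h1 h2] /andP[h3 h4]; have Nr : 0 < N%:R :> R by rewrite ltr0n.
case: e => kk' /=; rewrite -(ltr_pM2l Nr).
  by rewrite (lt_le_trans h2)// (le_trans _ h3)// ler_nat.
by rewrite (lt_le_trans h4)// (le_trans _ h1)// ler_nat.
Qed.

Local Notation T3 n := ('I_n * 'I_n * 'I_n)%type.
Definition ord3 n (k : T3 n) : nat * nat * nat := (val k.1.1, val k.1.2, val k.2).

Variables (S : set (R * R * R)) (cS : convex_set S).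

Definition meets3 N (k : nat * nat * nat) : bool := `[< exists2 q, S q & in_cell3 N k q >].
Definition inside3 N (k : nat * nat * nat) : bool := `[< forall q, in_cell3 N k q -> S q >].

(** A cell that meets the set without being inside it is cut off by an open
    orthant, hence so is every later cell on the diagonal of that orthant: each
    of the [O(n ^ 2)] diagonals carries at most one such cell per orthant. *)
Lemma boundary_cells_count N n : (0 < N)%N ->
  (#|[pred k : T3 n | meets3 N (ord3 k) && ~~ inside3 N (ord3 k)]| <= 8 * (2 * n).+1 ^ 2)%N.
Proof.
move=> N0.
pose B (e : bool * bool * bool) := [pred k : T3 n | meets3 N (ord3 k) &&
  `[< exists2 p, in_cell3 N (ord3 k) p & forall q, S q ->
    ~~ [&& beyond e.1.1 p.1.1 q.1.1, beyond e.1.2 p.1.2 q.1.2 & beyond e.2 p.2 q.2] >] ].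
have cardB e : (#|B e| <= (2 * n).+1 ^ 2)%N.
  pose c (b : bool) (i : 'I_n) : nat := if b then nat_of_ord i else (n - nat_of_ord i)%N.
  (* The signed coordinates [c] grow into the orthant [e], and [f] labels the
   diagonals in its direction, with the offset [n] to stay nonnegative. *)
pose f (k : T3 n) : 'I_(2 * n).+1 * 'I_(2 * n).+1 :=
    (inord (c e.1.1 k.1.1 + n - c e.1.2 k.1.2), inord (c e.1.1 k.1.1 + n - c e.2 k.2)).
  have cn b i : (c b i <= n)%N by rewrite /c; case: b; [exact: ltnW (ltn_ord i)|exact: leq_subr].
  have noincr k k' : k \in B e -> k' \in B e ->
      (c e.1.1 k.1.1 < c e.1.1 k'.1.1)%N -> (c e.1.2 k.1.2 < c e.1.2 k'.1.2)%N ->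
      (c e.2 k.2 < c e.2 k'.2)%N -> False.
    move=> /andP[_ /asboolP[p pk hp]] /andP[/asboolP[q Sq qk'] _] l1 l2 l3.
    move/and3P: pk => [p1 p2 p3]; move/and3P: qk' => [q1 q2 q3].
    have cE b (i i' : 'I_n) : (c b i < c b i')%N -> if b then (i < i')%N else (i' < i)%N.
      by rewrite /c; case: b => //; have := ltn_ord i; have := ltn_ord i'; lia.
    have := hp q Sq; apply/negP/negPn/and3P; split.
    - exact: cell_beyond p1 q1 (cE _ _ _ l1).
    - exact: cell_beyond p2 q2 (cE _ _ _ l2).
    - exact: cell_beyond p3 q3 (cE _ _ _ l3).
  have fI : {in B e &, injective f}.
    move=> k k' kB k'B [/(congr1 val) e1 /(congr1 val) e2].
    have b1 := cn e.1.1 k.1.1; have b2 := cn e.1.2 k.1.2; have b3 := cn e.2 k.2.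
    have b4 := cn e.1.1 k'.1.1; have b5 := cn e.1.2 k'.1.2; have b6 := cn e.2 k'.2.
    have bnd a b : (a <= n)%N -> (a + n - b < (2 * n).+1)%N by lia.
    move: e1 e2; rewrite /= !inordK; [|exact: bnd..].
    have := noincr k k' kB k'B; have := noincr k' k k'B kB.
    have cI b (i i' : 'I_n) : c b i = c b i' -> i = i'.
      rewrite /c => h; apply: val_inj; move: h; have := ltn_ord i; have := ltn_ord i'.
      by case: b => /=; lia.
    have := cI e.1.1 k.1.1 k'.1.1; have := cI e.1.2 k.1.2 k'.1.2; have := cI e.2 k.2 k'.2.
    move: b1 b2 b3 b4 b5 b6.
    set x1 := c _ k.1.1; set x2 := c _ k.1.2; set x3 := c _ k.2.
    set x1' := c _ k'.1.1; set x2' := c _ k'.1.2; set x3' := c _ k'.2.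
    move=> b1 b2 b3 b4 b5 b6 i3 i2 i1 A1 A2 e1 e2.
    have [lt|gt|eq] := ltngtP x1 x1'.
    - by exfalso; apply: A2 => //; lia.
    - by exfalso; apply: A1 => //; lia.
    - rewrite [k]surjective_pairing [k.1]surjective_pairing [k']surjective_pairing [k'.1]surjective_pairing.
      by rewrite i1// i2 ?i3//; lia.
  rewrite -(card_in_image fI) (leq_trans (max_card _))// card_prod card_ord.
  by rewrite expnS expn1.
have cover : {subset [pred k : T3 n | meets3 N (ord3 k) && ~~ inside3 N (ord3 k)]
              <= [pred k | [exists e, k \in B e]]}.
  move=> k /andP[km /asboolPn/existsNP[p /not_implyP[pk nSp]]].
  have [e he] := convex_misses_orthant cS nSp.
  by apply/existsP; exists e; rewrite inE km; apply/asboolP; exists p.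
apply: (@leq_trans #|[pred k : T3 n | [exists e, k \in B e]]|); first by apply: subset_leq_card; exact/fintype.subsetP.
apply: (@leq_trans (\sum_(e : bool * bool * bool) #|B e|)%N); last first.
  apply: (@leq_trans (\sum_(e : bool * bool * bool) (2 * n).+1 ^ 2)%N).
    by apply: leq_sum => e _.
  by rewrite sum_nat_const !card_prod card_bool.
rewrite -sum1_card (eq_bigr (fun e => \sum_(k | k \in B e) 1)%N); last first.
  by move=> e _; rewrite sum1_card.
rewrite (exchange_big_dep xpredT)//= big_mkcond /=.
apply: leq_sum => k _; rewrite inE; case: existsP => // -[e ke].
by rewrite (bigD1 e).
Qed.

End ConvexCells.

(** * Lebesgue measure of unions of cells *)

Section CellMeasures.
Context {R : realType}.

(** Monotonicity without measurability of the integrands: the integral of a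
    nonnegative function is a supremum over the simple functions below it. *)
Lemma integral_mono d (T : measurableType d) (mu : {measure set T -> \bar R}) (f g : T -> \bar R) :
  (forall x, (0 <= f x)%E) -> (forall x, (f x <= g x)%E) ->
  (\int[mu]_x f x <= \int[mu]_x g x)%E.
Proof.
move=> f0 fg; rewrite !ge0_integralE//; last by move=> x _; exact: le_trans (fg x).
apply: ereal_sup_le => _ [h hf <-]; exists h => // x.
apply: le_trans (hf x) _; rewrite /patch mem_setT; exact: fg.
Qed.

Local Notation MR := (measurableTypeR R).
Local Notation leb := (@lebesgue_measure R).

Let plane_measure : {measure set (MR * MR) -> \bar R} := (leb \x leb)%E.

Let lambda2_set0 : @lambda2 R set0 = 0%E.
Proof. exact: (measure0 plane_measure). Qed.
Let lambda2_ge0 A : (0 <= @lambda2 R A)%E.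
Proof. exact: (measure_ge0 plane_measure). Qed.
Let lambda2_additive : semi_sigma_additive (@lambda2 R).
Proof. exact: (@measure_semi_sigma_additive _ _ _ plane_measure). Qed.

(** This lets the theory of product measures apply to [lambda3]. *)
HB.instance Definition _ := isMeasure.Build _ _ _ (@lambda2 R) lambda2_set0 lambda2_ge0 lambda2_additive.

Let space_measure : {measure set ((R * R) * MR) -> \bar R} := (@lambda2 R \x leb)%E.
Lemma lambda3E (A : set (R * R * R)) : lambda3 A = space_measure A. Proof. by []. Qed.

Lemma lambda2_box (A B : set R) : measurable A -> measurable B ->
  lambda2 (A `*` B)%classic = (leb A * leb B)%E.
Proof. by move=> mA mB; exact: product_measure1E. Qed.

Lemma lambda3_box (A : set (R * R)) (B : set R) : measurable A -> measurable B ->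
  lambda3 (A `*` B)%classic = (lambda2 A * leb B)%E.
Proof. by move=> mA mB; exact: product_measure1E. Qed.

(** It is enough that the sections are measurable, which holds for every convex
    set, Borel or not. *)
Lemma lambda2_mono (A B : set (R * R)) : (forall x, measurable (xsection A x)) ->
  (forall x, measurable (xsection B x)) -> (A `<=` B)%classic -> (lambda2 A <= lambda2 B)%E.
Proof.
move=> mA mB AB; apply: integral_mono => x //=.
apply: le_measure; [exact: mem_set (mA x)|exact: mem_set (mB x)|].
by move=> z; rewrite /xsection /= !inE => /AB.
Qed.

Lemma lambda3_mono (A B : set (R * R * R)) : (forall x, measurable (xsection A x)) ->
  (forall x, measurable (xsection B x)) -> (A `<=` B)%classic -> (lambda3 A <= lambda3 B)%E.
Proof.
move=> mA mB AB; apply: integral_mono => x //=.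
apply: le_measure; [exact: mem_set (mA x)|exact: mem_set (mB x)|].
by move=> z; rewrite /xsection /= !inE => /AB.
Qed.

Lemma measure_disjoint_union d (T : measurableType d) (mu : {measure set T -> \bar R})
    (K : eqType) (box : K -> set T) (c : R) (r : seq K) :
  (forall k, measurable (box k)) -> (forall k, mu (box k) = c%:E) ->
  (forall k k' q, box k q -> box k' q -> k = k') -> uniq r ->
  let U := [set q | exists2 k, k \in r & box k q]%classic in
  measurable U /\ mu U = ((size r)%:R * c)%:E.
Proof.
move=> mbox mubox disj; elim: r => [_|k r IH /= /andP[kr ur]] /=.
  have -> : [set q | exists2 k, k \in [::] & box k q]%classic = set0.
    by apply/seteqP; split=> // q [].
  by split; [exact: measurable0|rewrite measure0 mul0r].
have [mU muU] := IH ur; set U := [set q | _]%classic in mU muU.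
have -> : [set q | exists2 k0, k0 \in k :: r & box k0 q]%classic = (box k `|` U)%classic.
  apply/seteqP; split=> q.
    by move=> [k0]; rewrite inE => /orP[/eqP -> ?|? ?]; [left|right; exists k0].
  by move=> [bk|[k0 k0r bk]]; [exists k|exists k0]; rewrite // inE ?eqxx// k0r orbT.
split; first exact: measurableU.
have dj : (box k `&` U = set0)%classic.
  apply/seteqP; split=> // q [bk [k0 k0r bk0]].
  by move: kr; rewrite (disj _ _ _ bk bk0) k0r.
have -> : mu (box k `|` U)%classic = (mu (box k) + mu U)%E by exact: measureU.
by rewrite mubox muU -EFinD -natr1 mulrDl mul1r addrC.
Qed.

Lemma cell_itv N k : (0 < N)%N ->
  [set x : R | in_cell N k x]%classic = `[k%:R / N%:R, k.+1%:R / N%:R[%classic.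
Proof.
move=> N0; have Nr : 0 < N%:R :> R by rewrite ltr0n.
apply/seteqP; split=> x /=; rewrite in_itv /= /in_cell ler_pdivrMr// ltr_pdivlMr// mulrC//.
Qed.

Lemma measurable_cell N k : (0 < N)%N -> measurable [set x : R | in_cell N k x]%classic.
Proof. by move=> N0; rewrite cell_itv//; exact: measurable_itv. Qed.

Lemma lebesgue_cell N k : (0 < N)%N ->
  leb [set x : R | in_cell N k x]%classic = (N%:R^-1)%:E.
Proof.
move=> N0; have Nr : 0 < N%:R :> R by rewrite ltr0n.
rewrite cell_itv// lebesgue_measure_itv /= lte_fin ltr_pM2r ?invr_gt0// ltr_nat ltnSn.
by rewrite -EFinB -mulrBl -natr1 addrAC subrr add0r mul1r.
Qed.

Lemma in_cell_unique N k k' (x : R) : in_cell N k x -> in_cell N k' x -> k = k'.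
Proof.
move=> /andP[h1 h2] /andP[h3 h4]; apply/eqP; rewrite eqn_leq; apply/andP; split.
  by rewrite -ltnS -(ltr_nat R) (le_lt_trans h1).
by rewrite -ltnS -(ltr_nat R) (le_lt_trans h3).
Qed.

Definition in_cell2 (N : nat) (k : nat * nat) (q : R * R) : bool :=
  in_cell N k.1 q.1 && in_cell N k.2 q.2.

Lemma lambda2_cells N (r : seq (nat * nat)) : (0 < N)%N -> uniq r ->
  let U := [set q : R * R | exists2 k, k \in r & in_cell2 N k q]%classic in
  measurable U /\ lambda2 U = ((size r)%:R / N%:R ^+ 2)%:E.
Proof.
move=> N0 ur; pose box (k : nat * nat) : set (R * R) :=
  ([set x : R | in_cell N k.1 x] `*` [set x : R | in_cell N k.2 x])%classic.
have mbox k : measurable (box k) by apply: measurableX; exact: measurable_cell.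
have mubox k : lambda2 (box k) = (N%:R ^- 2)%:E.
  rewrite /box lambda2_box; [|exact: measurable_cell..].
  by rewrite !lebesgue_cell// -EFinM -invfM -expr2.
have disj (k k' : nat * nat) (q : R * R) : box k q -> box k' q -> k = k'.
  case: k k' => [k1 k2] [k1' k2'] [/= h1 h2] [/= h3 h4].
  by rewrite (in_cell_unique h1 h3) (in_cell_unique h2 h4).
have := measure_disjoint_union mbox mubox disj ur.
rewrite /= (_ : [set q | exists2 k, k \in r & in_cell2 N k q]%classic =
  [set q | exists2 k, k \in r & box k q]%classic)//.
by apply/seteqP; split=> q [k kr] => [/andP hk|hk]; exists k => //; exact/andP.
Qed.

Lemma lambda3_cells N (r : seq (nat * nat * nat)) : (0 < N)%N -> uniq r ->
  let U := [set q : R * R * R | exists2 k, k \in r & in_cell3 N k q]%classic in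
  measurable (U : set ((R * R) * MR)) /\ lambda3 U = ((size r)%:R / N%:R ^+ 3)%:E.
Proof.
move=> N0 ur; pose box (k : nat * nat * nat) : set (R * R * R) :=
  (([set x : R | in_cell N k.1.1 x] `*` [set x : R | in_cell N k.1.2 x]) `*`
    [set x : R | in_cell N k.2 x])%classic.
have mbox k : measurable (box k : set ((R * R) * MR)).
  by apply: measurableX; [apply: measurableX|]; exact: measurable_cell.
have mubox k : space_measure (box k) = (N%:R ^- 3)%:E.
  rewrite -lambda3E /box lambda3_box; last exact: measurable_cell; last first.
    by apply: measurableX; exact: measurable_cell.
  rewrite lambda2_box; [|exact: measurable_cell..].
  by rewrite !lebesgue_cell// -!EFinM; congr (_%:E); rewrite -!invfM !exprS expr0 mulr1 mulrA.
have disj (k k' : nat * nat * nat) (q : R * R * R) : box k q -> box k' q -> k = k'.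
  case: k k' => [[k1 k2] k3] [[k1' k2'] k3'] [[/= h1 h2] h3] [[/= g1 g2] g3].
  by rewrite (in_cell_unique h1 g1) (in_cell_unique h2 g2) (in_cell_unique h3 g3).
have := @measure_disjoint_union _ _ space_measure _ box _ r mbox mubox disj ur.
rewrite /= lambda3E (_ : [set q | exists2 k, k \in r & in_cell3 N k q]%classic =
  [set q | exists2 k, k \in r & box k q]%classic)//.
apply/seteqP; split=> q [k kr] => [/and3P[a b c]|[[a b] c]]; exists k => //.
by apply/and3P.
Qed.

Lemma convex_section2 (S : set (R * R)) x : convex_set S -> measurable (xsection S x).
Proof.
move=> cS; apply: measurable_realfun.is_interval_measurable => a b; rewrite /xsection /= !inE => Sa Sb z /andP[az zb]; apply: mem_set.
have [ab|ab] := eqVneq a b.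
  have -> : z = a by apply/eqP; rewrite eq_le az ab zb.
  exact: Sa.
have ba : 0 < b - a by rewrite subr_gt0 lt_def eq_sym ab (le_trans az zb).
have t01 : 0 <= (b - z) / (b - a) <= 1.
  by rewrite divr_ge0 ?ler_pdivrMr ?mul1r//; lra.
have tE : (b - z) / (b - a) * a + (1 - (b - z) / (b - a)) * b = z by field; rewrite gt_eqF.
have := convex_comb cS Sa Sb t01; congr (S _).
congr (_, _) => /=; first by rewrite -mulrDl addrC subrK mul1r.
exact: tE.
Qed.

Lemma convex_section3 (S : set (R * R * R)) x : convex_set S -> measurable (xsection S x).
Proof.
move=> cS; apply: measurable_realfun.is_interval_measurable => a b; rewrite /xsection /= !inE => Sa Sb z /andP[az zb]; apply: mem_set.
have [ab|ab] := eqVneq a b.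
  have -> : z = a by apply/eqP; rewrite eq_le az ab zb.
  exact: Sa.
have ba : 0 < b - a by rewrite subr_gt0 lt_def eq_sym ab (le_trans az zb).
have t01 : 0 <= (b - z) / (b - a) <= 1.
  by rewrite divr_ge0 ?ler_pdivrMr ?mul1r//; lra.
have tE : (b - z) / (b - a) * a + (1 - (b - z) / (b - a)) * b = z by field; rewrite gt_eqF.
have := convex_comb cS Sa Sb t01; congr (S _).
case: x {Sa Sb} => x1 x2; congr (_, _, _) => /=.
- by rewrite -mulrDl addrC subrK mul1r.
- by rewrite -mulrDl addrC subrK mul1r.
- exact: tE.
Qed.

End CellMeasures.

(** * Convex sets between unions of cells *)

Section Sandwich.
Context {R : realType}.

Local Notation T3 n := ('I_n * 'I_n * 'I_n)%type.
Local Notation T2 n := ('I_n * 'I_n)%type.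

Lemma in_cell_trunc (N : nat) (x : R) : (0 < N)%N -> 0 <= x <= 1 ->
  exists k : 'I_N.+1, in_cell N k x.
Proof.
move=> N0 /andP[x0 x1]; have kN : (cell N x < N.+1)%N.
  rewrite /cell truncn_lt_nat ?mulr_ge0// -natr1 (@le_lt_trans _ _ N%:R) ?ltrDl//.
  by rewrite ler_piMr.
by exists (Ordinal kN); rewrite /in_cell -cellP.
Qed.

Lemma in_cell_mid (N k : nat) : (0 < N)%N -> in_cell N k ((k%:R + 2^-1) / N%:R : R).
Proof.
move=> N0; rewrite /in_cell mulrC divfK ?pnatr_eq0 -?lt0n// -[k.+1%:R]natr1.
by apply/andP; split; lra.
Qed.

Lemma in_cell_in_unit (N k : nat) : (0 < N)%N ->
  (forall x : R, in_cell N k x -> x <= 1) -> (k < N)%N.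
Proof.
move=> N0 /(_ _ (in_cell_mid k N0)); rewrite ler_pdivrMr ?ltr0n// mul1r => h.
by rewrite -(ltr_nat R); lra.
Qed.

Section Space.
Variables (S : set (R * R * R)) (cS : convex_set S) (N : nat) (N0 : (0 < N)%N).
Hypothesis Sbox : (S `<=` (`[0, 1] `*` `[0, 1]) `*` `[0, 1[)%classic.

Definition inner_cells3 := [pred k : T3 N.+1 | inside3 S N (ord3 k)].
Definition outer_cells3 := [pred k : T3 N.+1 | meets3 S N (ord3 k)].

Lemma ord3_inj n : injective (@ord3 n).
Proof. by move=> [[a b] c] [[a' b'] c'] [/val_inj -> /val_inj -> /val_inj ->]. Qed.

Let Sitv q : S q -> [/\ 0 <= q.1.1 <= 1, 0 <= q.1.2 <= 1 & 0 <= q.2 < 1].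
Proof. by move=> /Sbox [[]]; rewrite /= !in_itv. Qed.

Lemma outer_cells3_cover q : S q -> exists2 k, k \in outer_cells3 & in_cell3 N (ord3 k) q.
Proof.
move=> Sq; have [q1 q2 /andP[q3 q3']] := Sitv Sq.
have [k1 h1] := in_cell_trunc N0 q1; have [k2 h2] := in_cell_trunc N0 q2.
have [k3 h3] := in_cell_trunc N0 (introT andP (conj q3 (ltW q3'))).
have hk : in_cell3 N (ord3 (k1, k2, k3)) q by apply/and3P.
by exists (k1, k2, k3) => //; apply/asboolP; exists q.
Qed.

(** The indices range up to [N] included, because the closed cube reaches into the
    cells of index [N]; but those are not contained in it. *)
Lemma inner_cells3_lt k : k \in inner_cells3 -> [/\ (k.1.1 < N)%N, (k.1.2 < N)%N & (k.2 < N)%N].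
Proof.
move=> /asboolP kin; have mid l := in_cell_mid l N0.
split; apply: (in_cell_in_unit N0) => x hx.
- have /Sitv[/andP[]//] : S (x, (k.1.2%:R + 2^-1) / N%:R, (k.2%:R + 2^-1) / N%:R).
  by apply: kin; apply/and3P; split => //=; exact: mid.
- have /Sitv[_ /andP[]//] : S ((k.1.1%:R + 2^-1) / N%:R, x, (k.2%:R + 2^-1) / N%:R).
  by apply: kin; apply/and3P; split => //=; exact: mid.
- have /Sitv[_ _ /andP[_ /ltW]//] : S ((k.1.1%:R + 2^-1) / N%:R, (k.1.2%:R + 2^-1) / N%:R, x).
  by apply: kin; apply/and3P; split => //=; exact: mid.
Qed.

(** The constant is that of [N = 1], where [8 * (2 * N.+1).+1 ^ 2] is 200. *)
Lemma outer_le_inner3 : (#|outer_cells3| <= #|inner_cells3| + 200 * N ^ 2)%N.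
Proof.
have hB := boundary_cells_count cS N.+1 N0.
have : (#|outer_cells3| <= #|inner_cells3| + #|[pred k : T3 N.+1 | meets3 S N (ord3 k) && ~~ inside3 S N (ord3 k)]|)%N.
  rewrite -(cardID (mem inner_cells3) outer_cells3) leq_add//.
    by apply: subset_leq_card; apply/fintype.subsetP => k /andP[].
  apply: subset_leq_card; apply/fintype.subsetP => k.
  by rewrite !inE andbC.
move=> h; apply: leq_trans h _; rewrite leq_add2l (leq_trans hB)//; nia.
Qed.

Lemma lambda3_sandwich :
  #|inner_cells3|%:R / N%:R ^+ 3 <= fine (lambda3 S) <= #|outer_cells3|%:R / N%:R ^+ 3.
Proof.
have ur (p : pred (T3 N.+1)) : uniq [seq ord3 k | k <- enum p].
  by rewrite (map_inj_uniq (@ord3_inj _)) enum_uniq.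
have [mI lI] := @lambda3_cells R _ _ N0 (ur inner_cells3).
have [mO lO] := @lambda3_cells R _ _ N0 (ur outer_cells3).
rewrite size_map -cardE in lI; rewrite size_map -cardE in lO.
have secS x := convex_section3 x cS.
have h1 : ((#|inner_cells3|%:R / N%:R ^+ 3)%:E <= lambda3 S)%E.
  rewrite -lI; apply: lambda3_mono => //; first by move=> x; exact: measurable_xsection.
  move=> q [_ /mapP[k kin ->] hq]; move: kin; rewrite mem_enum => /asboolP; exact.
have h2 : (lambda3 S <= (#|outer_cells3|%:R / N%:R ^+ 3)%:E)%E.
  rewrite -lO; apply: lambda3_mono => //; first by move=> x; exact: measurable_xsection.
  move=> q Sq; have [k kout hk] := outer_cells3_cover Sq.
  by exists (ord3 k) => //; apply/mapP; exists k => //; rewrite mem_enum.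
move: h1 h2; case: (lambda3 S) => [r| |]//=.
by rewrite !lee_fin => -> ->.
Qed.

End Space.

Lemma convex_cylinder (S : set (R * R)) : convex_set S ->
  convex_set ((S `*` `[0, 1[)%classic : set (R * R * R)).
Proof.
move=> cS; apply/convex_setW => x y; rewrite !inE => -[Sx x01] [Sy y01] k k0 k1.
apply: mem_set; split; first by have := cS x.1 y.1 k; rewrite !inE; apply.
set t := k%:num in k0 k1.
have -> : (conv k x y).2 = t * x.2 + (1 - t) * y.2 by [].
move: x01 y01; rewrite /= !in_itv /= => /andP[x0 x1] /andP[y0 y1].
by apply/andP; split; nra.
Qed.

Section Plane.
Variables (S : set (R * R)) (cS : convex_set S).
Hypothesis Sbox : (S `<=` `[0, 1] `*` `[0, 1])%classic.

Let S3 : set (R * R * R) := (S `*` `[0, 1[)%classic.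
Let cS3 : convex_set S3. Proof. exact: convex_cylinder. Qed.

Definition meets2 N (k : nat * nat) : bool := `[< exists2 q, S q & in_cell2 N k q >].
Definition inside2 N (k : nat * nat) : bool := `[< forall q, in_cell2 N k q -> S q >].
Definition ord2 n (k : T2 n) : nat * nat := (val k.1, val k.2).

(** Each boundary square of a plane set carries [N] boundary cubes of its
    cylinder. *)
Lemma boundary_cells_count2 N : (0 < N)%N ->
  (N * #|[pred k : T2 N.+1 | meets2 N (ord2 k) && ~~ inside2 N (ord2 k)]| <= 200 * N ^ 2)%N.
Proof.
move=> N0; have hB := boundary_cells_count cS3 N.+1 N0.
apply: (@leq_trans (8 * (2 * N.+1).+1 ^ 2)); last by nia.
apply: leq_trans hB.
set B2 := [pred k : T2 N.+1 | _]; set B3 := [pred k : T3 N.+1 | _].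
pose f (k : T2 N.+1 * 'I_N) : T3 N.+1 := (k.1, widen_ord (leqnSn N) k.2).
have fI : injective f.
  by move=> [a b] [a' b'] [-> h]; congr (_, _); exact: val_inj.
have -> : (N * #|B2|)%N = #|[predX B2 & 'I_N]| by rewrite cardX card_ord mulnC.
rewrite -(fintype.card_image fI).
apply: subset_leq_card; apply/fintype.subsetP => _ /fintype.imageP[[k l] /andP[/= kB _] ->].
move: kB => /andP[/asboolP[q Sq qk] /asboolPn/existsNP[p /not_implyP[pk nSp]]].
have midl := @in_cell_mid N l N0.
have mid01 : 0 <= ((l%:R + 2^-1) / N%:R : R) < 1.
  rewrite divr_ge0 ?addr_ge0//= ltr_pdivrMr ?ltr0n// mul1r.
  have : l%:R + 1 <= N%:R :> R by rewrite natr1 ler_nat.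
  by lra.
apply/andP; split.
  apply/asboolP; exists (q, (l%:R + 2^-1) / N%:R).
    by split; rewrite /= ?in_itv.
  by case/andP: qk => ? ?; apply/and3P.
apply/asboolPn => hin; apply: nSp.
have : S3 (p, (l%:R + 2^-1) / N%:R).
  by apply: hin; case/andP: pk => ? ?; apply/and3P.
by case.
Qed.

Lemma plane_sandwich N : (0 < N)%N ->
  let a := #|[pred k : T2 N.+1 | inside2 N (ord2 k)]|%:R / N%:R ^+ 2 in
  let b := #|[pred k : T2 N.+1 | meets2 N (ord2 k)]|%:R / N%:R ^+ 2 in
  a <= fine (lambda2 S) <= b /\ a <= fine (lambda3 S3) <= b.
Proof.
move=> N0 a b.
have ord2I : injective (@ord2 N.+1) by move=> [x y] [x' y'] [/val_inj -> /val_inj ->].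
have ur (p : pred (T2 N.+1)) : uniq [seq ord2 k | k <- enum p].
  by rewrite (map_inj_uniq ord2I) enum_uniq.
pose pin := [pred k : T2 N.+1 | inside2 N (ord2 k)].
pose pout := [pred k : T2 N.+1 | meets2 N (ord2 k)].
have [mI lI] := @lambda2_cells R _ _ N0 (ur pin); have [mO lO] := @lambda2_cells R _ _ N0 (ur pout).
rewrite size_map -cardE -[_ / _]/a in lI; rewrite size_map -cardE -[_ / _]/b in lO.
set UI := [set q | _]%classic in mI lI; set UO := [set q | _]%classic in mO lO.
have subI : (UI `<=` S)%classic.
  by move=> q [_ /mapP[k kin ->] hq]; move: kin; rewrite mem_enum => /asboolP; exact.
have subO : (S `<=` UO)%classic.
  move=> q Sq; have [] := Sbox Sq; rewrite /= !in_itv => q1 q2.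
  have [k1 h1] := in_cell_trunc N0 q1; have [k2 h2] := in_cell_trunc N0 q2.
  have hk : in_cell2 N (ord2 (k1, k2)) q by apply/andP.
  exists (ord2 (k1, k2)) => //; apply/mapP; exists (k1, k2) => //.
  by rewrite mem_enum; apply/asboolP; exists q.
have fineP (r : \bar R) : (a%:E <= r)%E -> (r <= b%:E)%E -> a <= fine r <= b.
  by case: r => [r| |]//=; rewrite !lee_fin => -> ->.
have leb01 : lebesgue_measure (`[0, 1[%classic : set R) = 1%E.
  by rewrite lebesgue_measure_itv /= lte_fin ltr01 -EFinB subr0.
have m01 : measurable (`[0, 1[%classic : set R) by exact: measurable_itv.
have cyl (U : set (R * R)) : measurable U -> lambda3 (U `*` `[0, 1[)%classic = lambda2 U.
  by move=> mU; rewrite lambda3_box// leb01 mule1.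
have secS x := convex_section2 x cS; have secS3 x := convex_section3 x cS3.
split; apply: fineP.
- by rewrite -lI; apply: lambda2_mono => // x; exact: measurable_xsection.
- by rewrite -lO; apply: lambda2_mono => // x; exact: measurable_xsection.
- rewrite -lI -cyl//; apply: lambda3_mono => //; last by move=> q [/subI].
  by move=> x; apply: measurable_xsection; exact: measurableX.
- rewrite -lO -cyl//; apply: lambda3_mono => //; last by move=> q [/subO].
  by move=> x; apply: measurable_xsection; exact: measurableX.
Qed.

(** Both sides lie between the same sums over squares; Fubini's theorem does
    not apply, since [S] may fail to be Borel. *)
Lemma lambda3_cylinder : fine (lambda3 S3) = fine (lambda2 S).
Proof.
apply/eqP; rewrite -subr_eq0 -normr_le0; apply/ler_addgt0Pl => e e0; rewrite addr0.
pose N := (Num.truncn (200 / e)).+1; have N0 : (0 < N)%N by [].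
have Nr : 0 < N%:R :> R by rewrite ltr0n.
have := plane_sandwich N0; rewrite /=; set pin := [pred k : T2 N.+1 | _]; set pout := [pred k : T2 N.+1 | _].
move=> [/andP[a1 b1] /andP[a2 b2]].
have hB := boundary_cells_count2 N0.
have card : (#|pout| <= #|pin| + #|[pred k : T2 N.+1 | meets2 N (ord2 k) && ~~ inside2 N (ord2 k)]|)%N.
  rewrite -(cardID (mem pin) pout) leq_add//.
    by apply: subset_leq_card; apply/fintype.subsetP => k /andP[].
  apply: subset_leq_card; apply/fintype.subsetP => k.
  by rewrite !inE andbC.
have : N%:R * (#|pout|%:R - #|pin|%:R) <= 200 * N%:R ^+ 2 :> R.
  rewrite -natrX -natrM; apply: le_trans (_ : (N * #|[pred k : T2 N.+1 | meets2 N (ord2 k) && ~~ inside2 N (ord2 k)]|)%:R <= _); last by rewrite ler_nat.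
  by rewrite natrM ler_pM2l// lerBlDl -natrD ler_nat.
have N2 : 0 < N%:R ^+ 2 :> R by rewrite exprn_gt0.
have hN := truncnS_gt (200 / e); rewrite -/N ltr_pdivrMr// in hN.
move=> h.
have gap : #|pout|%:R / N%:R ^+ 2 - #|pin|%:R / N%:R ^+ 2 <= e.
  rewrite -mulrBl ler_pdivrMr// -(ler_pM2l Nr) (le_trans h)//.
  by rewrite [leRHS]mulrA ler_wpM2r ?(ltW N2)// (ltW hN).
by rewrite ler_norml; apply/andP; split; lra.
Qed.

End Plane.

End Sandwich.

(** * From the surface to the 3-manifold, for a single orbit *)

Section Independence.
Context {R : realType}.
Variables (v1 v2 : R).

Lemma lin_indep3P : lin_indep_rat [tuple v1; v2; 1] <->
  (forall q1 q2 q3 : rat, ratr q1 * v1 + ratr q2 * v2 + ratr q3 = 0 -> [/\ q1 = 0, q2 = 0 & q3 = 0]).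
Proof.
split=> h.
  move=> q1 q2 q3 e; pose a (i : 'I_3) := nth 0 [:: q1; q2; q3] i.
  have ha : forall i, a i = 0.
    apply: h; rewrite !big_ord_recl big_ord0 !(tnth_nth 0) /= addr0.
    by rewrite /a /= mulr1 addrA.
  have h1 := ha (inord 0); have h2 := ha (inord 1); have h4 := ha (inord 2).
  rewrite /a inordK//= in h1; rewrite /a inordK//= in h2; rewrite /a inordK//= in h4.
move=> a; rewrite !big_ord_recl big_ord0 !(tnth_nth 0) /= addr0 mulr1 addrA => /h[e1 e2 e3] i.
by case: i => [[|[|[|//]]] hi]; [rewrite -e1|rewrite -e2|rewrite -e3]; congr a; exact: val_inj.
Qed.

Lemma lin_indep4P w : lin_indep_rat [tuple v1; v2; w; 1] <->
  (forall q1 q2 q3 q4 : rat, ratr q1 * v1 + ratr q2 * v2 + ratr q3 * w + ratr q4 = 0 ->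
    [/\ q1 = 0, q2 = 0, q3 = 0 & q4 = 0]).
Proof.
split=> h.
  move=> q1 q2 q3 q4 e; pose a (i : 'I_4) := nth 0 [:: q1; q2; q3; q4] i.
  have ha : forall i, a i = 0.
    apply: h; rewrite !big_ord_recl big_ord0 !(tnth_nth 0) /= addr0.
    by rewrite /a /= mulr1 !addrA.
  have h1 := ha (inord 0); have h2 := ha (inord 1); have h3 := ha (inord 2); have h4 := ha (inord 3).
  rewrite /a inordK//= in h1; rewrite /a inordK//= in h2.
  by rewrite /a inordK//= in h3; rewrite /a inordK//= in h4.
move=> a; rewrite !big_ord_recl big_ord0 !(tnth_nth 0) /= addr0 mulr1 !addrA => /h[e1 e2 e3 e4] i.
by case: i => [[|[|[|[|//]]]] hi]; [rewrite -e1|rewrite -e2|rewrite -e3|rewrite -e4]; congr a; exact: val_inj.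
Qed.

(** The rational span of [v1], [v2] and 1 is countable. *)
Lemma exists_independent : lin_indep_rat [tuple v1; v2; 1] ->
  exists w, lin_indep_rat [tuple v1; v2; w; 1].
Proof.
move=> /lin_indep3P h3.
pose f (q : rat * rat * rat) : R := ratr q.1.1 * v1 + ratr q.1.2 * v2 + ratr q.2.
have cA : countable (range f).
  by apply: sub_countable (countableP [set: rat * rat * rat]); exact: card_image_le.
have [w hw] : exists w, ~ range f w.
  apply: contrapT => all; have cI : countable (`[0, 1]%classic : set R).
    apply: sub_countable cA; apply: subset_card_le => w _.
    by apply: contrapT => nw; apply: all; exists w.
  have := countable_lebesgue_measure0 cI.
  by rewrite lebesgue_measure_itv /= lte_fin ltr01 -EFinB subr0 => /eqP; rewrite eqe oner_eq0.
exists w; apply/lin_indep4P => q1 q2 q3 q4 e.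
have [q30|q30] := eqVneq q3 0.
  by have [-> -> ->] : [/\ q1 = 0, q2 = 0 & q4 = 0]
    by apply: h3; move: e; rewrite q30 rmorph0 mul0r addr0.
exfalso; apply: hw; exists (- q1 / q3, - q2 / q3, - q4 / q3) => //.
have q3r : ratr q3 != 0 :> R by rewrite fmorph_eq0.
rewrite /f /= !fmorph_div !rmorphN /=; apply: (mulIf q3r).
have -> : w * ratr q3 = - (ratr q1 * v1 + ratr q2 * v2 + ratr q4) by move: e; lra.
by field.
Qed.

End Independence.

Section Assembly.
Context {R : realType} {s : nat} (P : polysquare s).

Lemma visit_freqE (X : Type) (x : nat -> X) (A : set X) (J : nat) :
  visit_freq x A J = avg (fun j => (x j \in A)%:R) J :> R.
Proof.
rewrite /visit_freq /avg; congr (_ / _).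
rewrite -sum1_card natr_sum big_mkcond /=.
by apply: eq_bigr => j _; rewrite inE; case: (_ \in _).
Qed.

Lemma chart_id (i : 'I_s) (y : R * R) : 0 <= y.1 < 1 -> 0 <= y.2 < 1 -> chart P i y = (i, y).
Proof.
case: y => a b /= h1 h2.
by rewrite /chart /= !floor_eq0// !fracpart_id//= !perm1.
Qed.

Lemma in_cell_conv (N k : nat) (x y t : R) : in_cell N k x -> in_cell N k y -> 0 <= t <= 1 ->
  in_cell N k (t * x + (1 - t) * y).
Proof.
move=> /andP[x1 x2] /andP[y1 y2] /andP[t0 t1].
rewrite /in_cell mulrDr !(mulrCA N%:R); apply/andP; split; first by nra.
have [h|h] := leP t 2^-1; nra.
Qed.

Lemma in_cell_bounds (N k : nat) (x : R) : (0 < N)%N -> (k < N)%N -> in_cell N k x -> 0 <= x < 1.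
Proof.
move=> N0 kN /andP[h1 h2]; have Nr : 0 < N%:R :> R by rewrite ltr0n.
have : k.+1%:R <= N%:R :> R by rewrite ler_nat.
have : 0 <= k%:R :> R by [].
move=> k0 k1; apply/andP; split; first by rewrite -(pmulr_rge0 _ Nr); lra.
by rewrite -(ltr_pM2l Nr) mulr1; lra.
Qed.

Section Orbit.
Variables (v1 v2 : R) (L : R -> surface_point R s).
Hypothesis hL : halfinf_geodesic (regular_points P) (displace P) (v1, v2) L.

Local Notation a1 := (L 0).2.1.
Local Notation a2 := (L 0).2.2.
Local Notation y1 := (rotation_orbit a1 v1).
Local Notation y2 := (rotation_orbit a2 v2).
Let x (j : nat) := L j%:R.
Let sheet (j : nat) := (x j).1.

Let xE j : x j = (sheet j, (y1 j, y2 j)).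
Proof.
have [c1 c2] := motion_coord hL (ler0n R j).
rewrite /rotation_orbit -c1 -c2 /sheet /x.
by case: (L _) => i [a b].
Qed.

(** The points of a half-open cell are counted without ambiguity, since its chart
    is the identity. *)
Lemma unif_distributed_cells (m : (nat -> R) -> R) : mean_functional m ->
  unif_distributed P x -> equidistributed_on_cells m sheet a1 a2 v1 v2.
Proof.
move=> mm ud N i k1 k2 k1N k2N.
have N0 : (0 < N)%N by exact: leq_ltn_trans k1N.
pose S : set (R * R) := [set q | in_cell2 N (k1, k2) q]%classic.
have cS : convex_set S.
  apply/convex_setW => q r; rewrite !inE => /andP[q1 q2] /andP[r1 r2] t t0 t1.
  by apply: mem_set; apply/andP; split; apply: in_cell_conv; rewrite ?(ltW t0) ?(ltW t1).
have Sb : (S `<=` `[0, 1] `*` `[0, 1])%classic.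
  move=> q /andP[/(in_cell_bounds N0 k1N)/andP[q1 q1'] /(in_cell_bounds N0 k2N)/andP[q2 q2']].
  by split; rewrite /= in_itv /= ?q1 ?q2 ltW.
have mem j : (x j \in (chart P i @` S)%classic) =
    [&& sheet j == i, cell N (y1 j) == k1 & cell N (y2 j) == k2].
  have f1 := fracpart_itv (a1 + j%:R * v1); have f2 := fracpart_itv (a2 + j%:R * v2).
  rewrite !cellP; [|by case/andP: f2|by case/andP: f1].
  apply/idP/idP.
    rewrite inE => -[q /[dup] /andP[q1 q2] Sq]; have b1 := in_cell_bounds N0 k1N q1.
    have b2 := in_cell_bounds N0 k2N q2.
    rewrite chart_id// xE => -[<- qE]; rewrite eqxx /=.
    by rewrite qE in q1 q2; apply/andP; split; [exact: q1|exact: q2].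
  move=> /and3P[/eqP si h1 h2]; apply: mem_set; exists (y1 j, y2 j).
    by apply/andP; split; [exact: h1|exact: h2].
  by rewrite chart_id// -si -xE.
have hfreq := ud i S cS Sb.
have -> : step sheet a1 a2 v1 v2 (fun i' k1' k2' => [&& i' == i, k1' == k1 & k2' == k2]%:R) N =
    fun j => (x j \in (chart P i @` S)%classic)%:R :> R.
  by apply/funext => j; rewrite mem.
rewrite (mean_cvg mm (l := fine (lambda2 S) / s%:R)); first last.
- have <- : visit_freq x (chart P i @` S)%classic = avg (fun j => (x j \in (chart P i @` S)%classic)%:R) :> (nat -> R).
    by apply/funext => J; exact: visit_freqE.
  exact: hfreq.
- exact: bdd_bool.
have -> : fine (lambda2 S) = N%:R ^- 2.
  have [_] := @lambda2_cells R N [:: (k1, k2)] N0 isT.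
  rewrite (_ : [set q | _]%classic = S) => [->|]; first by rewrite /= mul1r.
  apply/seteqP; split=> q; first by move=> [k]; rewrite inE => /eqP ->.
  by move=> hq; exists (k1, k2); rewrite ?inE.
by rewrite [in RHS]invfM mulrC.
Qed.

(** Disposes of the points that a convex set has on the edges with coordinate 1:
    their images under the chart have coordinate 0. *)
Lemma rotation_zero_null (m : (nat -> R) -> R) (a v : R) : mean_functional m ->
  irrational_step v -> m (fun j => (rotation_orbit a v j == 0)%:R) = 0.
Proof.
move=> mm iv; have b0 : bdd (fun j => (rotation_orbit a v j == 0)%:R : R) by exact: bdd_bool.
apply/eqP; rewrite eq_le (mean_ge0 mm) ?andbT//.
apply/ler_addgt0Pl => e e0; rewrite addr0.
pose H := (Num.truncn e^-1).+1; have H0 : (0 < H)%N by [].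
have He : H%:R^-1 <= e.
  by rewrite -[leRHS]invrK lef_pV2 ?posrE ?invr_gt0//; exact/ltW/truncnS_gt.
have [d d0 hd] := rotation_near_point iv H0.
apply: le_trans He; apply: le_trans (hd a m mm).
apply: (mean_le mm) => [//||j]; first exact: bdd_bool.
rewrite /rotation_orbit; case: eqP => [f0|_ //].
have -> : a + j%:R * v = (Num.floor (a + j%:R * v))%:~R by rewrite {1}(fracpartE (a + j%:R * v)) f0 addr0.
have := sqmod_cexpB1 ((Num.floor (a + j%:R * v))%:~R : R); rewrite cexp_int subrr sqmod0.
by move=> /esym/eqP; rewrite mulf_eq0 pnatr_eq0 /= sqrf_eq0 => /eqP ->; rewrite normr0 d0.
Qed.

Variables (w z0 : R).
Hypothesis hw : lin_indep_rat [tuple v1; v2; w; 1].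

Local Notation z := (rotation_orbit z0 w).

Lemma no_relation (r1 r2 r3 r4 : int) :
  r1%:~R * v1 + r2%:~R * v2 + r3%:~R * w + r4%:~R = 0 :> R -> [/\ r1 = 0, r2 = 0 & r3 = 0].
Proof.
move/lin_indep4P: hw => h e.
have [] := h r1%:~R r2%:~R r3%:~R r4%:~R; first by rewrite !ratr_int.
by move=> /eqP; rewrite intr_eq0 => /eqP -> /eqP; rewrite intr_eq0 => /eqP -> /eqP; rewrite intr_eq0 => /eqP ->.
Qed.

Let iv1 : irrational_step v1.
Proof.
move=> g g0 n e; have [] := no_relation (r1 := g%:Z) (r2 := 0) (r3 := 0) (r4 := - n).
  by rewrite rmorphN /= -e !mul0r !addr0 addrN.
by move=> /eqP; rewrite eqz_nat => /eqP gz; rewrite gz in g0.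
Qed.
Let iv2 : irrational_step v2.
Proof.
move=> g g0 n e; have [] := no_relation (r1 := 0) (r2 := g%:Z) (r3 := 0) (r4 := - n).
  by rewrite rmorphN /= -e !mul0r !addr0 add0r addrN.
by move=> _ /eqP; rewrite eqz_nat => /eqP gz; rewrite gz in g0.
Qed.
Let iw : irrational_step w.
Proof.
move=> g g0 n e; have [] := no_relation (r1 := 0) (r2 := 0) (r3 := g%:Z) (r4 := - n).
  by rewrite rmorphN /= -e !mul0r !add0r addrN.
by move=> _ _ /eqP; rewrite eqz_nat => /eqP gz; rewrite gz in g0.
Qed.

Let cube_ind N (i : 'I_s) (k : nat * nat * nat) j : R :=
  [&& sheet j == i, cell N (y1 j) == k.1.1, cell N (y2 j) == k.1.2 & cell N (z j) == k.2]%:R.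

(** The indicator of a cell of the surface is a weight orthogonal to the characters
    of the rotation [z], hence each cube above the cell gets an equal share. *)
Lemma mean_cube (m : (nat -> R) -> R) N i k : mean_functional m ->
  unif_distributed P x -> (k.1.1 < N)%N -> (k.1.2 < N)%N -> (k.2 < N)%N ->
  m (cube_ind N i k) = (s%:R * N%:R ^+ 3)^-1.
Proof.
move=> mm ud k1N k2N k3N; have N0 : (0 < N)%N by exact: leq_ltn_trans k1N.
have cud := unif_distributed_cells mm ud.
have cdyn := motion_cellwise_dynamics hL mm cud.
pose phi := step sheet a1 a2 v1 v2
  (fun i' k1' k2' => [&& i' == i, k1' == k.1.1 & k2' == k.1.2]%:R : R) N.
have phi01 j : 0 <= phi j <= 1 by rewrite /phi /step; case: [&& _, _ & _]; rewrite ?lexx ?ler01.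
have orth (r : int) (c : R[i]) : r != 0 ->
    m (fun j => phi j * complex.Re (c * cexp (r%:~R * (j%:R * w)))) = 0.
  move=> r0.
  have nres (n : nat) (r1 r2 r3 : int) : (0 < n)%N ->
      r1%:~R * v1 + r2%:~R * v2 - n%:R * (r%:~R * w) <> r3%:~R.
    move=> n0 e; have [] := no_relation (r1 := r1) (r2 := r2) (r3 := - (n%:Z * r)) (r4 := - r3).
      by rewrite !rmorphN /= -e intrM; ring.
    move=> _ _ /eqP; rewrite oppr_eq0 mulf_eq0 (negPf r0) orbF eqz_nat.
    by move=> /eqP sqmod; rewrite sqmod in n0.
  have := cell_indicator_orthogonal mm cud cdyn iv1 iv2 nres i k.1.1 k.1.2 c N0.
  by move=> <-; congr m; apply/funext => j; rewrite (mulrCA j%:R).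
have := rotation_independent mm phi01 iw orth z0 k3N.
rewrite (cud N i _ _ k1N k2N) => h.
transitivity ((s%:R * N%:R ^+ 2)^-1 / N%:R : R); last first.
  by rewrite -invfM -mulrA -exprSr.
rewrite -h; congr m; apply/funext => j; rewrite /cube_ind /phi /step -natrM mulnb.
by rewrite -!andbA.
Qed.

(** Comparison with the inner and outer cubes of side [1/N], whose numbers differ by
    at most [200 * N ^ 2]. *)
Lemma skew_unif_distributed : unif_distributed P x ->
  unif_distributed3 P (fun j => (x j, z j)).
Proof.
move=> ud i S cS Sb.
have s0 : 0 < s%:R :> R by rewrite ltr0n polysquare_gt0//.
pose ind j : R := ((x j, z j) \in (chart3 P i @` S)%classic)%:R.
have -> : visit_freq (fun j => (x j, z j)) (chart3 P i @` S)%classic = avg ind.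
  by apply/funext => J; rewrite visit_freqE.
have bind : bdd ind by exact: bdd_bool.
apply: avg_cvg_of_means => // m mm.
apply/eqP; rewrite -subr_eq0 -normr_le0; apply/ler_addgt0Pl => e e0; rewrite addr0.
pose N := (Num.truncn (200 / (s%:R * e))).+1; have N0 : (0 < N)%N by [].
have Nr : 0 < N%:R :> R by rewrite ltr0n.
have f1 j := fracpart_itv (a1 + j%:R * v1); have f2 j := fracpart_itv (a2 + j%:R * v2).
have f3 j := fracpart_itv (z0 + j%:R * w).
pose q j : R * R * R := (y1 j, y2 j, z j).
have bcube k : bdd (cube_ind N i k) by exact: bdd_bool.
have cubeE k j : cube_ind N i k j = ((sheet j == i) && in_cell3 N k (q j))%:R.
  rewrite /cube_ind !cellP //=; [by case/andP: (f3 j)|by case/andP: (f2 j)|by case/andP: (f1 j)].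
have in_mem j : sheet j = i -> S (q j) -> ind j = 1.
  move=> si Sq; rewrite /ind mem_set//; exists (q j) => //.
  rewrite /chart3 /= chart_id; [|exact: f1|exact: f2].
  rewrite [fracpart (q j).2]fracpart_id; last exact: f3.
  by rewrite xE si.
have mem_in j : ind j = 0 \/ [\/ y1 j = 0, y2 j = 0 | sheet j = i /\ S (q j)].
  rewrite /ind; case: (boolP (_ \in _)) => [|_]; last by left.
  rewrite inE => -[p Sp pE]; right.
  have [[]] := Sb _ Sp; rewrite /= !in_itv /= => /andP[p1 p1'] /andP[p2 p2'] /andP[p3 p3'].
  move: pE; rewrite /chart3 fracpart_id ?p3// => -[cE zE].
  have frac01 (t : R) : 0 <= t -> t <= 1 -> fracpart t = 0 \/ 0 <= t < 1.
    move=> t0 t1; have [->|tn1] := eqVneq t 1.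
      by left; apply: (@fracpart_unique _ _ _ 1) => //; rewrite ?lexx ?ltr01// addr0.
    by right; rewrite t0 lt_neqAle tn1.
  have y1E : fracpart p.1.1 = y1 j by rewrite xE in cE; case: cE.
  have y2E : fracpart p.1.2 = y2 j by rewrite xE in cE; case: cE.
  have [h1|h1] := frac01 _ p1 p1'; first by apply: Or31; rewrite -y1E.
  have [h2|h2] := frac01 _ p2 p2'; first by apply: Or32; rewrite -y2E.
  apply: Or33; rewrite chart_id// xE in cE; case: cE => -> pE; split=> //.
  move: Sp; rewrite /q -zE (surjective_pairing p) pE /=.
  by [].
have ord3N (k k' : 'I_N.+1 * 'I_N.+1 * 'I_N.+1) (p : R * R * R) : in_cell3 N (ord3 k) p -> in_cell3 N (ord3 k') p -> k = k'.
  move=> /and3P[h1 h2 h3] /and3P[g1 g2 g3]; apply: ord3_inj.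
  rewrite [ord3 k]surjective_pairing [(ord3 k).1]surjective_pairing.
  by rewrite (in_cell_unique h1 g1) (in_cell_unique h2 g2) (in_cell_unique h3 g3).
have cubes_sum (p : pred ('I_N.+1 * 'I_N.+1 * 'I_N.+1)) j :
    \sum_(k | p k) cube_ind N i (ord3 k) j =
    ((sheet j == i) && [exists k, p k && in_cell3 N (ord3 k) (q j)])%:R.
  case: (boolP [exists k, _]) => [/existsP[k /andP[pk hk]]|/existsPn np].
    rewrite (bigD1 k)//= big1 ?addr0 ?cubeE ?hk// => k' /andP[_ k'k].
    rewrite cubeE; case: (boolP (in_cell3 N (ord3 k') (q j))) => [hk'|]; last by rewrite andbF.
    by rewrite (ord3N _ _ _ hk' hk) eqxx in k'k.
  rewrite big1 ?andbF// => k pk; rewrite cubeE.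
  by move: (np k); rewrite pk /= => /negPf ->; rewrite andbF.
pose c : R := (s%:R * N%:R ^+ 3)^-1.
have c0 : 0 < c by rewrite invr_gt0 mulr_gt0// exprn_gt0.
have mcube (k : 'I_N.+1 * 'I_N.+1 * 'I_N.+1) : m (cube_ind N i (ord3 k)) <= c.
  have [h|h] := boolP [&& (k.1.1 < N)%N, (k.1.2 < N)%N & (k.2 < N)%N].
    by case/and3P: h => h1 h2 h3; rewrite (mean_cube _ mm ud).
  rewrite (_ : cube_ind N i (ord3 k) = fun=> 0); first by rewrite (mean_cst mm) ltW.
  apply/funext => j; rewrite /cube_ind; case: and4P => // -[_ /eqP e1 /eqP e2 /eqP e3].
  have l1 := cell_lt N0 (f1 j); have l2 := cell_lt N0 (f2 j); have l3 := cell_lt N0 (f3 j).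
  by case/negP: h; apply/and3P; split; [move: l1; rewrite e1|move: l2; rewrite e2|move: l3; rewrite e3].
pose Z1 j : R := (y1 j == 0)%:R; pose Z2 j : R := (y2 j == 0)%:R.
have bZ1 : bdd Z1 by exact: bdd_bool.
have bZ2 : bdd Z2 by exact: bdd_bool.
pose cin := inner_cells3 S N; pose cout := outer_cells3 S N.
have lower : #|cin|%:R * c <= m ind.
  apply: (@le_trans _ _ (m (fun j => \sum_(k | k \in cin) cube_ind N i (ord3 k) j))).
    rewrite (mean_sum mm)//; rewrite mulr_natl -sumr_const; apply: ler_sum => k kin.
    have [h1 h2 h3] := inner_cells3_lt N0 Sb kin.
    by rewrite (mean_cube _ mm ud).
  apply: (mean_le mm) => [||j]; [exact: bdd_sum|exact: bind|].
  rewrite cubes_sum; case: andP => [[/eqP si /existsP[k /andP[/asboolP kin hk]]]|_].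
    by rewrite in_mem//; exact: kin.
  by rewrite /ind.
have upper : m ind <= #|cout|%:R * c.
  apply: (@le_trans _ _ (m (fun j => \sum_(k | k \in cout) cube_ind N i (ord3 k) j + (Z1 j + Z2 j)))).
    apply: (mean_le mm) => [||j]; [exact: bind|by apply: bddD; [exact: bdd_sum|bd]|].
    rewrite cubes_sum /Z1 /Z2; have [->|[->|->|[si Sq]]] := mem_in j.
    - by rewrite !addr_ge0.
    - rewrite eqxx -[ind j]add0r lerD//; apply: (@le_trans _ _ 1); first by rewrite lern1 leq_b1.
      by rewrite lerDl.
    - rewrite eqxx -[ind j]add0r lerD//; apply: (@le_trans _ _ 1); first by rewrite lern1 leq_b1.
      by rewrite lerDr.
    - have [k kout hk] := outer_cells3_cover N0 Sb Sq.
      have -> : [exists k, (k \in cout) && in_cell3 N (ord3 k) (q j)] by apply/existsP; exists k; rewrite kout.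
      by rewrite in_mem// si eqxx /= lerDl addr_ge0.
  rewrite (meanD mm); [|exact: bdd_sum|bd].
  rewrite (meanD mm)// /Z1 /Z2 !(rotation_zero_null _ mm)// !addr0.
  rewrite (mean_sum mm)// mulr_natl -sumr_const; apply: ler_sum => k _; exact: mcube.
have /andP[l1 l2] := lambda3_sandwich cS N0 Sb.
have hcard := outer_le_inner3 cS N0.
have scale (M : R) : M / N%:R ^+ 3 / s%:R = M * c.
  by rewrite -mulrA -invfM /c (mulrC (N%:R ^+ 3)).
have l1' : #|cin|%:R * c <= fine (lambda3 S) / s%:R by rewrite -scale ler_wpM2r// invr_ge0 ltW.
have l2' : fine (lambda3 S) / s%:R <= #|cout|%:R * c by rewrite -scale ler_wpM2r// invr_ge0 ltW.
have gap : #|cout|%:R * c - #|cin|%:R * c <= e.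
  rewrite -mulrBl.
  have h : #|cout|%:R - #|cin|%:R <= 200 * N%:R ^+ 2 :> R.
    by rewrite lerBlDl -natrX -natrM -natrD ler_nat.
  apply: (@le_trans _ _ (200 * N%:R ^+ 2 * c)); first by rewrite ler_wpM2r// ltW.
  rewrite /c ler_pdivrMr ?mulr_gt0 ?exprn_gt0//.
  have hN := truncnS_gt (200 / (s%:R * e)); rewrite -/N ltr_pdivrMr ?mulr_gt0// in hN.
  rewrite (_ : e * _ = N%:R * (s%:R * e) * N%:R ^+ 2); last by ring.
  by rewrite ler_wpM2r ?exprn_ge0 ?ltW.
by rewrite ler_norml; apply/andP; split; lra.
Qed.

End Orbit.
End Assembly.

(** * Projection and lifting *)

Section Projection.
Context {R : realType} {s : nat} (P : polysquare s).

(** A geodesic of the product is a geodesic of the surface together with a linear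
    motion on the circle; the singularities are the vertical lines over those of
    the surface, so that regularity is decided by the projection. *)
Lemma halfinf_geodesic3P (v : R * R) (w : R) (L3 : R -> surface_point R s * R) :
  halfinf_geodesic (regular_points3 P) (displace3 P) (v, w) L3 <->
  [/\ halfinf_geodesic (regular_points P) (displace P) v (fun t => (L3 t).1),
      0 <= (L3 0).2 < 1 & forall t, 0 <= t -> (L3 t).2 = fracpart ((L3 0).2 + t * w)].
Proof.
split=> [/halfinf_geodesicP h|[/halfinf_geodesicP hL h0 hz]].
  have z01 t : 0 <= t -> 0 <= (L3 t).2 < 1.
    by move=> /h[[_]]; rewrite /= in_itv.
  split; [|exact: z01|].
    apply/halfinf_geodesicP => t t0; have [[h1 _] [d d0 hd]] := h t t0; split=> //.
    by exists d => // t' t'0 /(hd t' t'0) ->.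
  apply: (frac_propagation (f := fun t => (L3 t).2)) => // t t0.
  have [_ [d d0 hd]] := h t t0; exists d => // t' t'0 /(hd t' t'0) ->.
  by [].
apply/halfinf_geodesicP => t t0; have [h1 [d d0 hd]] := hL t t0; split.
  by split=> //=; rewrite in_itv /= hz// fracpart_itv.
exists d => // t' t'0 tt'.
have e2 : (L3 t').2 = fracpart ((L3 t).2 + (t' - t) * w).
  rewrite (hz t')// (hz t)// fracpartDl; congr fracpart; ring.
by rewrite [LHS]surjective_pairing e2 (hd t' t'0 tt').
Qed.

End Projection.

Section Equivalence.
Context {R : realType} {s : nat} (P : polysquare s) (v1 v2 : R).
Hypothesis v10 : v1 != 0.

Lemma halfinf_kroneckerP x : halfinf_kronecker P (v1, v2) x <->
  exists L, halfinf_geodesic (regular_points P) (displace P) (v1, v2) L /\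
            forall j, x j = L j%:R.
Proof.
apply: kronecker_motion; rewrite sqrtr_gt0 /= ltr_wpDr ?sqr_ge0//.
by rewrite lt_neqAle eq_sym sqrf_eq0 v10 sqr_ge0.
Qed.

Lemma halfinf_kronecker3P w x : halfinf_kronecker3 P (v1, v2, w) x <->
  exists L, halfinf_geodesic (regular_points3 P) (displace3 P) (v1, v2, w) L /\
            forall j, x j = L j%:R.
Proof.
apply: kronecker_motion; rewrite sqrtr_gt0 /= ltr_wpDr ?sqr_ge0// ltr_wpDr ?sqr_ge0//.
by rewrite lt_neqAle eq_sym sqrf_eq0 v10 sqr_ge0.
Qed.

Lemma kronecker_lift w x : halfinf_kronecker P (v1, v2) x ->
  halfinf_kronecker3 P (v1, v2, w) (fun j => (x j, rotation_orbit 0 w j)).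
Proof.
move=> /halfinf_kroneckerP[L [hL hx]]; apply/halfinf_kronecker3P.
exists (fun t => (L t, fracpart (0 + t * w))); split; last by move=> j; rewrite hx.
have z0 : fracpart (0 + 0 * w) = 0 by rewrite mul0r addr0 fracpart_id// lexx ltr01.
apply/halfinf_geodesic3P; rewrite /= z0; split=> //; first by rewrite lexx ltr01.
Qed.

(** Test the orbit above against the cylinders over convex sets. *)
Lemma unif_distributed_base (x : nat -> surface_point R s) (z : nat -> R) : (forall j, 0 <= z j < 1) ->
  unif_distributed3 P (fun j => (x j, z j)) -> unif_distributed P x.
Proof.
move=> z01 ud3 i S cS Sb.
have := ud3 i (S `*` `[0, 1[)%classic (convex_cylinder cS).
rewrite (lambda3_cylinder cS Sb).
have -> : visit_freq (fun j => (x j, z j)) (chart3 P i @` (S `*` `[0, 1[))%classic =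
    visit_freq x (chart P i @` S)%classic :> (nat -> R).
  apply/funext => J; rewrite !visit_freqE; congr avg; apply/funext => j; congr ((nat_of_bool _)%:R).
  apply/idP/idP; rewrite !inE.
    by move=> [[p t] [Sp _] [<- _]]; exists p.
  move=> [p Sp px]; exists (p, z j); first by split=> //; rewrite /= in_itv /= z01.
  by rewrite /chart3 /= px fracpart_id.
by apply=> q [/Sb].
Qed.

End Equivalence.

Theorem theorem4 (R : realType) (s : nat) (P : polysquare s) (v1 v2 : R)
    (hv : lin_indep_rat [tuple v1; v2; 1]) :
  (forall x : nat -> surface_point R s,
     halfinf_kronecker P (v1, v2) x -> unif_distributed P x)
  <->
  (forall w : R, lin_indep_rat [tuple v1; v2; w; 1] ->
     forall x : nat -> surface_point R s * R,
       halfinf_kronecker3 P (v1, v2, w) x -> unif_distributed3 P x).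
Proof.
have v10 : v1 != 0.
  apply/negP => /eqP v10; have /lin_indep3P := hv.
  move=> /(_ 1 0 0); rewrite v10 !rmorph0 mulr0 mul0r !addr0 => /(_ erefl)[/eqP].
  by rewrite oner_eq0.
split=> [ud w hw x /(halfinf_kronecker3P _ _ v10)[L3 [/halfinf_geodesic3P[hL _ hz] hx]]|ud3 x hx].
  have -> : x = fun j => ((L3 j%:R).1, rotation_orbit (L3 0).2 w j).
    by apply/funext => j; rewrite hx [LHS]surjective_pairing hz.
  apply: (skew_unif_distributed hL _ hw); apply: ud; apply/halfinf_kroneckerP => //.
  by exists (fun t => (L3 t).1).
have [w hw] := exists_independent hv.
apply: (@unif_distributed_base R s P x (rotation_orbit 0 w)) => [j|]; first exact: fracpart_itv.
by apply: (ud3 w hw); exact: kronecker_lift.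
Qed.
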